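(* Consider the following two assertions, with all notation as defined in the context. **Assertion E (remainder vanishing conjecture).** Let $(a,b,m,n)\in\mathcal{Q}$, $\delta\in\Delta$, $i\in\mathcal{I}$, and let $S\in\mathcal{S}^w$, $E',F'\in\mathbb{C}[x,y]$, $\alpha'\in\mathbb{T}$ be such that the compatibility conditions (★) hold. Let $B\subseteq\{\beta\in[1,\mathfrak{m}]: r(e-\beta)/d\in\mathbb{Z}\}$ and let $\ell\in[\mathrm{u}_F,\mathrm{v}_F]$. Suppose that $B$ is supported with respect to $(S,E',F',\alpha')$ and that $P_1(S(\tilde{x}_j))=0$ for all $j\in[\ell+1,\mathrm{v}_F]$. If $E'$ is a principal polynomial, then either $P_1(S(\tilde{x}_\ell))=0$ or there exists a proper subset of $B$ which is supported with respect to $(S,E',F',\alpha')$. **Assertion D.** Let $(a,b,m,n)\in\mathcal{Q}$ and let $F,G\in\mathbb{C}[x,y]$ satisfy (1) $N^0(F)=T_{m,n}$ and $N^0(F-x^my^n)\subsetneq N^0(F)$; (2) $F^{(0,1)}_{n-i}$ is divisible by $(x+1)^{m-i}$ for $0\le i\le m$; (3) $F^{(1,1)}_{m+n-i}$ is divisible by $(x+y)^{n-i}$ for $0\le i\le n$; (4) $N^0(G)=T_{bm/a,bn/a}$ and $N^0(G-x^{bm/a}y^{bn/a})\subsetneq N^0(G)$; (5) $[F,G]\in\mathbb{C}$. Then: (i) Let $w=(0,1)$ and let $i$ be an integer in $[m(n-m)\frac{a-1}{a}+1,\,m(n-m)]$. If $F^\circ$ satisfies the $i$-th collection of $w$-DC,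 then $F^\circ$ satisfies the $(i-1)$-th collection of $w$-DC. (ii) Let $w=(1,1)$ and let $i$ be an integer in $[m(n-m)\frac{a-1}{a},\,m(n-m)]$. If $F^\circ$ satisfies the $i$-th collection of $w$-DC, then $F^\circ$ satisfies the $(i-1)$-th collection of $w$-DC. (iii) Let $i$ be an integer in $[1,\,m(n-m)\frac{a-1}{a}]$. If $F^\circ$ satisfies the $i$-th collection of DSC, then $F^\circ$ satisfies the $(i-1)$-th collection of DC. If Assertion E is true, then Assertion D is true.
   Context: **General notation.** $[r_1,r_2]$ for integers denotes $\{x\in\mathbb{Z}:r_1\le x\le r_2\}$; $[r]_+=\max(0,r)$. For $f,g\in\mathbb{C}[x,y]$, $[f,g]=\frac{\partial f}{\partial x}\frac{\partial g}{\partial y}-\frac{\partial g}{\partial x}\frac{\partial f}{\partial y}$. For $f=\sum f_{ij}x^iy^j\in\mathbb{C}[x,y]$, $\mathrm{supp}(f)=\{(i,j):f_{ij}\neq0\}\subset\mathbb{R}^2$; for $f\ne0$, $N^0(f)$ is the convex hull of $\mathrm{supp}(f)\cup\{(0,0)\}$, and $N^0(0)=\emptyset$. For integers $m,n$, $T_{m,n}=\{(x,y)\in\mathbb{R}^2: 0\le y\le n,\ 0\le x\le m+n-y\}$ (empty if $n<0$). $\mathcal{Q}=\{(a,b,m,n)\in\mathbb{Z}_{>0}^4: m<n,\ a\mid m,\ a\mid n,\ \gcd(a,b)=1,\ 2\le a<b\}$. For $w=(u,1)$ with $u\in\{0,1\}$, $f^w_j$ is the sum of the terms $f_{pq}x^py^q$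 of $f$ with $up+q=j$, and $w\text{-}\deg(f)$ is the largest $j$ with $f_j^w\ne0$ ($-\infty$ if $f=0$). $\varepsilon=\frac1{m(n-m)}$, $a_i=\lfloor(i+1)m\varepsilon\rfloor$, $b_i=\lfloor(i+1)m\varepsilon\rfloor+\lfloor i(n-m)\varepsilon\rfloor$. $\mathbb{T}$ is the set of polynomials $\alpha(z)=z^k+e_{k-1}z^{k-1}+\dots+e_0\in\mathbb{C}[z]$ with $k\ge1$ and $e_{k-1}=0$. For $f\in\mathbb{C}[x,y]$, $\mathcal{E}(f)=\{E\in\mathbb{C}[x,y]: f=\alpha(E)\text{ for some }\alpha\in\mathbb{T}\}$; $f$ is called principal if $\mathcal{E}(f)=\{f\}$. **Notation for Assertion D.** Let $(a,b,m,n)\in\mathcal{Q}$ and let $F$ satisfy (1)–(3). Put $\mathcal{N}'=\frac1aT_{m,n}$ and $\mathcal{N}''=\mathcal{N}'+\frac{a-1}{a}(m,n)$. There is a unique $Q\in\mathbb{C}[x,y]$ with $N^0(Q-x^{m/a}y^{n/a})\subsetneq N^0(Q)=\mathcal{N}'$ and $\mathrm{supp}(F-Q^a)\subseteq N^0(F)\setminus\mathcal{N}''$. There is a unique $\delta\in\mathbb{Z}_{>0}$ such that $N^0(E)=\frac{1}{\delta a}T_{m,n}$ for every principal $E\in\mathcal{E}(Q)$. $E^\circ$ is the unique principal polynomial in $\mathcal{E}(Q)$ whose coefficient at $x^{m/(a\delta)}y^{n/(a\delta)}$ is $1$. $\mathbb{T}_F=\{\alpha\in\mathbb{T}:\mathrm{supp}(F-\alpha(E^\circ))\subseteq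 N^0(F)\setminus\mathcal{N}''\}$ (nonempty); $\mathbb{V}_F=\{N^0(F-\alpha(E^\circ)):\alpha\in\mathbb{T}_F\}$, a finite set partially ordered by inclusion. For each such $F$ a minimal element $V^\circ\in\mathbb{V}_F$ and $\alpha^\circ\in\mathbb{T}_F$ with $V^\circ=N^0(F-\alpha^\circ(E^\circ))$ are fixed, and $F^\circ=F-\alpha^\circ(E^\circ)$. Divisibility: $f\mid g$ means $g/f$ is a (Laurent) polynomial; in particular any polynomial is divisible by $(x+1)^l$ and $(x+y)^l$ for $l\le0$. For $i\in\mathbb{Z}_{\ge0}$: $F^\circ$ satisfies the $i$-th collection of $(0,1)$-DC if $(x+1)^{j-\lfloor i(n-m)\varepsilon\rfloor}\mid(F^\circ)^{(0,1)}_j$ for each $j\in\mathbb{Z}$; of $(1,1)$-DC if $(x+y)^{j-\lfloor(i+1)m\varepsilon\rfloor}\mid(F^\circ)^{(1,1)}_j$ for each $j\in\mathbb{Z}$; of DC if both hold; of DSC if the $i$-th collection of DC holds and $\mathrm{supp}(F^\circ)\subseteq T_{a_i,b_i}$. **Notation for Assertion E.** Fix $(a,b,m,n)\in\mathcal{Q}$. $\Delta$ is the set of positive common divisors of $\frac ma$ and $\frac na$; fix $\delta\in\Delta$. $\mathcal{I}=\{i\in[0,m(n-m)]:\frac im\in\mathbb{Z}\text{ or }\frac{i+1}{n-m}\in\mathbb{Z}\}$; fix $i\in\mathcal{I}$ (the two possibilities are mutually exclusive). If $\frac im\in\mathbb{Z}$: $u=0$, $L=x+1$, $\mathrm{u}_E=\frac{n-m}{\delta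 a}$, $\mathrm{u}_F=\lfloor i(n-m)\varepsilon\rfloor$, $R_2=\mathbb{C}[x^{\pm1},y^{\pm1/m}]$. If $\frac{i+1}{n-m}\in\mathbb{Z}$: $u=1$, $L=x+y$, $\mathrm{u}_E=\frac{m}{\delta a}$, $\mathrm{u}_F=\lfloor(i+1)m\varepsilon\rfloor$, $R_2=\mathbb{C}[x^{\pm1/n},y^{\pm1}]$. Put $w=(u,1)$, $d=um+n$, $e=bd/a$, $\mathfrak{m}=d+e-u-2$, $\mathrm{v}_E=d/(\delta a)$, $r=\gcd(m,n)$, and - $\mathrm{v}_F=\mathrm{u}_F+\frac{(un-um+m)(a-1)}{a}-1$ if $i>\frac{m(n-m)(a-1)}{a}$; - $\mathrm{v}_F=ua_i+b_i-1$ if $i\le\frac{m(n-m)(a-1)}{a}$ and $\frac{a\delta\lfloor i(n-m)\varepsilon\rfloor}{n-m}=\frac{a\delta\lfloor(i+1)m\varepsilon\rfloor}{m}\in\mathbb{Z}$; - $\mathrm{v}_F=ua_i+b_i$ otherwise. Let $R_1=\mathbb{C}[\tilde\Gamma_0,\dots,\tilde\Gamma_{\mathrm{v}_E-1},\tilde x_0,\dots,\tilde x_{\mathrm{v}_F},\tilde c_1,\tilde c_2,\dots]$ (polynomial ring), and in $R_1[\tau]$ put $$\tilde F^\circ=\sum_{j=\mathrm{u}_F}^{\mathrm{v}_F}\tau^{j-\mathrm{u}_F}\tilde x_j+\sum_{j=0}^{\mathrm{u}_F-1}\tilde x_j,\qquad \tilde E^\circ=\tau^{\mathrm{v}_E-\mathrm{u}_E}+\sum_{j=\mathrm{u}_E}^{\mathrm{v}_E-1}\tau^{j-\mathrm{u}_E}\tilde\Gamma_j+\sum_{j=0}^{\mathrm{u}_E-1}\tilde\Gamma_j.$$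 $\mathcal{S}^w$ is the set of ring homomorphisms $S:R_1[\tau]\to R_2$ with $S(\tau)=(x+1)y^{n/m}$ if $w=(0,1)$, and $S(\tau)=x^{m/n}(x+y)$ if $w=(1,1)$. Such $S$ is extended to $R_1[\tau^{\pm1}]\to R_2[L^{-1}]$. Compatibility conditions (★) for $S\in\mathcal{S}^w$, $E',F'\in\mathbb{C}[x,y]$, $\alpha'\in\mathbb{T}$: $S(\tilde c_\beta)\in\mathbb{C}$ for all $\beta\in[1,\mathfrak{m}]$; $F'=S(\tilde F^\circ)$, $w\text{-}\deg(F')\le\mathrm{v}_F$, and $(F')^w_j=S(\tau^{[j-\mathrm{u}_F]_+}\tilde x_j)$ for $j\in[0,\mathrm{v}_F]$; $E'=S(\tilde E^\circ)$, $w\text{-}\deg(E')\le\mathrm{v}_E$, and $(E')^w_j=S(\tau^{[j-\mathrm{u}_E]_+}\tilde\Gamma_j)$ for $j\in[0,\mathrm{v}_E-1]$; $\deg(\alpha')=\delta a$. Grade $R_1[\tau]$ by $\deg(\tau)=n/m$ if $w=(0,1)$ and $\deg(\tau)=m/n+1$ if $w=(1,1)$, $\deg(\tilde\Gamma_j)=j-[j-\mathrm{u}_E]_+\deg(\tau)$, $\deg(\tilde x_j)=j-[j-\mathrm{u}_F]_+\deg(\tau)$. For a nonzero $f=\sum_{j\in\mathbb{Z}}f_j$ with all terms of integer degree ($f_j$ of degree $j$), let $\deg(f)=\max\{j:f_j\ne0\}$ and $h(f)=\sum_jf_jt^{\deg(f)-j}\in R_1[\tau,t]$. Put $H=h(\alpha'(\tilde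 E^\circ)+\tilde F^\circ)$; its $t^0$-coefficient is $\tau^N$ with $N=m$ if $u=0$ and $N=n$ if $u=1$. For rational $A$, writing $H=y_0+y_1t+\dots+y_{n'}t^{n'}$, the power $H^A$ is the power series in $t$ $$\sum_{v_1,\dots,v_{n'}\ge0}\frac{A(A-1)\cdots(A-\sum_jv_j+1)}{\prod_jv_j!}\,y_0^{A-\sum_jv_j}y_1^{v_1}\cdots y_{n'}^{v_{n'}}\,t^{v_1+2v_2+\cdots+n'v_{n'}},$$ with $y_0^{A}=\tau^{NA}$. $[\cdot]_{t^j}$ and $[\cdot]_{\tau^j}$ denote the coefficients of $t^j$ and of $\tau^j$. For $\mu\in[0,\mathfrak{m}]$ and $B\subseteq\{\beta\in[1,\mathfrak{m}]:r(e-\beta)/d\in\mathbb{Z}\}$, put $$\tilde G_{B,e-\mu}=[H^{e/d}]_{t^\mu}+\sum_{\beta\in B\cap[1,\mu]}\tilde c_\beta[H^{(e-\beta)/d}]_{t^{\mu-\beta}}\in R_1[\tau^{\pm1}],$$ $\mathfrak{j}(\mu)=\min\{\mathfrak{j}\in\mathbb{Z}_{\ge0}:[\tilde G_{B,e-\mu}]_{\tau^{-j}}=0\text{ for all }j>\mathfrak{j}\}$, and for $k\in[1,\mathfrak{j}(\mu)]$ $$\tilde G_{B,e-\mu,k}=\sum_{j=\mathfrak{j}(\mu)+1-k}^{\mathfrak{j}(\mu)}\tau^{\mathfrak{j}(\mu)-j}[\tilde G_{B,e-\mu}]_{\tau^{-j}}\in R_1[\tau].$$ For $k\ge0$, $P_k:R_2\to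 R_2/(L^k)$ is the natural projection. $B$ is supported with respect to $(S,E',F',\alpha')$ if $P_k(S(\tilde G_{B,e-\mu,k}))=0$ for all $\mu\in[0,\mathfrak{m}]$ and $k\in[1,\mathfrak{j}(\mu)]$, and $S(\tilde G_{B,e-\mu})=0$ for all $\mu\in[e+1,\mathfrak{m}]$. *)

(* Defs.v *)
From HB Require Import structures.
From mathcomp Require Import all_boot all_order all_algebra.
From mathcomp Require Import finmap.
From mathcomp Require Import complex.
From mathcomp Require Import boolp classical_sets reals convex.
From mathcomp Require Import monalg.

Set Implicit Arguments.
Unset Strict Implicit.
Unset Printing Implicit Defensive.

Import Order.TTheory GRing.Theory Num.Theory.

Local Open Scope ring_scope.
Local Open Scope classical_set_scope.

(* The complex numbers are [R[i]] for [R : realType].  An element of C[x, y] is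
   an [f : {poly {poly R[i]}}]: the outer variable is y, the inner one is x, so
   the coefficient of f at x^p y^q is [f`_q`_p].  A weight w = (u, 1), with u in
   {0, 1}, is given by the boolean u. *)

Section Plane.
Variable R : realType.
Local Notation pol2 := {poly {poly R[i]}}.
Local Notation plane := (R^o * R^o)%type.

Definition monom2 (p q : nat) : pol2 := ('X^p)%:P * 'X^q.
Definition const2 (c : R[i]) : pol2 := c%:P%:P.

Definition supp (f : pol2) : set plane :=
  [set z | exists p q : nat, f`_q`_p != 0 /\ z = (p%:R, q%:R)].

Definition convex_hull (A : set plane) : set plane :=
  smallest (@convex_set R plane) A.

Definition N0 (f : pol2) : set plane :=
  if f == 0 then set0 else convex_hull (supp f `|` [set (0, 0)]).

Definition trapezoid (m n : int) : set plane :=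
  [set z | 0 <= z.2 <= n%:~R /\ 0 <= z.1 <= (m + n)%:~R - z.2].

Definition dilate (c : R) (A : set plane) : set plane :=
  [set c *: z | z in A].

Definition translate (v : plane) (A : set plane) : set plane :=
  [set z + v | z in A].

Definition jacobian (f g : pol2) : pol2 :=
  map_poly (@deriv _) f * g^`() - map_poly (@deriv _) g * f^`().

Definition wpart (u : bool) (j : int) (f : pol2) : pol2 :=
  \sum_(q < size f) \sum_(p < size f`_q | (u * p + q)%N%:Z == j)
    (f`_q`_p *: 'X^p)%:P * 'X^q.

Definition wdeg_le (u : bool) (f : pol2) (k : int) : Prop :=
  forall j : int, k < j -> wpart u j f = 0.

Definition linf (u : bool) : pol2 :=
  'X%:P + (if u then 'X else 1).

Definition pospart (l : int) : nat := `|(Num.max 0 l)%R|%N.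

(* g / f^l is a polynomial, for a possibly negative integer l *)
Definition dvd_pow (f : pol2) (l : int) (g : pol2) : Prop :=
  exists h : pol2, g * f ^+ pospart (- l) = h * f ^+ pospart l.

Definition inT (alpha : {poly R[i]}) : Prop :=
  [/\ alpha \is monic, (1 < size alpha)%N & alpha`_(size alpha).-2 = 0].

Definition subst2 (alpha : {poly R[i]}) (E : pol2) : pol2 :=
  (map_poly const2 alpha).[E].

Definition calE (f : pol2) : set pol2 :=
  [set E | exists2 alpha, inT alpha & f = subst2 alpha E].

Definition principal (f : pol2) : Prop := calE f = [set f].

End Plane.

Definition calQ (a b m n : nat) : Prop :=
  [/\ (0 < a)%N, (0 < b)%N, (0 < m)%N & (0 < n)%N] /\
  [/\ (m < n)%N, (a %| m)%N, (a %| n)%N, coprime a b & (2 <= a < b)%N].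

Definition eps (m n : nat) : rat := ((m * (n - m))%N%:R)^-1.

(* floor ((i + 1) m eps) and floor (i (n - m) eps); both are nonnegative *)
Definition fl1 (m n i : nat) : nat := Num.truncn ((i.+1 * m)%N%:R * eps m n).
Definition fl0 (m n i : nat) : nat :=
  Num.truncn ((i * (n - m))%N%:R * eps m n).

Definition seqa (m n i : nat) : nat := fl1 m n i.
Definition seqb (m n i : nat) : nat := (fl1 m n i + fl0 m n i)%N.

(* m (n - m) (a - 1) / a, an integer when a divides m *)
Definition threshold (a m n : nat) : nat := (m * (n - m) * (a - 1) %/ a)%N.

Definition uF (m n i : nat) (u : bool) : nat :=
  if u then fl1 m n i else fl0 m n i.

Section AssertionD.
Variable R : realType.
Local Notation pol2 := {poly {poly R[i]}}.

Definition condF (m n : nat) (F : pol2) : Prop :=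
  [/\ N0 F = trapezoid m n /\ N0 (F - monom2 R m n) `<` N0 F,
      forall i : nat, (i <= m)%N ->
        dvd_pow (linf R false) (m%:Z - i%:Z) (wpart false (n%:Z - i%:Z) F)
    & forall i : nat, (i <= n)%N ->
        dvd_pow (linf R true) (n%:Z - i%:Z)
                (wpart true (m%:Z + n%:Z - i%:Z) F)].

Definition condG (a b m n : nat) (F G : pol2) : Prop :=
  [/\ N0 G = trapezoid (b * m %/ a)%N (b * n %/ a)%N,
      N0 (G - monom2 R (b * m %/ a) (b * n %/ a)) `<` N0 G
    & exists c : R[i], jacobian F G = const2 c].

Definition calN1 (a m n : nat) : set (R^o * R^o) :=
  dilate a%:R^-1 (trapezoid m n).

Definition calN2 (a m n : nat) : set (R^o * R^o) :=
  translate ((a - 1)%N%:R / a%:R * m%:R, (a - 1)%N%:R / a%:R * n%:R)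
            (calN1 a m n).

Definition isQ (a m n : nat) (F Q : pol2) : Prop :=
  [/\ N0 (Q - monom2 R (m %/ a) (n %/ a)) `<` N0 Q,
      N0 Q = calN1 a m n
    & supp (F - Q ^+ a) `<=` N0 F `\` calN2 a m n].

Definition isDelta (a m n : nat) (Q : pol2) (delta : nat) : Prop :=
  (0 < delta)%N /\
  forall E : pol2, principal E -> calE Q E ->
    N0 E = dilate ((delta * a)%N%:R^-1) (trapezoid m n).

Definition isEcirc (a m n : nat) (Q : pol2) (delta : nat) (E : pol2) : Prop :=
  [/\ principal E, calE Q E
    & E`_(n %/ (a * delta))`_(m %/ (a * delta)) = 1].

Definition TF (a m n : nat) (F Ecirc : pol2) : set {poly R[i]} :=
  [set alpha | inT alpha /\
     supp (F - subst2 alpha Ecirc) `<=` N0 F `\` calN2 a m n].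

Definition VF (a m n : nat) (F Ecirc : pol2) : set (set (R^o * R^o)) :=
  [set N0 (F - subst2 alpha Ecirc) | alpha in TF a m n F Ecirc].

(* Q, delta and Ecirc are determined by F, but V and alpha are not: Fcirc is any
   polynomial obtained from an admissible choice of them *)
Definition isFcirc (a m n : nat) (F Fcirc : pol2) : Prop :=
  exists (Q : pol2) (delta : nat) (Ecirc : pol2)
         (V : set (R^o * R^o)) (alpha : {poly R[i]}),
    [/\ isQ a m n F Q, isDelta a m n Q delta & isEcirc a m n Q delta Ecirc] /\
    [/\ VF a m n F Ecirc V,
        forall V', VF a m n F Ecirc V' -> V' `<=` V -> V' = V,
        TF a m n F Ecirc alpha,
        V = N0 (F - subst2 alpha Ecirc)
      & Fcirc = F - subst2 alpha Ecirc].

Definition wDC (m n : nat) (u : bool) (i : nat) (f : pol2) : Prop :=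
  forall j : int, dvd_pow (linf R u) (j - (uF m n i u)%:Z) (wpart u j f).

Definition DC (m n i : nat) (f : pol2) : Prop :=
  wDC m n false i f /\ wDC m n true i f.

Definition DSC (m n i : nat) (f : pol2) : Prop :=
  DC m n i f /\ supp f `<=` trapezoid (seqa m n i) (seqb m n i).

Definition AssertionD : Prop :=
  forall (a b m n : nat) (F G Fcirc : pol2),
    calQ a b m n -> condF m n F -> condG a b m n F G ->
    isFcirc a m n F Fcirc ->
  [/\ forall i : nat, (threshold a m n + 1 <= i <= m * (n - m))%N ->
        wDC m n false i Fcirc -> wDC m n false (i - 1) Fcirc,
      forall i : nat, (threshold a m n <= i <= m * (n - m))%N ->
        wDC m n true i Fcirc -> wDC m n true (i - 1) Fcirc
    & forall i : nat, (1 <= i <= threshold a m n)%N ->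
        DSC m n i Fcirc -> DC m n (i - 1) Fcirc].

End AssertionD.

Section Graded.
Variables (R : realType) (I : choiceType) (degI : I -> rat) (degtau : rat).
Local Notation R1 := {malg R[i][{cmonom I}]}.

(* The degree of tau^k M, for M a monomial of R1 *)
Definition tmdeg (k : nat) (M : {cmonom I}) : rat :=
  k%:R * degtau + \sum_(g <- finsupp M) (M g)%:R * degI g.

Definition tdegs (f : {poly R1}) : seq rat :=
  [seq tmdeg k M | k <- iota 0 (size f), M <- enum_fset (msupp f`_k)].

Definition hcomp (q : rat) (f : {poly R1}) : {poly R1} :=
  \sum_(k < size f) \sum_(M <- msupp f`_k | tmdeg k M == q)
    (<< mcoeff M f`_k *g M >>)%:P * 'X^k.

Definition hdeg (f : {poly R1}) : rat :=
  \big[Num.max/head 0 (tdegs f)]_(q <- tdegs f) q.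

(* The outer variable of the result is t, the inner one tau; the exponents of t
   are exact when all the terms of f have integer degree *)
Definition hpoly (f : {poly R1}) : {poly {poly R1}} :=
  \sum_(q <- undup (tdegs f)) (hcomp q f)%:P * 'X^(Num.truncn (hdeg f - q)).

End Graded.

Section AssertionE.
Variable R : realType.
Local Notation C := R[i].
Local Notation pol2 := {poly {poly R[i]}}.

Section Rings.
Variables (a b m n delta i : nat) (u : bool).

Definition Ed : nat := (u * m + n)%N.
Definition Ee : nat := (b * Ed %/ a)%N.
Definition Em : nat := (Ed + Ee - u - 2)%N.
Definition Er : nat := gcdn m n.

Definition uE : nat :=
  if u then (m %/ (delta * a))%N else ((n - m) %/ (delta * a))%N.
Definition vE : nat := (Ed %/ (delta * a))%N.

(* vF may be equal to -1, whence its type *)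
Definition vF : int :=
  if (threshold a m n < i)%N then
    (uF m n i u)%:Z + ((u * n - u * m + m) * (a - 1) %/ a)%N%:Z - 1
  else
    let q0 : rat := (a * delta * fl0 m n i)%N%:R / (n - m)%N%:R in
    let q1 : rat := (a * delta * fl1 m n i)%N%:R / m%:R in
    let v := (u * seqa m n i + seqb m n i)%N%:Z in
    if (q0 == q1) && (q1 \is a Num.int) then v - 1 else v.

Definition nF : nat := `|(vF + 1)%R|%N.

(* The variables Gamma_j (0 <= j < vE), x_j (0 <= j <= vF) and c_1, c_2, ...;
   the latter are numbered from 0 in the third summand. *)
Definition gen : choiceType := ('I_vE + 'I_nF + nat)%type.

Definition R1 : comAlgType C := {malg C[{cmonom gen}]}.
Definition var (g : gen) : R1 := << ucm g >>.
Definition varG (j : 'I_vE) : R1 := var (inl (inl j)).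
Definition varx (j : 'I_nF) : R1 := var (inl (inr j)).
Definition varc (beta : nat) : R1 := var (inr beta.-1).

(* The variable of {poly R1} is tau *)
Definition tF : {poly R1} :=
  \sum_(j < nF | (uF m n i u <= j)%N) 'X^(j - uF m n i u) * (varx j)%:P +
  \sum_(j < nF | (j < uF m n i u)%N) (varx j)%:P.

Definition tE : {poly R1} :=
  'X^(vE - uE) + \sum_(j < vE | (uE <= j)%N) 'X^(j - uE) * (varG j)%:P +
  \sum_(j < vE | (j < uE)%N) (varG j)%:P.

(* R2 is the ring of Laurent polynomials in X, Y, with X = x, Y = y^(1/m) if
   u = 0 and X = x^(1/n), Y = y if u = 1.  It is taken inside the field C(X, Y)
   of fractions of C[X][Y], which contains R2[1/L] as well. *)
Definition frac2 : fieldType := {fraction pol2}.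

Definition inR2 (f : frac2) : Prop :=
  exists (k : nat) (p : pol2), f * tofrac ('X%:P * 'X) ^+ k = tofrac p.

(* The inclusion of C[x, y] in R2 *)
Definition embR2 (f : pol2) : frac2 :=
  tofrac (map_poly (comp_poly 'X^(if u then n else 1%N)) f
            \Po 'X^(if u then 1%N else m)).

Definition L2 : frac2 := embR2 (linf R u).

(* The kernel of P_k : R2 -> R2 / (L^k) *)
Definition Pzero (k : nat) (f : frac2) : Prop :=
  exists2 g, inR2 g & f = L2 ^+ k * g.

(* (x + 1) y^(n/m) for u = 0 and x^(m/n) (x + y) for u = 1 *)
Definition tau2 : frac2 :=
  if u then tofrac ('X^m)%:P * L2 else L2 * tofrac 'X^n.

Definition inS (S : {rmorphism {poly R1} -> frac2}) : Prop :=
  (forall p, inR2 (S p)) /\ S 'X = tau2.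

(* R1[tau, 1/tau], as the R1-module of finitely supported families of elements
   of R1 indexed by the exponents of tau *)
Definition laurent : lmodType R1 := {malg R1[int]}.

Definition tshift (z : int) (p : {poly R1}) : laurent :=
  \sum_(k < size p) << p`_k *g k%:Z + z >>.

(* The extension of S to R1[tau, 1/tau] *)
Definition Sext (S : {rmorphism {poly R1} -> frac2}) (g : laurent) : frac2 :=
  \sum_(z <- msupp g) S (mcoeff z g)%:P * S 'X ^ z.

Definition const_frac (c : C) : frac2 := tofrac (const2 c).

Definition compatible (S : {rmorphism {poly R1} -> frac2}) (E' F' : pol2)
    (alpha' : {poly C}) : Prop :=
  [/\ forall beta : nat, (1 <= beta <= Em)%N ->
        exists c : C, S (varc beta)%:P = const_frac c,
      [/\ embR2 F' = S tF, wdeg_le u F' vF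
        & forall j : 'I_nF, embR2 (wpart u j F') =
            S ('X^(pospart (j%:Z - (uF m n i u)%:Z)) * (varx j)%:P)],
      [/\ embR2 E' = S tE, wdeg_le u E' vE
        & forall j : 'I_vE, embR2 (wpart u j E') =
            S ('X^(pospart (j%:Z - uE%:Z)) * (varG j)%:P)]
    & size alpha' = (delta * a).+1].

Definition degtau : rat :=
  if u then m%:R / n%:R + 1 else n%:R / m%:R.

(* The variables c_beta do not occur in H; their degree is irrelevant. *)
Definition deggen (g : gen) : rat :=
  match g with
  | inl (inl j) => j%:R - (pospart (j%:Z - uE%:Z))%:R * degtau
  | inl (inr j) => j%:R - (pospart (j%:Z - (uF m n i u)%:Z))%:R * degtau
  | inr _ => 0
  end.

Definition scal (c : C) : R1 := c%:A.

Definition polyH (alpha' : {poly C}) : {poly {poly R1}} :=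
  @hpoly R gen deggen degtau
    ((map_poly (fun c => (scal c)%:P) alpha').[tE] + tF).

Definition EN : nat := if u then n else m.

(* [H^A]_{t^mu}: v ranges over the exponents (v_1, ..., v_n') such that
   v_1 + 2 v_2 + ... + n' v_n' = mu (so that v_j <= mu), with v_(j+1) = v j, and
   y_0^(A - sum_j v_j) is tau^(N (A - sum_j v_j)) *)
Definition Hpow (H : {poly {poly R1}}) (A : rat) (mu : nat) : laurent :=
  \sum_(v : {ffun 'I_(size H).-1 -> 'I_mu.+1} | (\sum_(j < (size H).-1) j.+1 * v j)%N == mu)
    let s := (\sum_j v j)%N in
    let c : rat := (\prod_(l < s) (A - l%:R)) / (\prod_j (v j)`!)%N%:R in
    tshift (Num.floor (EN%:R * (A - s%:R)))
           ((scal (ratr c))%:P * \prod_(j < (size H).-1) H`_j.+1 ^+ v j).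

Definition tG (H : {poly {poly R1}}) (B : {fset nat}) (mu : nat) : laurent :=
  Hpow H (Ee%:R / Ed%:R) mu +
  \sum_(beta <- B | (1 <= beta <= mu)%N)
    varc beta *: Hpow H ((Ee%:R - beta%:R) / Ed%:R) (mu - beta).

Definition pole_le (g : laurent) (k : nat) : bool :=
  all (fun z : int => - k%:Z <= z) (enum_fset (msupp g)).

Lemma pole_leP (g : laurent) (k : nat) :
  pole_le g k <-> forall j : nat, (k < j)%N -> mcoeff (- j%:Z) g = 0.
Proof.
split=> [/allP gk j kj|g0].
  apply/eqP; rewrite mcoeff_eq0; apply/negP => /gk.
  by rewrite lerN2 lez_nat leqNgt kj.
apply/allP => z zg; case: (leP (- k%:Z) z) => // zk.
have z0 : z = - `|z|%N%:Z.
  by rewrite abszE ltr0_norm ?opprK// (lt_le_trans zk)// oppr_le0.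
have : mcoeff z g != 0 by rewrite mcoeff_neq0.
by rewrite z0 g0 ?eqxx// -ltz_nat -ltrN2 -z0.
Qed.

Lemma pole_ex (g : laurent) : exists k, pole_le g k.
Proof.
exists (\sum_(z <- msupp g) `|z|)%N; apply/allP => z zg.
rewrite lerNl; apply: (@le_trans _ _ `|z|%N%:Z).
  by rewrite abszE -normrN ler_norm.
by rewrite lez_nat (big_rem z)//= leq_addr.
Qed.

Definition pole (g : laurent) : nat := ex_minn (pole_ex g).

(* G_{B, e - mu, k}, for g = G_{B, e - mu} *)
Definition ppart (g : laurent) (k : nat) : {poly R1} :=
  \sum_((pole g).+1 - k <= j < (pole g).+1)
    'X^(pole g - j) * (mcoeff (- j%:Z) g)%:P.

Definition supported (S : {rmorphism {poly R1} -> frac2})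
    (alpha' : {poly C}) (B : {fset nat}) : Prop :=
  let G := tG (polyH alpha') B in
  (forall mu k : nat, (mu <= Em)%N -> (1 <= k <= pole (G mu))%N ->
     Pzero k (S (ppart (G mu) k))) /\
  (forall mu : nat, (Ee + 1 <= mu <= Em)%N -> Sext S (G mu) = 0).

Definition admissibleB (B : {fset nat}) : Prop :=
  forall beta, beta \in B ->
    (1 <= beta <= Em)%N /\
    Er%:R * (Ee%:R - beta%:R) / Ed%:R \is a @Num.int rat.

End Rings.

(* For u = 0 the condition is i / m in Z, for u = 1 it is (i + 1) / (n - m) in Z;
   at most one of them holds when (a, b, m, n) is in calQ *)
Definition inI (m n i : nat) (u : bool) : Prop :=
  (i <= m * (n - m))%N /\ if u then (n - m %| i.+1)%N else (m %| i)%N.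

Definition AssertionE : Prop :=
  forall (a b m n delta i : nat) (u : bool),
    calQ a b m n ->
    [/\ (0 < delta)%N, (delta %| m %/ a)%N & (delta %| n %/ a)%N] ->
    inI m n i u ->
  forall (S : {rmorphism {poly R1 a m n delta i u} -> frac2})
         (E' F' : pol2) (alpha' : {poly C}),
    inS S -> inT alpha' ->
    compatible b S E' F' alpha' ->
  forall (B : {fset nat}) (l : 'I_(nF a m n delta i u)),
    admissibleB a b m n u B ->
    (uF m n i u <= l)%N ->
    supported b S alpha' B ->
    (forall j : 'I_(nF a m n delta i u), (l < j)%N ->
       Pzero m n u 1 (S (varx j)%:P)) ->
    principal E' ->
    Pzero m n u 1 (S (varx l)%:P) \/
    exists B' : {fset nat}, (B' `<` B)%fset /\ supported b S alpha' B'.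

End AssertionE.

(* Main.v *)
Require Import Defs.
From HB Require Import structures.
From mathcomp Require Import all_boot all_order all_algebra.
From mathcomp Require Import finmap complex boolp classical_sets reals convex monalg.
From mathcomp Require Import interval_inference.
From mathcomp Require Import ring lra zify.

(** Fix a weight $w = (u, 1)$. The coordinate change [straight] makes $L$ the first
coordinate $s$ and turns the component of $w$-degree $j$ of a polynomial into the
coefficient of $T^j$. The $i$-th collection of $w$-DC then says that the
coefficient of $T^j$ in the image of $F^\circ$ is divisible by $s^{j-c}$, where
$c$ is $\mathrm{u}_F$ ([slope_le], [wDC_slope]). When $i$ is replaced by $i-1$,
$c$ drops, and then by one, exactly if $i\in\mathcal I$ with the given $u$
([uF_pred]). So all three claims reduce to one: if $i\in\mathcal I$, the constant
terms of the quotients by $s^{j-c}$ vanish. For a suitable $S$ this means that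
$P_1(S(\tilde x_j))=0$ for $j\ge c$.

That homomorphism exists as soon as $w$-deg$(F^\circ)\le\mathrm{v}_F$ and
$E^\circ$ has slope $\mathrm{u}_E$: it sends $\tilde\Gamma_j$ and $\tilde x_j$ to
the quotients of the components of $E^\circ$ and $F^\circ$ by powers of $\tau$
([realize]), and it is homogeneous, so it maps the coefficients of $H$ to the
components of $F$ ([realize_polyH]). A supported $B$ comes from $G$. Reversing
the powers of $T$ and scaling, $F$ becomes $s^N(1+w)$ and the condition
$[F,G]\in\mathbb C$ becomes a linear differential equation for $G$ to high order.
Its solutions are the combinations, with constant coefficients $c_\beta$, of
the products of monomials with $(1+w)^{(e-\beta)/d}$ ([magnus_expansion]). If
$S(\tilde c_\beta)=c_\beta$ and $B=\{\beta : c_\beta\ne0\}$, the $S$-value of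
$\tilde G_{B,e-\mu}$ is the component of degree $e-\mu$ of the polynomial $G$,
which is zero for $\mu>e$; hence $B$ is supported ([supported_exists]). A minimal
supported subset of $B$ excludes the second alternative of Assertion E, and a
descending induction on $\ell$ yields the claim ([remainder_vanishing]).

It remains to check the hypotheses. Since $\alpha(E^\circ)=F-F^\circ$ and
$\alpha$ is monic, the slope of $E^\circ$ follows from those of $F$ and $F^\circ$
([slope_le_root]). For $i$ above the threshold, the high rows of $F^\circ$ are
short because its support avoids $\mathcal N''$, and a short row that is
divisible by a high power of $x+1$ is zero ([size_below_x]). For $w=(1,1)$ the
same argument applies once the $(0,1)$-DC are known at the threshold
([size_below_y]); claim (i) brings them down from $i=m(n-m)$, where a row by row
comparison of $F$ with $\alpha(E^\circ)$ proves them ([slope_initial]). For $i$ up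
to the threshold, the support condition of DSC gives the bound, except that one
more must be gained when $T_{a_i,b_i}$ is a multiple of $N^0(E^\circ)$. There the
coefficient of $F^\circ$ at the corner of $T_{a_i,b_i}$ is zero, since otherwise
subtracting a multiple of a power of $E^\circ$ would shrink $N^0(F^\circ)$, in
spite of the minimality of $V^\circ$ ([minimal_corner]). *)

Set Implicit Arguments.
Unset Strict Implicit.
Unset Printing Implicit Defensive.
Import Order.TTheory GRing.Theory Num.Theory.
Local Open Scope ring_scope.

(** * Binomial series and the multinomial theorem *)

Section Vanishing.
Variable K : comNzRingType.
Implicit Types p q : {poly K}.

Definition ord_ge (n : nat) p : Prop := exists q, p = q * 'X^n.

Lemma ord_geP n p : ord_ge n p <-> forall i, (i < n)%N -> p`_i = 0.
Proof.
split=> [[q ->] i ltin|p0]; first by rewrite coefMXn ltin.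
exists (\poly_(i < size p) p`_(i + n)); apply/polyP=> i.
rewrite coefMXn; case: ltnP => [/p0//|leni]; rewrite coef_poly subnK//.
by case: ltnP => // lepi; rewrite nth_default// (leq_trans lepi)// leq_subr.
Qed.

Lemma ord_ge0 n : ord_ge n 0.
Proof. by exists 0; rewrite mul0r. Qed.

Lemma ord_geD n p q : ord_ge n p -> ord_ge n q -> ord_ge n (p + q).
Proof. by move=> [p' ->] [q' ->]; exists (p' + q'); rewrite mulrDl. Qed.

Lemma ord_geN n p : ord_ge n p -> ord_ge n (- p).
Proof. by move=> [p' ->]; exists (- p'); rewrite mulNr. Qed.

Lemma ord_geB n p q : ord_ge n p -> ord_ge n q -> ord_ge n (p - q).
Proof. by move=> np nq; apply/ord_geD/ord_geN. Qed.

Lemma ord_geM a b p q : ord_ge a p -> ord_ge b q -> ord_ge (a + b) (p * q).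
Proof. by move=> [p' ->] [q' ->]; exists (p' * q'); rewrite exprD mulrACA. Qed.

Lemma ord_geMl n p q : ord_ge n q -> ord_ge n (p * q).
Proof. by move=> [q' ->]; exists (p * q'); rewrite mulrA. Qed.

Lemma ord_geMr n p q : ord_ge n p -> ord_ge n (p * q).
Proof. by rewrite mulrC; exact: ord_geMl. Qed.

Lemma ord_geX a k p : ord_ge a p -> ord_ge (k * a) (p ^+ k).
Proof.
by move=> [q ->]; exists (q ^+ k); rewrite exprMn -exprM mulnC.
Qed.

Lemma ord_geW a b p : (a <= b)%N -> ord_ge b p -> ord_ge a p.
Proof.
by move=> leab [q ->]; exists (q * 'X^(b - a)); rewrite -mulrA -exprD subnK.
Qed.

Lemma ord_ge_sum n (I : Type) (r : seq I) (P : pred I) (F : I -> {poly K}) :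
  (forall i, P i -> ord_ge n (F i)) -> ord_ge n (\sum_(i <- r | P i) F i).
Proof.
move=> nF; elim/big_rec: _ => [|i x Pi nx]; first exact: ord_ge0.
by apply: ord_geD => //; exact: nF.
Qed.

(** As [1 + q] is invertible as a power series, it does not affect the
order of vanishing; polynomials having no such inverse, the order of [p] is
raised one step at a time. *)
Lemma ord_ge1D_cancel n p q : ord_ge 1 q -> ord_ge n ((1 + q) * p) -> ord_ge n p.
Proof.
move=> q1 np; elim: n np => [_|n IH np]; first by exists p; rewrite mulr1.
have {}IH : ord_ge n p by apply: IH; exact: ord_geW np.
have -> : p = (1 + q) * p - q * p by rewrite mulrDl mul1r addrK.
by apply: ord_geB => //; exact: (ord_geM q1 IH).
Qed.

End Vanishing.

Section Multinomial.
Variables (C : numFieldType) (K : comNzRingType) (iota : {rmorphism C -> K}).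

Definition texp (M : nat) (x : K) : {poly K} :=
  \poly_(k < M.+1) (iota (k`!%:R^-1) * x ^+ k).

(** Coefficient of $t^s$ in
$\prod_j\exp(x_jt)=\exp(\sum_jx_jt)$, which proves the multinomial theorem
below. *)
Lemma coef_prod_texp n M s (x : 'I_n -> K) : (s <= M)%N ->
  (\prod_(j < n) texp M (x j))`_s = iota (s`!%:R^-1) * (\sum_(j < n) x j) ^+ s.
Proof.
elim: n s x => [|n IH] s x lesM.
  rewrite !big_ord0 coef1 expr0n; case: s lesM => [|s] _ /=.
    by rewrite ?fact0 ?invr1 ?rmorph1 ?mulr1.
  by rewrite mulr0.
rewrite !big_ord_recr/= coefMr.
set X := \sum_(j < n) _; set y := x ord_max.
rewrite exprDn mulr_sumr; apply: eq_bigr => i _.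
have leis : (i <= s)%N by rewrite -ltnS.
have lesi : (s - i <= s)%N by rewrite leq_subr.
rewrite IH; last exact: leq_trans lesM.
rewrite coef_poly ltnS (leq_trans leis lesM) mulrACA -rmorphM/=.
suff -> : iota ((s - i)`!%:R^-1 / i`!%:R) = iota s`!%:R^-1 * 'C(s, i)%:R.
  by rewrite -mulrA mulr_natl -mulrnAr.
rewrite -(rmorph_nat iota) -rmorphM/=; congr (iota _).
have := bin_fact leis; set b := 'C(s, i) => /(congr1 (fun k => k%:R : C)).
rewrite !natrM => <-.
have nz k : k`!%:R != 0 :> C by rewrite pnatr_eq0 -lt0n fact_gt0.
have bnz : b%:R != 0 :> C by rewrite pnatr_eq0 -lt0n bin_gt0.
by field; rewrite !nz bnz.
Qed.

(** The bound [M] on the exponents is free above [s], so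
that powers of several degrees can be summed over one index set. *)
Lemma exp_sum_multinomial n M s (x : 'I_n -> K) : (s <= M)%N ->
  (\sum_(j < n) x j) ^+ s =
  \sum_(v : {ffun 'I_n -> 'I_M.+1} | (\sum_j v j)%N == s)
     iota (s`!%:R / (\prod_j (v j)`!)%N%:R) * \prod_j x j ^+ v j.
Proof.
move=> lesM; have := coef_prod_texp x lesM.
have nz k : k`!%:R != 0 :> C by rewrite pnatr_eq0 -lt0n fact_gt0.
move=> /(congr1 (fun z => iota s`!%:R * z)).
rewrite mulrA -rmorphM divff// rmorph1 mul1r => <-.
under eq_bigr do rewrite /texp poly_def.
rewrite bigA_distr_bigA coef_sum mulr_sumr [RHS]big_mkcond/=.
apply: eq_bigr => v _.
rewrite scaler_prod prodrXr coefZ coefXn big_split/= -rmorph_prod/=.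
rewrite natr_prod -prodfV rmorphM/= eq_sym.
by case: eqP => _; rewrite ?mulr0// mulr1 mulrA.
Qed.

End Multinomial.

Section BinomialSeries.
Variables (C : numFieldType) (K : comNzRingType) (iota : {rmorphism C -> K}).
Implicit Types (A : C) (w : {poly K}).

Definition gfall A s : C := \prod_(l < s) (A - l%:R).

Definition gbin A s : C := gfall A s / s`!%:R.

(** The series $(1+w)^A$, cut off after $w^M$. *)
Definition powser A M w : {poly K} :=
  \sum_(s < M.+1) (iota (gbin A s))%:P * w ^+ s.

(** The right-hand side has the shape of the formula that defines the
rational powers of $H$. *)
Lemma coef_powser A M mu n (a : 'I_n -> K) : (mu <= M)%N ->
  (powser A M (\sum_(j < n) a j *: 'X^(j.+1)))`_mu =
  \sum_(v : {ffun 'I_n -> 'I_mu.+1} | (\sum_(j < n) j.+1 * v j)%N == mu)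
     iota (gfall A (\sum_j v j) / (\prod_j (v j)`!)%N%:R) * \prod_j a j ^+ v j.
Proof.
move=> leM; set w := \sum_(j < n) _.
have w1 : ord_ge 1 w.
  by apply: ord_ge_sum => j _; exists (a j *: 'X^j); rewrite -scalerAl -exprSr.
have nz k : k`!%:R != 0 :> C by rewrite pnatr_eq0 -lt0n fact_gt0.
rewrite /powser coef_sum (bigID (fun s : 'I_M.+1 => s < mu.+1)%N)/=.
rewrite [X in _ + X]big1 ?addr0; last first.
  move=> s; rewrite -leqNgt => lts; rewrite coefCM.
  by have /ord_geP -> := ord_geX s w1; rewrite ?mulr0// muln1.
rewrite -(@big_ord_widen _ _ _ mu.+1 M.+1
  (fun s => ((iota (gbin A s))%:P * w ^+ s)`_mu))//.
transitivity (\sum_(s < mu.+1)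
    \sum_(v : {ffun 'I_n -> 'I_mu.+1} |
       ((\sum_(j < n) j.+1 * v j)%N == mu) && ((\sum_j v j)%N == s))
     iota (gfall A s / (\prod_j (v j)`!)%N%:R) * \prod_j a j ^+ v j).
  apply: eq_bigr => s _; rewrite coefCM.
  have les : (s <= mu)%N by rewrite -ltnS.
  rewrite /w (exp_sum_multinomial (polyC \o iota) _ les) coef_sum mulr_sumr.
  rewrite [RHS](eq_bigl (fun v : {ffun 'I_n -> 'I_mu.+1} =>
    ((\sum_j v j)%N == s) && ((\sum_(j < n) j.+1 * v j)%N == mu))); last first.
    by move=> v; rewrite andbC.
  rewrite [RHS]big_mkcondr/=; apply: eq_bigr => v _.
  rewrite coefCM/=.
  have -> : \prod_j (a j *: 'X^(j.+1)) ^+ v j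
      = (\prod_j a j ^+ v j) *: 'X^(\sum_(j < n) j.+1 * v j) :> {poly K}.
    by under eq_bigr do rewrite exprZn -exprM; rewrite scaler_prod prodrXr.
  rewrite coefZ coefXn eq_sym.
  case: eqP => _; last by rewrite !mulr0.
  rewrite mulr1 mulrA -rmorphM/=; congr (iota _ * _).
  by rewrite /gbin mulrA; congr (_ / _); rewrite divfK.
rewrite (exchange_big_dep (fun v : {ffun 'I_n -> 'I_mu.+1} =>
   (\sum_(j < n) j.+1 * v j)%N == mu))/=; last by move=> s v _ /andP[].
apply: eq_bigr => v /eqP vmu.
have les : (\sum_j v j < mu.+1)%N.
  rewrite ltnS; apply: (@leq_trans (\sum_(j < n) j.+1 * v j)).
    by apply: leq_sum => j _; rewrite leq_pmull.
  by rewrite vmu.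
rewrite (big_pred1 (Ordinal les)) // => s.
by rewrite vmu eqxx/= -val_eqE/= eq_sym.
Qed.

Variable delta : {additive {poly K} -> {poly K}}.
Hypothesis deltaM : forall p q, delta (p * q) = delta p * q + p * delta q.
Hypothesis deltaC : forall c, delta (iota c)%:P = 0.

Lemma derivation_exp w s : delta (w ^+ s.+1) = s.+1%:R * w ^+ s * delta w.
Proof.
elim: s => [|s IH]; first by rewrite expr1 expr0 !mul1r.
by rewrite exprS deltaM IH (exprS _ s) -[s.+2%:R]natr1; ring.
Qed.

Lemma gbinS A s : s.+1%:R * gbin A s.+1 = (A - s%:R) * gbin A s.
Proof.
rewrite /gbin /gfall big_ord_recr/= factS natrM.
have nz : s`!%:R != 0 :> C by rewrite pnatr_eq0 -lt0n fact_gt0.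
have nz' : s.+1%:R != 0 :> C by rewrite pnatr_eq0.
move: nz'; move: s.+1%:R => t tnz.
by field; rewrite nz tnz.
Qed.

(** The differential equation $(1+w)\,\partial P=A\,\partial w\,P$ of
$P=(1+w)^A$. Truncation adds an error $w^M\partial w$, of order $M+1$. *)
Lemma powser_deriv A M w : ord_ge 1 w -> ord_ge 1 (delta w) ->
  ord_ge M.+1 ((1 + w) * delta (powser A M w)
               - (iota A)%:P * delta w * powser A M w).
Proof.
move=> w1 dw1; pose c s := (iota (gbin A s))%:P : {poly K}.
have dP : delta (powser A M w) = \sum_(s < M) c s.+1 * s.+1%:R * w ^+ s * delta w.
  rewrite raddf_sum big_ord_recl/= expr0 mulr1 deltaC add0r.
  apply: eq_bigr => s _; rewrite deltaM deltaC mul0r add0r derivation_exp.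
  by rewrite /c /bump add1n !mulrA.
have cS s : c s.+1 * s.+1%:R = ((iota A)%:P - s%:R) * c s.
  rewrite -[s.+1%:R](rmorph_nat (polyC \o iota)) /c/= -polyCM -rmorphM/= mulrC.
  by rewrite gbinS rmorphM rmorphB polyCM rmorphB/= !rmorph_nat.
have -> : (1 + w) * delta (powser A M w) - (iota A)%:P * delta w * powser A M w
  = - ((iota A)%:P - M%:R) * c M * w ^+ M * delta w.
  rewrite dP; elim: M {dP} => [|M IH].
    by rewrite big_ord0 /powser big_ord1 /c expr0; ring.
  rewrite big_ord_recr/= /powser big_ord_recr/= mulrDr.
  rewrite [X in _ - X]mulrDr opprD addrACA IH -/(c M.+1).
  have := cS M; rewrite (exprS w M); set a := c M.+1; set b := c M; move=> E.
  rewrite -!mulrA !(mulrCA _ a) in E *.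
  transitivity ((a * M.+1%:R - ((iota A)%:P - M%:R) * b) * w ^+ M * delta w
    + (M.+1%:R - (iota A)%:P) * a * (w * w ^+ M) * delta w).
    by rewrite -/b; ring.
  by rewrite E; ring.
rewrite -mulrA; apply: ord_geMl; rewrite -addn1; apply: ord_geM dw1.
by rewrite -[X in ord_ge X _]muln1; exact: ord_geX.
Qed.

End BinomialSeries.

(** * The differential equation of a constant bracket *)

Section Derivations.
Variables (C : numFieldType) (N : nat).
Local Notation K := {poly C}.

Definition theta (p : {poly K}) : {poly K} := 'X * p^`().

(** The derivation $s\,\partial_s-N\,t\,\partial_t$, where $s$ is the inner
variable and $t$ the outer one: it is $s\,\partial_s$ conjugated by the
substitution $t\mapsto s^Nt$ (see [twist_scale]). *)
Definition twist (p : {poly K}) : {poly K} :=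
  map_poly (fun q : K => 'X * q^`()) p - N%:R * theta p.

Lemma theta_additive : zmod_morphism theta.
Proof. by move=> p q; rewrite /theta derivB mulrBr. Qed.

HB.instance Definition _ :=
  GRing.isZmodMorphism.Build {poly K} {poly K} theta theta_additive.

Lemma coef_theta p i : (theta p)`_i = p`_i *+ i.
Proof.
by rewrite /theta coefXM; case: i => [|i]; rewrite ?mulr0n//= coef_deriv.
Qed.

Lemma coef_twist p i : (twist p)`_i = 'X * (p`_i)^`() - p`_i *+ (N * i).
Proof.
rewrite coefB coef_map_id0; last by rewrite deriv0 mulr0.
by rewrite mulr_natl coefMn coef_theta -mulrnA mulnC.
Qed.

Lemma twist_additive : zmod_morphism twist.
Proof.
move=> p q; apply/polyP=> i.
by rewrite [RHS]coefB !coef_twist coefB derivB; ring.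
Qed.

HB.instance Definition _ :=
  GRing.isZmodMorphism.Build {poly K} {poly K} twist twist_additive.

Lemma thetaM p q : theta (p * q) = theta p * q + p * theta q.
Proof. by rewrite /theta derivM; ring. Qed.

Lemma thetaC (c : K) : theta c%:P = 0.
Proof. by rewrite /theta derivC mulr0. Qed.

Lemma twistM p q : twist (p * q) = twist p * q + p * twist q.
Proof.
have eM : map_poly (fun q : K => 'X * q^`()) (p * q) =
    map_poly (fun q : K => 'X * q^`()) p * q
    + p * map_poly (fun q : K => 'X * q^`()) q.
  have e0 : 'X * (0 : K)^`() = 0 by rewrite deriv0 mulr0.
  apply/polyP=> i; rewrite coefD coef_map_id0// !coefM raddf_sum mulr_sumr.
  rewrite -big_split/=; apply: eq_bigr => j _.
  by rewrite !coef_map_id0// derivM; ring.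
by rewrite /twist eM thetaM; ring.
Qed.

Lemma twistC (c : C) : twist c%:P%:P = 0.
Proof.
apply/polyP=> i; rewrite coef_twist coefC coef0.
by case: i => [|i]/=; rewrite ?derivC ?deriv0 ?mulr0 ?muln0 ?mulr0n ?mul0rn subr0.
Qed.

Lemma theta_mono (b k : nat) : theta ('X^b * 'X^k%:P) = b%:R * ('X^b * 'X^k%:P).
Proof.
rewrite thetaM thetaC mulr0 addr0 /theta derivXn.
case: b => [|b]/=; first by rewrite !mulr0n mulr0 mul0r mul0r.
by rewrite mulrnAr -exprS mulrnAl mulr_natl.
Qed.

Lemma twist_mono (b k : nat) :
  twist ('X^b * 'X^k%:P) = (k%:R - (N * b)%:R) * ('X^b * 'X^k%:P).
Proof.
apply/polyP=> i.
have -> : k%:R - (N * b)%:R = (k%:R - (N * b)%:R)%:P :> {poly K}.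
  by rewrite polyCB !polyC_natr.
rewrite coef_twist coefCM !coefMC coefXn; case: eqP => [->|_]; last first.
  by rewrite !mul0r deriv0 !mulr0 mul0rn subr0.
rewrite !mul1r derivXn mulrBl !mulr_natl; congr (_ - _).
by case: k => [|k]; rewrite ?mulr0n ?mulr0// mulrnAr -exprS.
Qed.

Lemma ord_ge_theta n p : ord_ge n p -> ord_ge n (theta p).
Proof.
by move=> /ord_geP p0; apply/ord_geP => i /p0 pi0; rewrite coef_theta pi0 mul0rn.
Qed.

Lemma ord_ge_twist n p : ord_ge n p -> ord_ge n (twist p).
Proof.
move=> /ord_geP p0; apply/ord_geP => i /p0 pi0.
by rewrite coef_twist pi0 mul0rn deriv0 mulr0 subr0.
Qed.

End Derivations.

Section Magnus.
Variables (C : numFieldType) (N d e M : nat).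
Local Notation K := {poly C}.
Hypothesis d_gt0 : (0 < d)%N.
Variable w : {poly K}.
Hypothesis w1 : ord_ge 1 w.

Local Notation th := (@theta C).
Local Notation tw := (twist N).

(** Let [Z] be the reversal of $G$ after $t\mapsto s^Nt$, and
$s^N(1+w)$ that of $F$. Then $s^N$ times [lop Z] is, up to a monomial factor, the
bracket of $F$ and $G$ in these coordinates (see [lop_of_bracket]). *)
Definition lop (Z : {poly K}) : {poly K} :=
  (e%:R * Z - th Z) * (N%:R * (1 + w) + tw w)
  - (d%:R * (1 + w) - th w) * tw Z.

Lemma lopB Y Z : lop (Y - Z) = lop Y - lop Z.
Proof. by rewrite /lop (raddfB th) (raddfB tw) /=; ring. Qed.

Lemma lopZ (c : C) Z : lop (c%:P%:P * Z) = c%:P%:P * lop Z.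
Proof. by rewrite /lop thetaM thetaC twistM twistC; ring. Qed.

Definition expnt (beta : nat) : C := (e%:R - beta%:R) / d%:R.

Definition pseries (beta : nat) : {poly K} := powser polyC (expnt beta) M w.

(** Let $Z=t^\beta s^k(1+w)^A$ with $dA=e-\beta$ and $NA=k-N\beta$,
and let $\partial$ be [twist]. Then $eZ-\theta Z$ and $\partial Z$ are $AZ/(1+w)$
times $d(1+w)-\theta w$ and $N(1+w)+\partial w$, so the two products in [lop] are
equal. The hypothesis on [k] is the second equation with the first one
inserted. *)
Lemma lop_pseries beta k : (d * k = N * e + N * (d - 1) * beta)%N ->
  ord_ge M.+1 (lop ('X^beta * 'X^k%:P * pseries beta)).
Proof.
move=> kE; apply: (ord_ge1D_cancel w1).
set P := pseries beta; set A := expnt beta; set T := 'X^beta * _.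
have dnz : d%:R != 0 :> C by rewrite pnatr_eq0 -lt0n.
have thc c : th (polyC c)%:P = 0 by exact: thetaC.
have := powser_deriv (@thetaM C) thc A M w1 (ord_ge_theta w1).
have := powser_deriv (@twistM C N) (@twistC C N) A M w1 (ord_ge_twist N w1).
rewrite -/P -/(pseries beta) -/P.
set r2 := _ - _ => or2; set r1 := _ - _ => or1.
set a : {poly K} := A%:P%:P in r1 r2 or1 or2.
have da : d%:R * a = e%:R - beta%:R.
  rewrite /a -(rmorph_nat (polyC \o polyC)) -polyCM -polyCM /A /expnt mulrC divfK//.
  by rewrite !rmorphB/= !polyC_natr.
have Na : N%:R * a = k%:R - (N * beta)%:R.
  rewrite /a -(rmorph_nat (polyC \o polyC)) -polyCM -polyCM /A /expnt.
  rewrite -[k%:R](rmorph_nat (polyC \o polyC)) -[(N * beta)%:R](rmorph_nat (polyC \o polyC)) -rmorphB/=.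
  have kC : d%:R * k%:R = N%:R * e%:R + N%:R * (d%:R - 1) * beta%:R :> C.
    by rewrite -natrM kE natrD !natrM natrB.
  have -> : k%:R = (N%:R * e%:R + N%:R * (d%:R - 1) * beta%:R) / d%:R :> C.
    by rewrite -kC mulrC mulKf.
  by congr (_%:P%:P); rewrite natrM; field.
have -> : (1 + w) * lop (T * P) =
   T * (- r1 * (N%:R * (1 + w) + tw w) - (d%:R * (1 + w) - th w) * r2).
  rewrite /lop thetaM twistM theta_mono twist_mono -Na /r1 /r2.
  have -> : e%:R = d%:R * a + beta%:R :> {poly K} by rewrite da subrK.
  by rewrite -/T; ring.
apply/ord_geMl/ord_geB; first exact/ord_geMr/ord_geN.
exact: ord_geMl.
Qed.

(** An eigenvector of $s\,\partial_s$ is a monomial. This is where the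
constants $c_\beta$ come from. *)
Lemma euler_eigen (kappa : nat) (z : K) :
  d%:R * ('X * z^`()) = kappa%:R * z ->
  exists (c : C) (k : nat), z = c *: 'X^k /\ (c != 0 -> (d * k = kappa)%N).
Proof.
move=> zE; have coefE i : z`_i != 0 -> (d * i = kappa)%N.
  move=> zi; have := congr1 (fun p : K => p`_i) zE.
  rewrite !mulr_natl !coefMn coefXM.
  have -> : (if i == 0%N then 0 else z^`()`_i.-1) = z`_i *+ i.
    by case: (i) => [|j]; rewrite ?mulr0n//= coef_deriv.
  rewrite -mulrnA -[in X in X -> _]mulr_natr -[in X in X -> _](mulr_natr _ kappa).
  by move=> /(mulfI zi)/eqP; rewrite eqr_nat mulnC => /eqP.
have [->|znz] := eqVneq z 0; first by exists 0, 0%N; rewrite scale0r eqxx.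
exists (lead_coef z), (size z).-1; split; last by move=> lz; apply: coefE.
apply/polyP=> i; rewrite coefZ coefXn; case: eqP => [->|ni]; first by rewrite mulr1.
rewrite mulr0; apply/eqP/negPn/negP => /coefE di; apply: ni.
have /coefE : z`_(size z).-1 != 0 by rewrite -[_`__]/(lead_coef z) lead_coef_eq0.
by rewrite -di => /eqP; rewrite eqn_mul2l eqn0Ngt d_gt0 => /eqP.
Qed.

Lemma coef0_pseries beta : (pseries beta)`_0 = 1.
Proof.
rewrite /pseries /powser coef_sum big_ord_recl/= expr0 mulr1 coefC/=.
rewrite big1 => [|s _].
  by rewrite /gbin /gfall big_ord0 fact0 divr1 addr0.
have /ord_geP/(_ 0%N) w0 := w1.
rewrite coefCM /bump add1n exprS coef0M w0// mul0r mulr0//.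
Qed.

Lemma lop_low_coef mu Z : ord_ge mu Z ->
  (lop Z)`_mu = N%:R * ((e%:R - mu%:R) * Z`_mu)
     - d%:R * ('X * (Z`_mu)^`() - (N * mu)%:R * Z`_mu).
Proof.
have /ord_geP/(_ 0%N isT) w0 := w1.
have aux (a b : {poly K}) : ord_ge mu a -> (a * b)`_mu = a`_mu * b`_0.
  move=> /ord_geP a0; rewrite coefMr big_ord_recl/= subn0 big1 ?addr0// => i _.
  by rewrite a0 ?mul0r// /bump add1n; have := ltn_ord i; lia.
move=> oZ; rewrite /lop [_ * tw Z]mulrC coefB.
rewrite !aux; last first.
- by apply: ord_geB; [exact: ord_geMl|exact: ord_ge_theta].
- exact: ord_ge_twist.
have tw0 : (tw w)`_0 = 0 by have /ord_geP -> := ord_ge_twist N w1.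
have th0 : (th w)`_0 = 0 by have /ord_geP -> := ord_ge_theta w1.
rewrite coef_twist [in X in _ * X - _]coefD tw0 addr0.
rewrite [X in _ - _ * X]coefB th0 subr0 [X in X * _ - _]coefB coef_theta.
have cn k (p : {poly K}) i : (k%:R * p)`_i = k%:R * p`_i by rewrite !mulr_natl coefMn.
by rewrite !cn coefD coef1 w0 -![Z`_mu *+ _]mulr_natl eqxx addr0 !mulr1; ring.
Qed.

(** By [lop_low_coef], the lowest coefficient of a solution
satisfies an Euler equation, hence is a constant times a monomial
([euler_eigen]). Subtracting that multiple of the explicit solution of
[lop_pseries] raises the order by one. *)
Lemma magnus_expansion (Z : {poly K}) : ord_ge M.+1 (lop Z) ->
  exists (c : nat -> C) (k : nat -> nat),
    (forall beta, c beta != 0 ->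
       (d * k beta = N * e + N * (d - 1) * beta)%N) /\
    forall mu, (mu <= M)%N ->
      Z`_mu = \sum_(beta < mu.+1)
        c beta *: ('X^(k beta) * (pseries beta)`_(mu - beta)).
Proof.
move=> oZ.
(* the explicit solutions of [lop_pseries] *)
pose Y (c : nat -> C) (k : nat -> nat) beta : {poly K} :=
  (c beta)%:P%:P * ('X^beta * 'X^(k beta)%:P * pseries beta).
suff [c [k [ckE oZY]]] : exists (c : nat -> C) (k : nat -> nat),
    (forall beta, c beta != 0 ->
       (d * k beta = N * e + N * (d - 1) * beta)%N) /\
    ord_ge M.+1 (Z - \sum_(beta < M.+1) Y c k beta).
  exists c, k; split=> // mu lemu.
  have /ord_geP/(_ mu lemu)/eqP := oZY.
  rewrite coefB subr_eq0 => /eqP ->; rewrite coef_sum.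
  rewrite (bigID (fun b : 'I_M.+1 => b < mu.+1)%N)/= [X in _ + X]big1 ?addr0.
    rewrite -(@big_ord_widen _ _ _ mu.+1 M.+1 (fun b => (Y c k b)`_mu))//.
    apply: eq_bigr => b _; rewrite /Y coefCM -mulrA coefXnM.
    by rewrite ltnNge -ltnS ltn_ord/= coefCM mul_polyC.
  move=> b; rewrite -leqNgt => ltb.
  by rewrite /Y coefCM -mulrA coefXnM ltb mulr0.
suff : forall n, (n <= M.+1)%N -> exists (c : nat -> C) (k : nat -> nat),
    (forall beta, c beta != 0 ->
       (d * k beta = N * e + N * (d - 1) * beta)%N) /\
    ord_ge n (Z - \sum_(beta < n) Y c k beta).
  by apply.
elim=> [_|n IH ltn].
  exists (fun=> 0), (fun=> 0%N); split=> [b|]; first by rewrite eqxx.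
  by exists (Z - \sum_(beta < 0) Y (fun=> 0) (fun=> 0%N) beta); rewrite mulr1.
have [c [k [ckE oZY]]] := IH (ltnW ltn).
set Z' := Z - _ in oZY.
have oZ' : ord_ge M.+1 (lop Z').
  rewrite /Z' lopB; apply: ord_geB => //.
  have -> : lop (\sum_(beta < n) Y c k beta) = \sum_(beta < n) lop (Y c k beta).
    have lop0 : lop 0 = 0 by rewrite -{1}[0](subrr 0) lopB subrr.
    apply: (big_morph lop) => // p q.
    by rewrite -[q in LHS]opprK -[- q]sub0r !lopB lop0 sub0r opprK.
  apply: ord_ge_sum => b _; rewrite /Y lopZ.
  have [->|/ckE cb] := eqVneq (c b) 0; first by rewrite mul0r; exact: ord_ge0.
  exact/ord_geMl/lop_pseries.
have /ord_geP/(_ n ltn) := oZ'; rewrite lop_low_coef//.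
set z := Z'`_n => zE.
have /euler_eigen[a [l [zal al]]] :
    d%:R * ('X * z^`()) = (N * e + N * (d - 1) * n)%:R * z.
  move: zE => /eqP; rewrite subr_eq0 => /eqP.
  rewrite [d%:R * (_ - _)]mulrBr => /eqP; rewrite eq_sym subr_eq => /eqP ->.
  by rewrite !natrD !natrM natrB//; ring.
exists (fun b => if b == n then a else c b), (fun b => if b == n then l else k b).
split=> [b|]; first by case: (b =P n) => [->|_] //; exact: ckE.
rewrite big_ord_recr/= opprD addrA.
have -> : \sum_(b < n) Y (fun b => if b == n then a else c b)
    (fun b => if b == n then l else k b) b = \sum_(b < n) Y c k b.
  by apply: eq_bigr => b _; rewrite /Y ltn_eqF.
rewrite -/Z' /Y eqxx; apply/ord_geP => i; rewrite ltnS leq_eqVlt.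
rewrite coefB coefCM -mulrA coefXnM => /orP[/eqP->|lti].
  by rewrite ltnn subnn coefCM coef0_pseries mulr1 mul_polyC -zal subrr.
by rewrite lti mulr0 subr0; have /ord_geP -> := oZY.
Qed.

End Magnus.

(** * Straightening coordinates *)

(** Locked, because unification would otherwise unfold the nested
evaluations. *)
HB.lock Definition eval2 (C : fieldType) (S : comNzRingType)
    (c : {rmorphism C -> S}) (x y : S) : {poly {poly C}} -> S :=
  horner_eval y \o map_poly (horner_eval x \o map_poly c).

Section Eval2.
Variables (C : fieldType) (S : comNzRingType) (c : {rmorphism C -> S}) (x y : S).
Local Notation pol2 := {poly {poly C}}.
Local Notation ev := (eval2 c x y).

Lemma eval2_zmod : zmod_morphism ev.
Proof. by move=> f g; rewrite eval2.unlock rmorphB. Qed.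

Lemma eval2_monoid : monoid_morphism ev.
Proof. by split=> [|f g]; rewrite eval2.unlock ?rmorph1 ?rmorphM. Qed.

HB.instance Definition _ := GRing.isZmodMorphism.Build pol2 S ev eval2_zmod.
HB.instance Definition _ := GRing.isMonoidMorphism.Build pol2 S ev eval2_monoid.

Lemma eval2_const (a : C) : ev a%:P%:P = c a.
Proof. by rewrite eval2.unlock/= map_polyC/= /horner_eval map_polyC/= !hornerC. Qed.

Lemma eval2_x : ev 'X%:P = x.
Proof. by rewrite eval2.unlock/= map_polyC/= /horner_eval map_polyX/= hornerC hornerX. Qed.

Lemma eval2_y : ev 'X = y.
Proof. by rewrite eval2.unlock/= map_polyX/= /horner_eval hornerX. Qed.

End Eval2.

Section Pol2.
Variables (C : fieldType).
Local Notation pol2 := {poly {poly C}}.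

Lemma pol2E (f : pol2) : f = \sum_(q < size f) \sum_(p < size f`_q)
  (f`_q`_p)%:P%:P * ('X%:P ^+ p * 'X ^+ q).
Proof.
rewrite -{1}[f]coefK poly_def; apply: eq_bigr => q _.
rewrite -{1}[f`_q]coefK poly_def -mul_polyC rmorph_sum/= mulr_suml.
by apply: eq_bigr => p _; rewrite -mul_polyC polyCM rmorphXn/= mulrA.
Qed.

Lemma pol2_ext (S : comNzRingType) (f g : {rmorphism pol2 -> S}) :
  (forall a : C, f a%:P%:P = g a%:P%:P) -> f 'X%:P = g 'X%:P -> f 'X = g 'X ->
  f =1 g.
Proof.
move=> fgc fgx fgy h; rewrite (pol2E h) !rmorph_sum; apply: eq_bigr => q _.
rewrite !rmorph_sum; apply: eq_bigr => p _.
by rewrite !rmorphM !rmorphXn/= fgc fgx fgy.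
Qed.

End Pol2.

Section Straighten.
Variables (R : realType) (u : bool).
Local Notation C := R[i].
Local Notation pol2 := {poly {poly R[i]}}.
Implicit Types f g h : pol2.

(** For $u=0$ the substitution $x=s-1$, $y=T$; for $u=1$ the substitution
$x=T$, $y=(s-1)T$. In both cases $x^py^q$ becomes $T^{up+q}$ times a polynomial in
$s$, and $L$ becomes $sT^u$. *)
Definition straight : pol2 -> {poly {poly C}} :=
  eval2 (polyC \o polyC) (if u then 'X else ('X - 1)%:P)
        (if u then ('X - 1)%:P * 'X else 'X).

Lemma straight_zmod : zmod_morphism straight.
Proof. exact: eval2_zmod. Qed.

Lemma straight_monoid : monoid_morphism straight.
Proof. exact: eval2_monoid. Qed.

HB.instance Definition _ :=
  GRing.isZmodMorphism.Build pol2 {poly {poly C}} straight straight_zmod.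
HB.instance Definition _ :=
  GRing.isMonoidMorphism.Build pol2 {poly {poly C}} straight straight_monoid.

Let straight_morphism : {rmorphism pol2 -> {poly {poly C}}} := straight.

Lemma straightB f g : straight (f - g) = straight f - straight g.
Proof. exact: (rmorphB straight_morphism). Qed.

Lemma straightM f g : straight (f * g) = straight f * straight g.
Proof. exact: (rmorphM straight_morphism). Qed.

Lemma straight_const (a : C) : straight a%:P%:P = a%:P%:P.
Proof. exact: eval2_const. Qed.
Lemma straight_x : straight 'X%:P = if u then 'X else ('X - 1)%:P.
Proof. exact: eval2_x. Qed.
Lemma straight_y : straight 'X = if u then ('X - 1)%:P * 'X else 'X.
Proof. exact: eval2_y. Qed.

Lemma straight_mono p q : straight ('X%:P ^+ p * 'X ^+ q) =
  (('X - 1) ^+ (if u then q : nat else p))%:P * 'X^(u * p + q).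
Proof.
rewrite rmorphM !rmorphXn/= straight_x straight_y; case: u.
  by rewrite [(true * p)%N]mul1n exprMn exprD; ring.
by [].
Qed.

Lemma coef_straight f j : (straight f)`_j =
  \sum_(q < size f) \sum_(p < size f`_q | (u * p + q)%N == j)
    f`_q`_p *: ('X - 1) ^+ (if u then q : nat else p).
Proof.
rewrite {1}(pol2E f) rmorph_sum coef_sum; apply: eq_bigr => q _.
rewrite rmorph_sum coef_sum [RHS]big_mkcond/=; apply: eq_bigr => p _.
rewrite rmorphM /= straight_const straight_mono mulrA -polyCM coefCM coefXn eq_sym.
by rewrite mul_polyC; case: eqP => _; rewrite ?mulr1 ?mulr0.
Qed.

Lemma wpart_nat j f : wpart u j%:Z f =
  \sum_(q < size f) \sum_(p < size f`_q | (u * p + q)%N == j)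
    (f`_q`_p)%:P%:P * ('X%:P ^+ p * 'X ^+ q).
Proof.
apply: eq_bigr => q _; apply: eq_big => // p _.
by rewrite -mul_polyC polyCM rmorphXn/= mulrA.
Qed.

Lemma straight_wpart j f : straight (wpart u j%:Z f) = ((straight f)`_j)%:P * 'X^j.
Proof.
rewrite wpart_nat coef_straight rmorph_sum rmorph_sum mulr_suml.
apply: eq_bigr => q _; rewrite rmorph_sum rmorph_sum mulr_suml.
apply: eq_bigr => p /eqP <-.
by rewrite rmorphM /= straight_const straight_mono -mul_polyC polyCM/= mulrA.
Qed.

Lemma wpart_neg (j : int) f : j < 0 -> wpart u j f = 0.
Proof.
move=> j0; rewrite /wpart big1// => q _; rewrite big1// => p /eqP jE.
by move: j0; rewrite -jE.
Qed.

Lemma straight_linf : straight (linf R u) = ('X)%:P * 'X^u.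
Proof.
rewrite /linf rmorphD/= straight_x; case: (u) straight_y => [->|_].
  by rewrite polyCB polyC1; ring.
by rewrite rmorph1 polyCB polyC1 expr0; ring.
Qed.

Lemma size_coef_straight f j : u -> (size ((straight f)`_j)%R <= j.+1)%N.
Proof.
move=> hu; rewrite coef_straight hu; apply: (leq_trans (size_sum _ _ _)).
apply/bigmax_leqP => q _; apply: (leq_trans (size_sum _ _ _)).
apply/bigmax_leqP => p /eqP <-; apply: (leq_trans (size_scale_leq _ _)).
by rewrite size_exp_XsubC ltnS leq_addl.
Qed.

(** For $u=1$ the image of [straight] is a proper subring, but
inverting $T$ makes up for it. *)
Lemma straight_sections (P : {poly {poly C}}) :
  exists D h, straight h = 'X^D * P.
Proof.
pose z : pol2 := if u then 'X%:P else 'X.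
have zE : straight z = 'X.
  by rewrite /z; case: (u) straight_x straight_y.
have secM (P1 P2 : {poly {poly C}}) : (exists D h, straight h = 'X^D * P1) ->
    (exists D h, straight h = 'X^D * P2) -> exists D h, straight h = 'X^D * (P1 * P2).
  move=> [D1 [h1 e1]] [D2 [h2 e2]]; exists (D1 + D2)%N, (h1 * h2).
  by rewrite rmorphM/= e1 e2 exprD mulrACA.
have secD (P1 P2 : {poly {poly C}}) : (exists D h, straight h = 'X^D * P1) ->
    (exists D h, straight h = 'X^D * P2) -> exists D h, straight h = 'X^D * (P1 + P2).
  move=> [D1 [h1 e1]] [D2 [h2 e2]].
  exists (D1 + D2)%N, (z ^+ D2 * h1 + z ^+ D1 * h2).
  by rewrite rmorphD !rmorphM !rmorphXn/= e1 e2 zE exprD; ring.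
have secs : exists D h, straight h = 'X^D * ('X)%:P.
  by exists u, (linf R u); rewrite straight_linf mulrC.
have secT : exists D h, straight h = 'X^D * 'X.
  by exists 0%N, z; rewrite zE mul1r.
have secc (a : C) : exists D h, straight h = 'X^D * a%:P%:P.
  by exists 0%N, a%:P%:P; rewrite straight_const mul1r.
have sec0 : exists D h, straight h = 'X^D * 0.
  by exists 0%N, 0; rewrite rmorph0 mulr0.
elim/poly_ind: P => [|P c IH]; first exact: sec0.
apply: (secD _ _ (secM _ _ IH secT)).
elim/poly_ind: c => [|c a IHc]; first exact: sec0.
by rewrite polyCD polyCM; exact: (secD _ _ (secM _ _ IHc secs) (secc a)).
Qed.

Lemma dvd_straight (l : int) (j : nat) f :
  dvd_pow (linf R u) l (wpart u j f) ->
  exists q, (straight f)`_j = q * 'X^(pospart l).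
Proof.
case=> h; have [l0 _|l0] := lerP l 0.
  by exists (straight f)`_j; rewrite /pospart max_l// mulr1.
rewrite [pospart (- l)](_ : _ = 0%N); last by rewrite /pospart max_l// oppr_le0 ltW.
rewrite expr0 mulr1 => /(congr1 straight).
rewrite straight_wpart rmorphM rmorphXn/= straight_linf => /(congr1 (fun p : {poly {poly C}} => p`_j)).
rewrite coefCM coefXn eqxx mulr1 exprMn -rmorphXn/= => ->.
by exists (straight h * ('X ^+ u) ^+ pospart l)`_j; rewrite mulrCA coefCM mulrC.
Qed.

End Straighten.

(** * The ring R2 in straightened coordinates *)

(** The variable of $R_2$ of which a power is $T$ ([unstraightX]):
$y^{1/m}$ for $u=0$ and $x^{1/n}$ for $u=1$. *)
Definition laurent_var (R : realType) (u : bool) : frac2 R :=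
  tofrac (if u then 'X%:P else 'X).

(** The value $L/T^u$ of the coordinate $s$ in the original variables. *)
HB.lock Definition line (R : realType) (m n : nat) (u : bool) : frac2 R :=
  L2 R m n u / laurent_var R u ^+ (EN m n u * u).

Section Laurent.
Variables (R : realType) (m n : nat) (u : bool).
Hypotheses (m_gt0 : (0 < m)%N) (n_gt0 : (0 < n)%N).
Local Notation C := R[i].
Local Notation pol2 := {poly {poly R[i]}}.
Local Notation N := (EN m n u).
Local Notation d := (Ed m n u).
Implicit Types f g h : pol2.

Lemma EN_gt0 : (0 < N)%N. Proof. by rewrite /EN; case: u. Qed.

Local Notation emb := (@embR2 R m n u).

Lemma embR2E f : emb f =
  (@tofrac pol2 \o comp_poly 'X^(if u then 1%N else m)
    \o map_poly (comp_poly 'X^(if u then n else 1%N))) f.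
Proof. by []. Qed.

Lemma embR2_zmod : zmod_morphism emb.
Proof. by move=> f g; rewrite !embR2E rmorphB. Qed.

Lemma embR2_monoid : monoid_morphism emb.
Proof.
by split=> [|f g]; rewrite !embR2E; [exact: rmorph1|exact: rmorphM].
Qed.

HB.instance Definition _ := GRing.isZmodMorphism.Build pol2 (frac2 R) emb embR2_zmod.
HB.instance Definition _ := GRing.isMonoidMorphism.Build pol2 (frac2 R) emb embR2_monoid.

Lemma embR2_const (c : C) : emb c%:P%:P = const_frac c.
Proof. by rewrite embR2E/= !(map_polyC, comp_polyC)/= comp_polyC. Qed.

Lemma embR2_x : emb 'X%:P = tofrac ('X^(if u then n else 1%N))%:P.
Proof. by rewrite embR2E/= map_polyC/= comp_polyX comp_polyC. Qed.

Lemma embR2_y : emb 'X = tofrac 'X^(if u then 1%N else m).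
Proof. by rewrite embR2E/= map_polyX comp_polyX. Qed.

Lemma comp_polyXn_inj (D : idomainType) k : (0 < k)%N ->
  injective (comp_poly ('X^k : {poly D})).
Proof.
move=> k0 p q /eqP; rewrite -subr_eq0 -comp_polyB comp_poly_eq0 ?subr_eq0 => [/eqP//|].
by rewrite size_polyXn ltnS.
Qed.

Lemma embR2_inj : injective emb.
Proof.
move=> f g; rewrite !embR2E /= => /eqP; rewrite tofrac_eq => /eqP.
have k0 : (0 < if u then 1%N else m)%N by case: u.
move=> /(comp_polyXn_inj k0)/map_inj_poly; apply.
  by apply: comp_polyXn_inj; case: u.
by rewrite comp_poly0.
Qed.

Local Notation th := (laurent_var R u).
Local Notation line := (line R m n u).

Lemma laurent_var_neq0 : th != 0.
Proof. by rewrite tofrac_eq0; case: u; rewrite ?polyC_eq0 polyX_eq0. Qed.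

Definition Cfrac : C -> frac2 R := @tofrac pol2 \o polyC \o polyC.
HB.instance Definition _ := GRing.RMorphism.on Cfrac.

(** The inverse coordinate change, with values in the field of
fractions. *)
Definition unstraight : {poly {poly C}} -> frac2 R := eval2 Cfrac line (th ^+ N).
HB.instance Definition _ := GRing.RMorphism.on unstraight.

Definition line_eval : {poly C} -> frac2 R := unstraight \o polyC.
HB.instance Definition _ := GRing.RMorphism.on line_eval.

Lemma unstraightC (p : {poly C}) : unstraight p%:P = line_eval p.
Proof. by []. Qed.

Lemma line_evalC (c : C) : line_eval c%:P = const_frac c.
Proof. exact: eval2_const. Qed.

Lemma line_evalX : line_eval 'X = line.
Proof. exact: eval2_x. Qed.

Lemma unstraightX : unstraight 'X = th ^+ N.
Proof. exact: eval2_y. Qed.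

Lemma lineE : th ^+ (N * u) * line = L2 R m n u.
Proof. by rewrite line.unlock mulrC divfK// expf_neq0// laurent_var_neq0. Qed.

Lemma L2E : L2 R m n u =
  tofrac ('X^(if u then n else 1%N))%:P + (if u then tofrac 'X else 1).
Proof.
have -> : L2 R m n u = emb (linf R u) by [].
rewrite /linf rmorphD/= embR2_x; congr (_ + _).
have -> : emb (if u then 'X else 1) = if u then emb 'X else emb 1 by case: u.
by rewrite embR2_y rmorph1; case: u.
Qed.

Lemma unstraightK f : unstraight (straight u f) = emb f.
Proof.
have lX := line_evalX; have lE := lineE; have uX := unstraightX.
move: lX lE uX; rewrite L2E; move: line => l lX lE uX.
apply: (@pol2_ext _ _ (unstraight \o straight u) emb) => [c||]/=.
- by rewrite straight_const unstraightC line_evalC embR2_const.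
- rewrite straight_x embR2_x; move: lE uX.
  rewrite /laurent_var /EN; case: u => [_ ->|].
    by rewrite polyC_exp tofracXn.
  rewrite muln0 expr0 mul1r => lE _.
  by rewrite unstraightC rmorphB/= lX rmorph1 lE addrK.
- rewrite straight_y embR2_y; move: lE uX.
  rewrite /laurent_var /EN; case: u => [|_ ->]; last by rewrite tofracXn.
  rewrite muln1 => lE xE.
  rewrite rmorphM/= unstraightC xE rmorphB/= lX rmorph1 mulrBl mul1r.
  by rewrite mulrC lE polyC_exp tofracXn addrAC subrr add0r.
Qed.

(** Up to a power of $T$, every polynomial in $s$ and $T$ is in the
image of [straight], where [unstraight] amounts to the inclusion of
$\mathbb C[x,y]$. *)
Lemma unstraight_inj : injective unstraight.
Proof.
move=> P Q /eqP; rewrite -subr_eq0 -rmorphB/= => PQ0; apply/eqP; rewrite -subr_eq0.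
have [D [h hE]] := straight_sections u (P - Q).
have := unstraightK h; rewrite hE rmorphM/= (eqP PQ0) mulr0.
move=> /esym/eqP; rewrite -(rmorph0 emb) => /eqP/embR2_inj h0.
move: hE; rewrite h0 rmorph0 => /esym/eqP.
by rewrite mulf_eq0 expf_eq0 polyX_eq0 andbF.
Qed.

Lemma straight_inj : injective (@straight R u).
Proof. by move=> f g fg; apply: embR2_inj; rewrite -!unstraightK fg. Qed.

Lemma embR2_wpart j f : emb (wpart u j%:Z f) =
  line_eval (straight u f)`_j * th ^+ (N * j).
Proof.
by rewrite -unstraightK straight_wpart rmorphM rmorphXn/= unstraightC unstraightX exprM.
Qed.

Lemma tau2E : tau2 R m n u = line * th ^+ d.
Proof.
have -> : d = (N * u + (d - N * u))%N by rewrite /Ed /EN; case: u; lia.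
rewrite exprD mulrA [line * _]mulrC lineE /tau2 /Ed /EN.
case hu: u; last by rewrite muln0 subn0 mul0n add0n -tofracXn /laurent_var ?hu.
by rewrite muln1 mul1n addnK mulrC /laurent_var ?hu polyC_exp tofracXn.
Qed.

Lemma tau2_neq0 : tau2 R m n u != 0.
Proof.
rewrite tau2E; apply: mulf_neq0; last exact: expf_neq0 laurent_var_neq0.
rewrite -line_evalX -unstraightC -(rmorph0 unstraight) (inj_eq unstraight_inj).
by rewrite polyC_eq0 polyX_eq0.
Qed.

Lemma inR2_tofrac f : inR2 (tofrac f).
Proof. by exists 0%N, f; rewrite mulr1. Qed.

Lemma inR2M (x y : frac2 R) : inR2 x -> inR2 y -> inR2 (x * y).
Proof.
move=> [k [p xp]] [l [q yq]]; exists (k + l)%N, (p * q).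
by rewrite exprD mulrACA xp yq rmorphM.
Qed.

Lemma inR2D (x y : frac2 R) : inR2 x -> inR2 y -> inR2 (x + y).
Proof.
move=> [k [p xp]] [l [q yq]].
exists (k + l)%N, (p * ('X%:P * 'X) ^+ l + q * ('X%:P * 'X) ^+ k).
by rewrite exprD mulrDl mulrA xp mulrCA mulrC yq rmorphD !rmorphM !rmorphXn/= rmorphM; ring.
Qed.

Lemma inR20 : inR2 (0 : frac2 R). Proof. by rewrite -tofrac0; exact: inR2_tofrac. Qed.
Lemma inR21 : inR2 (1 : frac2 R). Proof. by rewrite -tofrac1; exact: inR2_tofrac. Qed.

Lemma inR2N (x : frac2 R) : inR2 x -> inR2 (- x).
Proof. by move=> [k [p xp]]; exists k, (- p); rewrite mulNr xp rmorphN. Qed.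

Lemma inR2X (x : frac2 R) k : inR2 x -> inR2 (x ^+ k).
Proof.
by move=> xR; elim: k => [|k IH]; [exact: inR21|rewrite exprS; exact: inR2M].
Qed.

Lemma inR2_sum (I : Type) (r : seq I) (P : pred I) (F : I -> frac2 R) :
  (forall i, P i -> inR2 (F i)) -> inR2 (\sum_(i <- r | P i) F i).
Proof.
move=> RF; elim/big_rec: _ => [|i x Pi Rx]; first exact: inR20.
by apply: inR2D => //; exact: RF.
Qed.

Lemma inR2_varV : inR2 th^-1.
Proof.
exists 1%N, (if u then 'X else 'X%:P); rewrite expr1 rmorphM/=.
apply: (mulfI laurent_var_neq0); rewrite mulVKf ?laurent_var_neq0//.
by rewrite /laurent_var; case: u => //; rewrite mulrC.
Qed.

Lemma inR2_var : inR2 th. Proof. exact: inR2_tofrac. Qed.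

Lemma inR2_varz (z : int) : inR2 (th ^ z).
Proof.
case: z => k; first exact: (inR2X _ inR2_var).
by rewrite NegzE -exprz_inv; exact: (inR2X _ inR2_varV).
Qed.

Lemma inR2_line : inR2 line.
Proof.
rewrite line.unlock.
apply: inR2M; first exact: inR2_tofrac.
by rewrite -exprVn; exact: (inR2X _ inR2_varV).
Qed.

Lemma inR2_line_eval p : inR2 (line_eval p).
Proof.
elim/poly_ind: p => [|p c IH]; first by rewrite rmorph0; exact: inR20.
rewrite rmorphD rmorphM/= line_evalX line_evalC.
apply: inR2D; last exact: inR2_tofrac.
by apply: inR2M => //; exact: inR2_line.
Qed.

Lemma inR2_tau2 : inR2 (tau2 R m n u).
Proof. by rewrite tau2E; apply: inR2M inR2_line _; exact: (inR2X _ inR2_var). Qed.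

Lemma Pzero_tau2 k (x : frac2 R) : inR2 x -> Pzero m n u k (tau2 R m n u ^+ k * x).
Proof.
move=> xR; exists ((th ^ (d%:Z - (N * u)%:Z)) ^+ k * x).
  by apply: inR2M => //; exact: (inR2X _ (inR2_varz _)).
rewrite mulrA; congr (_ * _); rewrite -exprMn; congr (_ ^+ _).
rewrite tau2E; have := lineE; move: (L2 R m n u) => L <-.
rewrite [th ^+ (N * u) * line]mulrC -[RHS]mulrA; congr (_ * _).
have := expfzDr (N * u)%:Z (d%:Z - (N * u)%:Z) laurent_var_neq0.
by rewrite [_%:Z + (_ - _)]addrC subrK; exact.
Qed.

(** Subtracting the multiples of $L$ leaves the constant [p`_0],
which is not a multiple of $L$ in $R_2$: $L$ has a zero with nonzero
coordinates. *)
Lemma Pzero_line_eval (p : {poly C}) (z : int) :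
  Pzero m n u 1 (line_eval p * th ^ z) -> p`_0 = 0.
Proof.
case=> g gR; rewrite expr1 => E.
have : exists2 g, inR2 g & line_eval p = L2 R m n u * g.
  exists (g * th ^ (- z)); first by apply: inR2M => //; exact: inR2_varz.
  by rewrite mulrA -E -mulrA -expfzDr ?laurent_var_neq0// subrr mulr1.
move=> {g gR E} [g gR E].
have [p' pE] : exists p', p = p' * 'X + (p`_0)%:P.
  elim/poly_ind: p {E} => [|p c _]; first by exists 0; rewrite mul0r coef0 addr0.
  by exists p; rewrite coefD coefMX coefC eqxx add0r.
have [g' [k [q g'E]] E'] : exists2 g, inR2 g & const_frac p`_0 = L2 R m n u * g.
  exists (g - th ^- (N * u) * line_eval p').
    apply: inR2D => //; apply: inR2N; apply: inR2M; last exact: inR2_line_eval.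
    by rewrite -exprVn; exact: (inR2X _ inR2_varV).
  have lineL : L2 R m n u * th ^- (N * u) = line by rewrite line.unlock.
  rewrite mulrBr mulrA lineL -E.
  rewrite {2}pE rmorphD rmorphM/= line_evalX line_evalC.
  by rewrite [line_eval p' * _]mulrC addrC addKr.
pose Lp : pol2 := ('X^(if u then n else 1%N))%:P + (if u then 'X else 1).
have LE : L2 R m n u = tofrac Lp.
  by rewrite L2E rmorphD/=; case: (u); rewrite ?tofrac1.
have : tofrac ((p`_0)%:P%:P * ('X%:P * 'X) ^+ k) = tofrac (Lp * q) :> frac2 R.
  by rewrite rmorphM rmorphXn/= -/(const_frac _) E' LE -mulrA g'E rmorphM.
move=> /eqP; rewrite tofrac_eq => /eqP.
have key (ev : {rmorphism pol2 -> C}) : (forall c, ev c%:P%:P = c) ->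
    ev 'X%:P = (if u then 1 else -1) -> ev 'X = (if u then -1 else 1) ->
    (p`_0)%:P%:P * ('X%:P * 'X) ^+ k = Lp * q -> p`_0 * (-1) ^+ k = 0.
  move=> evc evx evy /(congr1 ev).
  rewrite !rmorphM/= rmorphXn/= rmorphM/= evc evx evy rmorphD/= polyC_exp rmorphXn/= evx.
  have -> : ev (if u then 'X else 1) = if u then ev 'X else 1.
    by case: (u); rewrite ?rmorph1.
  rewrite evy; case: (u);
    by rewrite ?(mul1r, mulr1, expr1n, expr1) ?(addNr, subrr) mul0r.
(* $L$ vanishes at $(X, Y) = (1, -1)$ for $u = 1$ and at $(-1, 1)$ for $u = 0$ *)
move=> /(key (eval2 (@idfun C) (if u then 1 else -1) (if u then -1 else 1))
  (eval2_const _ _ _) (eval2_x _ _ _) (eval2_y _ _ _))/eqP.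
by rewrite mulf_eq0 expf_eq0 oppr_eq0 oner_eq0 andbF orbF => /eqP.
Qed.

End Laurent.

(** * Slopes *)

Section Slope.
Variable C : fieldType.
Local Notation K := {poly C}.
Implicit Types (p q : {poly K}).

Definition slope_le (c : nat) p : Prop :=
  forall j, exists q : K, p`_j = q * 'X^(j - c).

(** The substitution $T\mapsto s^NT$. *)
Lemma coef_comp_scale N p j : (p \Po (('X^N)%:P * 'X))`_j = p`_j * 'X^(N * j).
Proof.
rewrite comp_polyE coef_sum; set st : {poly K} := _%:P * 'X.
have E (i : 'I_(size p)) : (p`_i *: st ^+ i)`_j = p`_i * 'X^(N * i) *+ (j == i :> nat).
  by rewrite exprMn -rmorphXn/= mul_polyC scalerA coefZ coefXn mulr_natr exprM.
under eq_bigr do rewrite E.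
have [ltj|lej] := ltnP j (size p).
  rewrite (bigD1 (Ordinal ltj))//= eqxx mulr1n big1 ?addr0// => i.
  by rewrite -val_eqE/= eq_sym => /negPf ->.
rewrite [p`_j]nth_default// mul0r big1// => i _.
by rewrite gtn_eqF// (leq_trans (ltn_ord i)).
Qed.

Local Notation sT := (('X : K)%:P * 'X : {poly K}).

Lemma coef_comp_sT p j : (p \Po sT)`_j = p`_j * 'X^j.
Proof. by have := coef_comp_scale 1 p j; rewrite mul1n. Qed.

Lemma comp_sT_inj : injective (fun p => p \Po sT).
Proof.
move=> p q /= pq; apply/polyP => j; have := congr1 (fun r : {poly K} => r`_j) pq.
by rewrite !coef_comp_sT; apply: mulIf; rewrite expf_eq0 polyX_eq0 andbF.
Qed.

(** In other words, $s^cp$ is a polynomial in $s$ and $sT$; products and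
powers of such polynomials are then easy to handle. *)
Lemma slope_leP c p : slope_le c p <-> exists q, q \Po sT = ('X^c)%:P * p.
Proof.
split=> [pc|[q qE] j].
  have /choice[f fE] := pc.
  exists (\poly_(j < size p) (if (j < c)%N then p`_j * 'X^(c - j) else f j)).
  apply/polyP => j; rewrite coef_comp_sT coef_poly coefCM.
  have [ltj|lej] := ltnP j (size p); last by rewrite nth_default// mulr0 mul0r.
  case: ltnP => [ltjc|lecj].
    by rewrite -mulrA -exprD subnK ?(ltnW ltjc)// mulrC.
  by rewrite fE mulrCA -exprD subnKC.
have := congr1 (fun r : {poly K} => r`_j) qE.
rewrite /= coef_comp_sT coefCM; have [lejc _|ltcj] := leqP j c.
  by exists p`_j; move: lejc; rewrite -subn_eq0 => /eqP ->; rewrite expr0 mulr1.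
have -> : 'X^j = 'X^(j - c) * 'X^c :> K by rewrite -exprD subnK// ltnW.
rewrite mulrA mulrC => E; exists q`_j; apply/esym; move: E; apply: mulfI.
by rewrite expf_eq0 polyX_eq0 andbF.
Qed.

Lemma slope_leD c p q : slope_le c p -> slope_le c q -> slope_le c (p + q).
Proof.
move=> pc qc j; have [a aE] := pc j; have [b bE] := qc j.
by exists (a + b); rewrite coefD aE bE mulrDl.
Qed.

Lemma slope_leN c p : slope_le c p -> slope_le c (- p).
Proof. by move=> pc j; have [a aE] := pc j; exists (- a); rewrite coefN aE mulNr. Qed.

Lemma slope_leB c p q : slope_le c p -> slope_le c q -> slope_le c (p - q).
Proof. by move=> pc qc; apply: slope_leD => //; exact: slope_leN. Qed.

Lemma slope_leW c c' p : (c <= c')%N -> slope_le c p -> slope_le c' p.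
Proof.
move=> lec pc j; have [a aE] := pc j; exists (a * 'X^((j - c) - (j - c'))).
by rewrite -mulrA -exprD subnK// leq_sub2l.
Qed.

Lemma slope_leM c c' p q : slope_le c p -> slope_le c' q -> slope_le (c + c') (p * q).
Proof.
move=> /slope_leP[a aE] /slope_leP[b bE]; apply/slope_leP; exists (a * b).
by rewrite comp_polyM aE bE exprD polyCM mulrACA.
Qed.

Lemma slope_leC (a : C) : slope_le 0 a%:P%:P.
Proof.
move=> j; rewrite coefC subn0; case: eqP => [->|_]; first by exists a%:P; rewrite mulr1.
by exists 0; rewrite mul0r.
Qed.

Lemma slope_leX c p k : slope_le c p -> slope_le (k * c) (p ^+ k).
Proof.
move=> pc; elim: k => [|k IH]; first by rewrite expr0; exact: (slope_leC 1).
by rewrite exprS mulSn; exact: slope_leM.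
Qed.

Definition subst (alpha : {poly C}) p : {poly K} :=
  \sum_(i < size alpha) (alpha`_i)%:P%:P * p ^+ i.

Lemma slope_le_subst c (alpha : {poly C}) p :
  slope_le c p -> slope_le ((size alpha).-1 * c) (subst alpha p).
Proof.
move=> pc; rewrite /subst; elim/big_ind: _ => [||i _].
- by move=> j; exists 0; rewrite coef0 mul0r.
- by move=> x y; exact: slope_leD.
apply: (@slope_leW (0 + i * c)).
  by rewrite add0n leq_mul2r -ltnS prednK ?ltn_ord ?orbT// (leq_trans _ (ltn_ord i)).
by apply: slope_leM; [exact: slope_leC|exact: slope_leX].
Qed.

(** The slope is lowered one step at a time. If $p$ has slope
$c'+1>c$, write $s^{c'+1}p=q_1(s,sT)$. As $\alpha(p)$ has slope less than
$k(c'+1)$, with $k=\deg\alpha$, the leading term of $\alpha$ forces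
$q_1^k\equiv0$ modulo $s$, so $s$ divides $q_1$. *)
Lemma slope_le_root c (alpha : {poly C}) p : alpha \is monic -> (1 < size alpha)%N ->
  slope_le ((size alpha).-1 * c) (subst alpha p) -> slope_le c p.
Proof.
set k := (size alpha).-1 => amon asz ac.
have k1 : (0 < k)%N by rewrite /k; case: (size alpha) asz => [|[]].
have sE : size alpha = k.+1 by rewrite /k prednK// (leq_trans _ asz).
suff step c' : (c <= c')%N -> slope_le c'.+1 p -> slope_le c' p.
  have : slope_le (c + size p) p.
    move=> j; have [lej|ltj] := leqP (size p) j.
      by exists 0; rewrite nth_default// mul0r.
    exists p`_j; have /eqP -> : (j - (c + size p) == 0)%N.
      by rewrite subn_eq0 (leq_trans (ltnW ltj))// leq_addl.
    by rewrite mulr1.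
  elim: (size p) => [|t IH]; first by rewrite addn0.
  by rewrite addnS => /step H; apply: IH; apply: H; rewrite leq_addr.
move=> lecc /slope_leP[q1 q1E].
have [q qE] := (slope_leP _ _).1 ac.
pose s : {poly K} := ('X : K)%:P.
have e1 : \sum_(i < size alpha) (alpha`_i)%:P%:P * s ^+ (c'.+1 * (k - i)) * q1 ^+ i
    = s ^+ (k * (c'.+1 - c)) * q.
  apply: comp_sT_inj; rewrite comp_polyM qE rmorph_sum/=.
  have sC x : s ^+ x \Po sT = s ^+ x by rewrite -rmorphXn/= comp_polyC.
  rewrite sC rmorphXn/= mulrA -exprD -mulnDr subnK//; last exact: leqW.
  rewrite /subst mulr_sumr; apply: eq_bigr => i _.
  rewrite !comp_polyM comp_polyC sC rmorphXn/= q1E exprMn rmorphXn/= -exprM.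
  have lei : (i <= k)%N by rewrite -ltnS -sE.
  rewrite -mulrA [s ^+ _ * _]mulrA -exprD -mulnDr subnK// mulrCA.
  by rewrite [(k * _)%N]mulnC.
(* reduction modulo s *)
pose rho : {rmorphism {poly K} -> K} := map_poly (horner_eval (0 : C)).
have rs : rho s = 0 by rewrite /rho/= map_polyC/= /horner_eval hornerX.
have rq : rho q1 = 0.
  have := congr1 rho e1; rewrite sE big_ord_recr/= rmorphD rmorph_sum/=.
  rewrite big1 => [|i _]; last first.
    rewrite !rmorphM rmorphXn rs expr0n muln_eq0/= subn_eq0 leqNgt ltn_ord.
    by rewrite mulr0 mul0r.
  have -> : alpha`_k = 1 by apply/eqP; rewrite -[_`_k]/(lead_coef alpha).
  rewrite subnn muln0 expr0 !mul1r add0r rmorphM !rmorphXn rs expr0n muln_eq0.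
  rewrite subn_eq0 leqNgt ltnS lecc orbF eqn0Ngt k1 mul0r.
  by move=> /eqP; rewrite expf_eq0 k1 => /eqP.
have [q2 q2E] : exists q2, q1 = s * q2.
  have /choice[f fE] : forall j, exists a : K, q1`_j = 'X * a.
    move=> j; have := congr1 (fun r : K => r`_j) rq; rewrite coef_map coef0 /= /horner_eval.
    by move/eqP/factor_theorem => [a aE]; exists a; rewrite aE subr0 mulrC.
  exists (\poly_(j < size q1) f j); apply/polyP => j.
  rewrite coefCM coef_poly; case: ltnP => // lej.
  by rewrite nth_default// mulr0.
apply/slope_leP; exists q2; apply: (@mulfI _ s); first by rewrite polyC_eq0 polyX_eq0.
have : q1 \Po sT = s * (q2 \Po sT) by rewrite q2E comp_polyM comp_polyC.
by move=> <-; rewrite q1E exprS polyCM mulrA.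
Qed.

End Slope.

Section StraightDivisibility.
Variables (R : realType) (u : bool).
Local Notation C := R[i].
Local Notation pol2 := {poly {poly R[i]}}.
Implicit Types f g h : pol2.

Lemma straight_injective : injective (@straight R u).
Proof. exact: (@straight_inj R 1 1 u isT isT). Qed.

Lemma pospart_nat (l : nat) : pospart l%:Z = l.
Proof. by rewrite /pospart max_r. Qed.

Lemma pospart_subn (j c : nat) : pospart (j%:Z - c%:Z) = (j - c)%N.
Proof.
rewrite /pospart; have [lejc|ltcj] := leqP j c.
  rewrite max_l ?subr_le0 ?lez_nat// absz0; apply/esym/eqP.
  by rewrite subn_eq0.
by rewrite max_r ?subr_ge0 ?lez_nat ?(ltnW ltcj)// subzn// ltnW.
Qed.

(** The quotient by $s^l$ has to be written back in $x$ and $y$. For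
$u=1$ this needs the bound of [size_coef_straight] on its degree in $s$. *)
Lemma dvd_of_straight (l : int) (j : nat) f (q : {poly C}) : l <= j%:Z ->
  (straight u f)`_j = q * 'X^(pospart l) -> dvd_pow (linf R u) l (wpart u j f).
Proof.
have [l0 _ _|l0] := lerP l 0.
  exists (wpart u j f * linf R u ^+ pospart (- l)).
  by rewrite [pospart l](_ : _ = 0%N) ?expr0 ?mulr1// /pospart max_l.
case: l l0 => [l|l]// l0; rewrite lez_nat pospart_nat => lelj qE.
rewrite /dvd_pow pospart_nat [pospart (- _)](_ : _ = 0%N); last first.
  by rewrite /pospart max_l// oppr_le0 ltW.
have [q0|qn0] := eqVneq q 0.
  exists 0; rewrite expr0 mulr1 mul0r; apply: straight_injective.
  by rewrite straight_wpart qE q0 mul0r mul0r rmorph0.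
pose z : pol2 := if u then 'X%:P else 'X.
have zE : straight u z = 'X by rewrite /z; case: (u) (straight_x R u) (straight_y R u).
exists (\sum_(i < size q) (q`_i)%:P%:P * linf R u ^+ i
   * z ^+ (if u then (j - l - i)%N else j)).
apply: straight_injective; rewrite expr0 mulr1 straight_wpart qE [RHS]rmorphM/=.
rewrite [straight u (\sum_(i < _) _)]rmorph_sum/=.
have -> : straight u (linf R u ^+ l) = ('X ^+ l)%:P * 'X^(u * l).
  by rewrite rmorphXn/= straight_linf exprMn -rmorphXn -exprM.
under eq_bigr => i _.
  rewrite !rmorphM/= !rmorphXn/= zE straight_const straight_linf exprMn -exprM.
  have -> : (q`_i)%:P%:P * ('X%:P ^+ i * 'X^(u * i)) * 'X^(if u then (j - l - i)%N else j)
     = (q`_i *: 'X^i)%:P * 'X^(j - u * l) :> {poly {poly C}}.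
    rewrite -mul_polyC polyCM rmorphXn/= -!mulrA -exprD; congr (_ * (_ * 'X^_)).
    case hu: u; last by rewrite mul0n subn0.
    rewrite !mul1n subnKC//.
    have := size_coef_straight f j hu; rewrite qE size_mulXn// addnC.
    rewrite -{1}(subnK lelj) -addSn leq_add2r => szq.
    by rewrite -ltnS (leq_trans (ltn_ord i)).
  over.
rewrite -mulr_suml -rmorph_sum/= -poly_def coefK polyCM; case hu: u.
  by rewrite !mul1n -{1}(subnK lelj) exprD; ring.
by rewrite !mul0n subn0; ring.
Qed.

Lemma wDC_slope m n i f : wDC m n u i f <-> slope_le (uF m n i u) (straight u f).
Proof.
split=> [fDC j|fs j].
  have [q qE] := dvd_straight (fDC j%:Z).
  by exists q; rewrite qE pospart_subn.
case: j => j; last first.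
  by rewrite wpart_neg//; exists 0; rewrite !mul0r.
have [q qE] := fs j; apply: (dvd_of_straight (q := q)).
  by rewrite lerBlDr lerDl.
by rewrite pospart_subn.
Qed.

Lemma straight_subst2 (alpha : {poly C}) f :
  straight u (subst2 alpha f) = subst alpha (straight u f).
Proof.
rewrite /subst2 horner_poly rmorph_sum; apply: eq_bigr => i _.
by rewrite rmorphM rmorphXn/= straight_const.
Qed.

End StraightDivisibility.

(** * The Jacobian in straightened coordinates *)

Section ChainRule.
Variable C : fieldType.
Local Notation pol2 := {poly {poly C}}.

Definition dinner (p : pol2) : pol2 := map_poly (@deriv C) p.

Lemma coef_dinner p i : (dinner p)`_i = (p`_i)^`().
Proof. by rewrite /dinner coef_map_id0// deriv0. Qed.

Lemma dinnerD p q : dinner (p + q) = dinner p + dinner q.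
Proof.
by apply/polyP => i; rewrite [RHS]coefD !coef_dinner coefD derivD.
Qed.

Lemma dinnerM p q : dinner (p * q) = dinner p * q + p * dinner q.
Proof.
apply/polyP => i; rewrite [RHS]coefD coef_dinner !coefM raddf_sum -big_split/=.
by apply: eq_bigr => j _; rewrite derivM !coef_dinner.
Qed.

Lemma dinnerC (p : {poly C}) : dinner p%:P = (p^`())%:P.
Proof. by apply/polyP => i; rewrite coef_dinner !coefC; case: i => //=; rewrite deriv0. Qed.

Lemma dinnerX : dinner 'X = 0.
Proof.
apply/polyP => i; rewrite coef_dinner coefX coef0.
by case: eqP => _; rewrite ?deriv0// -[1%:R]/(1%:P) derivC.
Qed.

(** Any derivation along a ring morphism is determined by its values on
the two variables. Used with both partial derivatives. *)
Lemma chain_rule (S : comNzRingType) (phi : {rmorphism pol2 -> S}) (D : S -> S) :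
  (forall a b, D (a + b) = D a + D b) ->
  (forall a b, D (a * b) = D a * b + a * D b) ->
  (forall c : C, D (phi c%:P%:P) = 0) ->
  forall f, D (phi f) = phi (dinner f) * D (phi 'X%:P) + phi f^`() * D (phi 'X).
Proof.
move=> DD DM DC.
have D0 : D 0 = 0 by apply: (addIr (D 0)); rewrite -DD addr0 add0r.
elim/poly_ind => [|f c IH].
  rewrite rmorph0 D0.
  by rewrite deriv0 /dinner map_poly0 rmorph0 !mul0r addr0.
rewrite rmorphD DD rmorphM DM IH dinnerD dinnerM dinnerX mulr0 addr0.
rewrite derivD derivM derivX derivC mulr1 addr0.
have -> : D (phi c%:P) = phi (dinner c%:P) * D (phi 'X%:P).
  elim/poly_ind: c => [|c a IHc].
    by rewrite dinnerC deriv0 rmorph0 mul0r.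
  rewrite dinnerC derivD derivC addr0 derivM derivX mulr1.
  rewrite polyCD rmorphD DD DC addr0 polyCM rmorphM DM IHc.
  by rewrite dinnerC polyCD polyCM rmorphD rmorphM; ring.
by rewrite !rmorphD !rmorphM; ring.
Qed.

End ChainRule.

Section Reversal.
Variable K : comNzRingType.
Implicit Types p q : {poly K}.

(** The polynomial $T^dp(1/T)$, for $p$ of degree at most $d$. *)
Definition reversal d p : {poly K} := \poly_(i < d.+1) p`_(d - i).

Lemma coef_reversal d p i : (reversal d p)`_i = if (i < d.+1)%N then p`_(d - i) else 0.
Proof. exact: coef_poly. Qed.

Lemma reversalD d p q : reversal d (p + q) = reversal d p + reversal d q.
Proof.
apply/polyP => i; rewrite coefD !coef_poly; case: ifP => _; last by rewrite addr0.
by rewrite coefD.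
Qed.

Lemma reversalZ d a p : reversal d (a *: p) = a *: reversal d p.
Proof.
apply/polyP => i; rewrite coefZ !coef_poly; case: ifP => _; last by rewrite mulr0.
by rewrite coefZ.
Qed.

Lemma reversal0 d : reversal d 0 = 0.
Proof. by apply/polyP => i; rewrite coef_poly !coef0; case: ifP. Qed.

Lemma reversalB d p q : reversal d (p - q) = reversal d p - reversal d q.
Proof. by rewrite reversalD -[- q]scaleN1r reversalZ scaleN1r. Qed.

Lemma reversalXn d i : (i <= d)%N -> reversal d 'X^i = 'X^(d - i).
Proof.
move=> lei; apply/polyP => j; rewrite coef_poly !coefXn ltnS.
case: leqP => [lej|ltj].
  by have -> : (d - j == i)%N = (j == d - i)%N by apply/eqP/eqP; lia.
by rewrite gtn_eqF// (leq_ltn_trans (leq_subr _ _)).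
Qed.

Lemma reversal_sum d (I : Type) (r : seq I) (P : pred I) (F : I -> {poly K}) :
  reversal d (\sum_(i <- r | P i) F i) = \sum_(i <- r | P i) reversal d (F i).
Proof. by apply: (big_morph (reversal d)) => [p q|]; [exact: reversalD|exact: reversal0]. Qed.

Lemma poly_widen d p : (size p <= d.+1)%N -> p = \sum_(i < d.+1) p`_i *: 'X^i.
Proof.
move=> szp; rewrite -poly_def; apply/polyP => i; rewrite coef_poly.
by case: ltnP => // ltdi; rewrite nth_default// (leq_trans szp).
Qed.

Lemma reversalE d p : (size p <= d.+1)%N -> reversal d p = \sum_(i < d.+1) p`_i *: 'X^(d - i).
Proof.
move=> szp; rewrite {1}(poly_widen szp) reversal_sum; apply: eq_bigr => i _.
by rewrite reversalZ reversalXn// -ltnS.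
Qed.

Lemma reversalM d e p q : (size p <= d.+1)%N -> (size q <= e.+1)%N ->
  reversal (d + e) (p * q) = reversal d p * reversal e q.
Proof.
move=> szp szq; rewrite (reversalE szp) (reversalE szq) {1}(poly_widen szp) {1}(poly_widen szq).
rewrite !mulr_suml reversal_sum; apply: eq_bigr => i _.
rewrite !mulr_sumr reversal_sum; apply: eq_bigr => j _.
rewrite -!scalerAl -!scalerAr !reversalZ -!exprD; congr (_ *: (_ *: _)).
have lti := ltn_ord i; have ltj := ltn_ord j.
by rewrite reversalXn; [congr ('X^_)|]; lia.
Qed.

Lemma ord_ge_reversal d k p : (k <= d.+1)%N ->
  (forall i, (d < i + k)%N -> p`_i = 0) -> ord_ge k (reversal d p).
Proof.
move=> lek p0; apply/ord_geP => i lti; rewrite coef_poly.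
by case: ifP => // ltid; apply: p0; lia.
Qed.

End Reversal.

Section JacobianExpansion.
Variables (R : realType) (u : bool).
Local Notation C := R[i].
Local Notation pol2 := {poly {poly R[i]}}.
Implicit Types F G : pol2.
Local Notation st := (@straight R u).

(** The factor is the Jacobian determinant of the substitution. *)
Lemma jacobian_straight F G :
  jacobian (st F) (st G) = st (jacobian F G) * (if u then - 'X else 1).
Proof.
have D0 (c : C) : dinner (st c%:P%:P) = 0 by rewrite straight_const dinnerC derivC.
have d0 (c : C) : (st c%:P%:P)^`() = 0 by rewrite straight_const derivC.
have cr f : dinner (st f) =
    st (dinner f) * dinner (st 'X%:P) + st f^`() * dinner (st 'X).
  exact: (@chain_rule C _ st (@dinner C) (@dinnerD C) (@dinnerM C) D0 f).
have cr' f : (st f)^`() =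
    st (dinner f) * (st 'X%:P)^`() + st f^`() * (st 'X)^`().
  exact: (@chain_rule C _ st (@deriv _) (@derivD _) (@derivM _) d0 f).
rewrite /jacobian -/(dinner (st F)) -/(dinner (st G)) -/(dinner F) -/(dinner G).
have stJ (a b c e : pol2) : st (a * b - c * e) = st a * st b - st c * st e.
  by rewrite straightB !straightM.
rewrite stJ (cr F) (cr G) (cr' F) (cr' G).
move: (st (dinner F)) (st (dinner G)) (st F^`()) (st G^`()) => a b c e /=.
have d1 : (1 : {poly C})^`() = 0 by exact: derivC.
rewrite straight_x straight_y; case: (u).
  rewrite dinnerX dinnerM dinnerX dinnerC derivX derivM derivX derivC derivB derivX.
  by rewrite d1 subr0 polyCB polyC1; ring.
by rewrite dinnerX dinnerC derivX derivC derivB derivX d1 subr0; ring.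
Qed.

End JacobianExpansion.

Section BracketReversal.
Variable C : numFieldType.
Local Notation pol2 := {poly {poly C}}.

Lemma reversal_dinner d (p : pol2) : reversal d (dinner p) = dinner (reversal d p).
Proof.
apply/polyP => i; rewrite coef_dinner !coef_reversal.
by case: ifP => _; rewrite ?deriv0// coef_dinner.
Qed.

Lemma reversal_theta d (p : pol2) : reversal d (theta p) = d%:R * reversal d p - theta (reversal d p).
Proof.
apply/polyP => i; rewrite coefB mulr_natl coefMn coef_theta !coef_reversal.
case: ifP => [ltid|_]; last by rewrite !mul0rn subr0.
by rewrite coef_theta -mulrnBr// -ltnS.
Qed.

Lemma size_theta (p : pol2) : (size (theta p) <= size p)%N.
Proof.
by apply/leq_sizeP => i lei; rewrite coef_theta nth_default// mul0rn.
Qed.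

Lemma size_dinner (p : pol2) : (size (dinner p) <= size p)%N.
Proof.
by apply/leq_sizeP => i lei; rewrite coef_dinner nth_default// deriv0.
Qed.

Variables (N d e M : nat).
Local Notation st_scale := ('X^N%:P * 'X : {poly {poly C}}).

Lemma theta_scale (p : {poly {poly C}}) : theta (p \Po st_scale) = theta p \Po st_scale.
Proof.
by apply/polyP => i; rewrite coef_theta !coef_comp_scale coef_theta mulrnAl.
Qed.

Lemma twist_scale (p : {poly {poly C}}) :
  twist N (p \Po st_scale) = 'X%:P * (dinner p \Po st_scale).
Proof.
apply/polyP => i.
rewrite coef_twist coefCM !coef_comp_scale coef_dinner derivM derivXn.
case: (N * i)%N => [|k]; first by rewrite !mulr0n mulr0 addr0 subr0.
by rewrite /= exprS mulrDr !mulrnAr [in X in _ + X - _]mulrCA addrK.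
Qed.

Lemma ord_ge_scale k (p : {poly {poly C}}) : ord_ge k p -> ord_ge k (p \Po st_scale).
Proof.
by move=> /ord_geP p0; apply/ord_geP => i /p0 pi0; rewrite coef_comp_scale pi0 mul0r.
Qed.

(** Reversal exchanges $\theta$ with $d-\theta$
([reversal_theta]) and the scaling turns $s\,\partial_s$ into [twist]
([twist_scale]); the factor $s^N$ is then common to all terms. *)
Lemma lop_of_bracket (P Q w : {poly {poly C}}) :
  (size P <= d.+1)%N -> (size Q <= e.+1)%N -> (M <= d + e)%N ->
  (forall i, (d + e < i + M.+1)%N ->
     (dinner P * theta Q - dinner Q * theta P)`_i = 0) ->
  reversal d P \Po st_scale = 'X^N%:P * (1 + w) ->
  ord_ge M.+1 (lop N d e w (reversal e Q \Po st_scale)).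
Proof.
move=> szP szQ leM J0 wE.
have szdP : (size (dinner P) <= d.+1)%N := leq_trans (size_dinner P) szP.
have szdQ : (size (dinner Q) <= e.+1)%N := leq_trans (size_dinner Q) szQ.
have sztP : (size (theta P) <= d.+1)%N := leq_trans (size_theta P) szP.
have sztQ : (size (theta Q) <= e.+1)%N := leq_trans (size_theta Q) szQ.
have := ord_ge_reversal (leM : (M.+1 <= (d + e).+1)%N) J0.
rewrite reversalB (reversalM szdP sztQ) [(d + e)%N]addnC (reversalM szdQ sztP).
rewrite !reversal_dinner !reversal_theta.
move=> /ord_ge_scale; set p := reversal d P in wE *; set q := reversal e Q.
move: (theta_scale p) (theta_scale q); move: (theta p) (theta q) => tp tq tpE tqE.
rewrite comp_polyB !comp_polyM !comp_polyB !comp_polyM -tpE -tqE.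
have nC k : k%:R \Po st_scale = k%:R by rewrite -polyC_natr comp_polyC.
rewrite !nC => /(ord_geMl ('X%:P)).
set q' := q \Po st_scale; set a := dinner p \Po _; set b := dinner q \Po _.
have -> : 'X%:P * (a * (e%:R * q' - theta q') - b * (d%:R * (p \Po st_scale) - theta (p \Po st_scale)))
  = twist N (p \Po st_scale) * (e%:R * q' - theta q')
    - twist N q' * (d%:R * (p \Po st_scale) - theta (p \Po st_scale)).
  rewrite /q' !twist_scale -/a -/b.
  move: (theta (q \Po _)) (theta (p \Po _)) => y1 y2.
  by move: a b (q \Po _) (p \Po _) => a b y3 y4; ring.
rewrite wE.
have tN : twist N 'X^N%:P = N%:R * 'X^N%:P :> {poly {poly C}}.
  by have := twist_mono C N 0 N; rewrite !mul1r muln0 subr0.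
rewrite thetaM thetaC twistM tN mul0r add0r.
have -> : theta (1 + w) = theta w by rewrite raddfD/= -polyC1 thetaC add0r.
have -> : twist N (1 + w) = twist N w.
  by rewrite raddfD/= -[1]/(1%:P%:P) twistC add0r.
have -> : (N%:R * 'X^N%:P * (1 + w) + 'X^N%:P * twist N w) * (e%:R * q' - theta q') -
    twist N q' * (d%:R * ('X^N%:P * (1 + w)) - 'X^N%:P * theta w)
  = 'X^N%:P * lop N d e w q' by rewrite /lop; ring.
move=> /ord_geP o; apply/ord_geP => i /o; rewrite coefCM => /eqP.
by rewrite mulf_eq0 expf_eq0 polyX_eq0 andbF => /eqP.
Qed.

End BracketReversal.

(** The bracket of the straightened polynomials is a constant or
a constant times $T$, hence zero in all degrees above $u$. *)
Lemma straight_expansion (R : realType) (u : bool) (N d e : nat)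
    (F G : {poly {poly R[i]}}) (c0 : R[i]) (w : {poly {poly R[i]}}) :
  (0 < d)%N -> (u.+2 <= d + e)%N ->
  (size (straight u F) <= d.+1)%N -> (size (straight u G) <= e.+1)%N ->
  jacobian F G = const2 c0 ->
  ord_ge 1 w ->
  reversal d (straight u F) \Po ('X^N%:P * 'X) = 'X^N%:P * (1 + w) ->
  exists (c : nat -> R[i]) (k : nat -> nat),
    (forall beta, c beta != 0 ->
       (d * k beta = N * e + N * (d - 1) * beta)%N) /\
    forall mu, (mu <= d + e - u.+2)%N ->
      (reversal e (straight u G))`_mu * 'X^(N * mu) = \sum_(beta < mu.+1)
        c beta *: ('X^(k beta) * (pseries d e (d + e - u.+2) w beta)`_(mu - beta)).
Proof.
move=> d0 led szF szG Jc w1 wE.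
have [|c [k [ck cE]]] := @magnus_expansion _ N d e (d + e - u.+2) d0 w w1
    (reversal e (straight u G) \Po ('X^N%:P * 'X)).
  apply: (lop_of_bracket szF szG) wE; first by rewrite leq_subr.
  move=> i lti.
  have -> : dinner (straight u F) * theta (straight u G)
      - dinner (straight u G) * theta (straight u F)
    = 'X * jacobian (straight u F) (straight u G).
    have aux (p q r s x : {poly {poly R[i]}}) :
      p * (x * q) - r * (x * s) = x * (p * q - r * s) by ring.
    exact: aux.
  rewrite jacobian_straight Jc straight_const mulrCA coefCM.
  have lei : (u.+2 <= i)%N by move: led lti; lia.
  by case: (u) lei => lei; rewrite ?mulrN ?coefN -?expr2 ?mulr1 ?coefXn ?coefX;
     rewrite gtn_eqF// ?oppr0 mulr0.
exists c, k; split=> // mu lemu; rewrite -cE//.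
by rewrite coef_comp_scale.
Qed.

(** * Evaluation and degrees of polynomials in tau *)

Section MonomialEvaluation.
Variables (I : choiceType) (K : comNzRingType) (val : I -> K).
Implicit Types M : {cmonom I}.

Definition meval M : K := \prod_(g <- finsupp M) val g ^+ M g.

Lemma mevalEw M (D : {fset I}) : (finsupp M `<=` D)%fset ->
  meval M = \prod_(g <- D) val g ^+ M g.
Proof.
move=> le; rewrite /meval (big_fset_incl _ le)// => g gD.
by rewrite -cmE_neq0 negbK => /eqP ->; rewrite expr0.
Qed.

Lemma meval_mmorphism : mmorphism meval.
Proof.
split=> [M1 M2|]; last by rewrite /meval mdom1 big_seq_fset0.
rewrite {1}/meval mdomD.
rewrite (mevalEw (fsubsetUl (finsupp M1) (finsupp M2))).
rewrite (mevalEw (fsubsetUr (finsupp M1) (finsupp M2))).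
by rewrite -big_split/=; apply: eq_bigr => g _; rewrite cmM exprD.
Qed.

HB.instance Definition _ := isMultiplicative.Build {cmonom I} K meval meval_mmorphism.

Lemma mevalU g : meval (ucm g) = val g.
Proof. by rewrite /meval mdomU big_seq_fset1 cmUU expr1. Qed.

Variables (C : comNzRingType) (cmap : {rmorphism C -> K}) (t : K).

Definition teval : {poly {malg C[{cmonom I}]}} -> K :=
  horner_eval t \o map_poly (mmap cmap meval).

HB.instance Definition _ := GRing.RMorphism.on teval.

Lemma tevalC (g : {malg C[{cmonom I}]}) : teval g%:P = mmap cmap meval g.
Proof. by rewrite /teval/= map_polyC/= /horner_eval hornerC. Qed.

Lemma tevalX : teval 'X = t.
Proof. by rewrite /teval/= map_polyX/= /horner_eval hornerX. Qed.

Lemma teval_var g : teval (<< ucm g >>)%:P = val g.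
Proof. by rewrite tevalC mmapU mevalU /= rmorph1 mul1r. Qed.

Lemma teval_shift v k : teval ('X^k * (<< ucm v >>)%:P) = t ^+ k * val v.
Proof. by rewrite rmorphM rmorphXn/= tevalX teval_var. Qed.

Lemma teval_mono c M k : teval ((<< c *g M >>)%:P * 'X^k) = cmap c * meval M * t ^+ k.
Proof. by rewrite rmorphM rmorphXn/= tevalX tevalC mmapU. Qed.

End MonomialEvaluation.

Section Degrees.
Variables (R : realType) (I : choiceType) (degI : I -> rat) (degtau : rat).
Local Notation A := {malg R[i][{cmonom I}]}.
Implicit Types (f g : {poly A}) (D : nat -> Prop).
Local Notation tmdeg := (tmdeg degI degtau).

Lemma tmdegEw k (M : {cmonom I}) (E : {fset I}) : (finsupp M `<=` E)%fset ->
  tmdeg k M = k%:R * degtau + \sum_(g <- E) (M g)%:R * degI g.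
Proof.
move=> le; congr (_ + _); rewrite (big_fset_incl _ le)// => g gD.
by rewrite -cmE_neq0 negbK => /eqP ->; rewrite mul0r.
Qed.

Lemma tmdegD k l (M1 M2 : {cmonom I}) :
  tmdeg (k + l) (mmul M1 M2) = tmdeg k M1 + tmdeg l M2.
Proof.
rewrite {1}/Defs.tmdeg mdomD.
rewrite (tmdegEw _ (fsubsetUl (finsupp M1) (finsupp M2))).
rewrite (tmdegEw _ (fsubsetUr (finsupp M1) (finsupp M2))).
rewrite natrD mulrDl addrACA -big_split/=; congr (_ + _).
by apply: eq_bigr => g _; rewrite cmM natrD mulrDl.
Qed.

Lemma tmdeg_tau k : tmdeg k (@mone _) = k%:R * degtau.
Proof. by rewrite /Defs.tmdeg mdom1 big_seq_fset0 addr0. Qed.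

Lemma tmdeg_var k (v : I) : tmdeg k (ucm v) = k%:R * degtau + degI v.
Proof. by rewrite /Defs.tmdeg mdomU big_seq_fset1 cmUU mul1r. Qed.

(** [hpoly] sorts terms by degree through truncation, so it behaves well
only on polynomials all of whose terms have natural degrees. *)
Definition degP D f : Prop :=
  forall k M, M \in msupp f`_k -> exists2 j : nat, tmdeg k M = j%:R & D j.

Lemma degPW D D' f : (forall j, D j -> D' j) -> degP D f -> degP D' f.
Proof. by move=> DD' fD k M /fD[j e /DD' Dj]; exists j. Qed.

Lemma degP0 D : degP D 0.
Proof. by move=> k M; rewrite coef0 msupp0 in_fset0. Qed.

Lemma degPD D f g : degP D f -> degP D g -> degP D (f + g).
Proof.
move=> fD gD k M; rewrite coefD => /(fsubsetP (msuppD_le _ _)).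
by rewrite in_fsetU => /orP[/fD|/gD].
Qed.

Lemma degP_sum D (J : Type) (r : seq J) (P : pred J) (F : J -> {poly A}) :
  (forall j, P j -> degP D (F j)) -> degP D (\sum_(j <- r | P j) F j).
Proof.
move=> FD; elim/big_rec: _ => [|j x Pj xD]; first exact: degP0.
by apply: degPD => //; exact: FD.
Qed.

Lemma msupp_sum (J : Type) (r : seq J) (F : J -> A) M :
  M \in msupp (\sum_(j <- r) F j) -> exists2 j, true & M \in msupp (F j).
Proof.
elim: r => [|j r IH]; first by rewrite big_nil msupp0 in_fset0.
rewrite big_cons => /(fsubsetP (msuppD_le _ _)); rewrite in_fsetU => /orP[Mj|/IH//].
by exists j.
Qed.

Lemma degPM D1 D2 D f g : (forall i j, D1 i -> D2 j -> D (i + j)%N) ->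
  degP D1 f -> degP D2 g -> degP D (f * g).
Proof.
move=> DD fD gD k M; rewrite coefM => /msupp_sum[i _ /msuppM_le].
move=> [M1 [M2 [/fD[j1 e1 d1] /gD[j2 e2 d2] ->]]].
exists (j1 + j2)%N; last exact: DD.
by rewrite natrD -e1 -e2 -tmdegD subnKC// -ltnS.
Qed.

Lemma degP_mono D c k M : (exists2 j : nat, tmdeg k M = j%:R & D j) ->
  degP D ((<< c *g M >>)%:P * 'X^k).
Proof.
move=> kM l M'; rewrite coefCM coefXn; case: eqP => [->|_].
  by rewrite mulr1 => /(fsubsetP msuppU_le); rewrite in_fset1 => /eqP ->.
by rewrite mulr0 msupp0 in_fset0.
Qed.

Lemma poly_monoE f : f = \sum_(k < size f) \sum_(M <- msupp f`_k)
  (<< mcoeff M f`_k *g M >>)%:P * 'X^k.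
Proof.
rewrite -{1}[f]coefK poly_def; apply: eq_bigr => k _.
by rewrite -mulr_suml -rmorph_sum/= -monalgE mul_polyC.
Qed.

Lemma hcomp_sum d f : degP (fun j => j <= d)%N f ->
  f = \sum_(j < d.+1) hcomp degI degtau j%:R f.
Proof.
move=> fd; rewrite {1}(poly_monoE f) /hcomp exchange_big/=; apply: eq_bigr => k _.
under [RHS]eq_bigr do rewrite big_mkcond/=.
rewrite exchange_big/=; apply: eq_big_seq => M /fd[j e led].
rewrite (bigD1 (Ordinal (led : j < d.+1)%N))//= e eqxx big1 ?addr0// => l.
by rewrite -val_eqE/= => nl; rewrite eqr_nat eq_sym (negPf nl).
Qed.

Lemma mem_tdegs f q : q \in tdegs degI degtau f ->
  exists k M, M \in msupp f`_k /\ q = tmdeg k M.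
Proof. by case/allpairsPdep => k [M [_ ? ->]]; exists k, M. Qed.

Lemma tdegs_mem f k M : M \in msupp f`_k -> tmdeg k M \in tdegs degI degtau f.
Proof.
move=> Mf; apply/allpairsPdep; exists k, M; split=> //.
rewrite mem_iota add0n leq0n/=; case: ltnP => // lek; move: Mf.
by rewrite nth_default// msupp0 in_fset0.
Qed.

(** The maximum that defines [hdeg] starts from an arbitrary first degree,
which is itself at most [d]. *)
Lemma hdegE d f : degP (fun j => j <= d)%N f ->
  d%:R \in tdegs degI degtau f -> hdeg degI degtau f = d%:R.
Proof.
move=> fd dd.
have le_d q : q \in tdegs degI degtau f -> q <= d%:R.
  by move=> /mem_tdegs[k [M [/fd[j e led] ->]]]; rewrite e ler_nat.
have max_le (s : seq rat) x : x <= d%:R -> (forall q, q \in s -> q <= d%:R) ->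
    \big[Num.max/x]_(q <- s) q <= d%:R.
  move=> xd; elim: s => [|q s IH] sd; first by rewrite big_nil.
  rewrite big_cons ge_max sd ?mem_head//= IH// => q' q's.
  by apply: sd; rewrite in_cons q's orbT.
have le_max (s : seq rat) x q : q \in s -> q <= \big[Num.max/x]_(q <- s) q.
  elim: s => [|q' s IH]//; rewrite in_cons big_cons le_max => /orP[/eqP->|/IH->].
    by rewrite lexx.
  by rewrite orbT.
apply/le_anti/andP; split; last exact: le_max.
apply: max_le => //; case: (tdegs degI degtau f) dd le_d => [|q s _ sd]//=.
by apply: sd; rewrite mem_head.
Qed.

Lemma hcomp_notin f q : q \notin tdegs degI degtau f -> hcomp degI degtau q f = 0.
Proof.
move=> qf; rewrite /hcomp big1// => k _; rewrite big_seq_cond big1// => M /andP[Mf /eqP qE].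
by move: qf; rewrite -qE tdegs_mem.
Qed.

Lemma coef_hpoly d f l : degP (fun j => j <= d)%N f ->
  d%:R \in tdegs degI degtau f ->
  (hpoly degI degtau f)`_l =
    if (l <= d)%N then hcomp degI degtau (d - l)%N%:R f else 0.
Proof.
move=> fd dd; rewrite /hpoly (hdegE fd dd) coef_sum.
set s := tdegs degI degtau f.
have key q : q \in undup s ->
    ((hcomp degI degtau q f)%:P * 'X^(Num.truncn (d%:R - q)))`_l =
    if (l <= d)%N && (q == (d - l)%N%:R) then hcomp degI degtau (d - l)%N%:R f else 0.
  rewrite mem_undup => /mem_tdegs[k [M [/fd[j e led] qE]]].
  rewrite qE e -natrB// natrK coefCM coefXn.
  have -> : (j%:R == (d - l)%N%:R :> rat) = (j == d - l)%N by rewrite eqr_nat.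
  have [lel|ltl] := leqP l d; last first.
    by rewrite gtn_eqF ?mulr0// (leq_ltn_trans (leq_subr _ _)).
  have -> : (l == d - j)%N = (j == d - l)%N by apply/eqP/eqP; lia.
  by case: eqP => [->|_]; rewrite ?mulr1 ?mulr0.
rewrite (eq_big_seq _ key); case: leqP => /= _; last by rewrite big1.
rewrite -big_mkcond/=; have [qs|qs] := boolP ((d - l)%N%:R \in undup s).
  by rewrite -big_filter filter_pred1_uniq ?undup_uniq// big_seq1.
rewrite -big_filter (_ : [seq _ <- _ | _] = [::]) ?big_nil.
  by rewrite hcomp_notin//; rewrite mem_undup in qs.
apply/eqP; rewrite -[_ == _]negbK -has_filter; apply/hasPn => q qs'.
by apply: contra qs => /eqP <-.
Qed.

End Degrees.

Arguments degPM {R I degI degtau D1} D2 {D f g}.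

(** * The homomorphism S attached to E and F *)

Section Realization.
Variables (R : realType) (a m n delta i : nat) (u : bool).
Hypotheses (m_gt0 : (0 < m)%N) (n_gt0 : (0 < n)%N).
Local Notation C := R[i].
Local Notation pol2 := {poly {poly R[i]}}.
Local Notation K := (frac2 R).
Local Notation N := (EN m n u).
Local Notation d := (Ed m n u).
Local Notation vE := (vE a m n delta u).
Local Notation uE := (uE a m n delta u).
Local Notation nF := (nF a m n delta i u).
Local Notation uF := (uF m n i u).
Local Notation gen := (gen a m n delta i u).
Local Notation R1 := (R1 R a m n delta i u).
Local Notation th := (laurent_var R u).
Local Notation lev := (@line_eval R m n u).
Local Notation deggen := (@deggen a m n delta i u).
Local Notation degtau := (degtau m n u).

Variables (pG : 'I_vE -> {poly C}) (px : 'I_nF -> {poly C}) (c : nat -> C).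

Definition gpoly (g : gen) : {poly C} :=
  match g with
  | inl (inl j) => pG j
  | inl (inr j) => px j
  | inr k => (c k.+1)%:P
  end.

(** The exponent that gives the generator, multiplied by its power of $\tau$ in
$\tilde E^\circ$ or $\tilde F^\circ$, the weight $Nj$ of $T^j$. It is $N$ times the
degree of the generator ([EN_deggen]). *)
Definition gexp (g : gen) : int :=
  match g with
  | inl (inl j) => (N * j)%:Z - (d * (j - uE))%:Z
  | inl (inr j) => (N * j)%:Z - (d * (j - uF))%:Z
  | inr k => 0
  end.

Definition gval (g : gen) : K := lev (gpoly g) * th ^ gexp g.

(** The homomorphism $S$: each generator goes to the component of
$E$ or $F'$ that it stands for, divided by the appropriate power of $\tau$. *)
Definition realize : {poly R1} -> K :=
  @teval gen K gval C (@Cfrac R) (tau2 R m n u).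

HB.instance Definition _ := GRing.RMorphism.on realize.

Lemma realize_tau : realize 'X = tau2 R m n u.
Proof. exact: tevalX. Qed.

Lemma realize_var g : realize (<< ucm g >>)%:P = gval g.
Proof. exact: teval_var. Qed.

Lemma realize_const (x : C) : realize (scal a m n delta i u x)%:P = const_frac x.
Proof.
rewrite /realize tevalC /scal -mul_malgC mulr1.
by rewrite mmapU mmorph1 mulr1.
Qed.

(** Homogeneity of weight [z] when [laurent_var] has weight 1 and the
coordinate $s$ has weight 0. *)
Definition homog (z : int) (x : K) : Prop := exists p, x = lev p * th ^ z.

Lemma homogM z1 z2 x y : homog z1 x -> homog z2 y -> homog (z1 + z2) (x * y).
Proof.
move=> [p ->] [q ->]; exists (p * q).
by rewrite expfzDr ?laurent_var_neq0// rmorphM mulrACA.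
Qed.

Lemma homogD z x y : homog z x -> homog z y -> homog z (x + y).
Proof. by move=> [p ->] [q ->]; exists (p + q); rewrite rmorphD mulrDl. Qed.

Lemma homog0 z : homog z 0.
Proof. by exists 0; rewrite rmorph0 mul0r. Qed.

Lemma homog1 : homog 0 1.
Proof. by exists 1; rewrite rmorph1 expr0z mulr1. Qed.

Lemma homog_const (x : C) : homog 0 (const_frac x).
Proof. by exists x%:P; rewrite line_evalC expr0z mulr1. Qed.

Lemma homogX z x k : homog z x -> homog (z * k%:Z) (x ^+ k).
Proof.
by move=> [p ->]; exists (p ^+ k); rewrite rmorphXn exprMn -exprz_exp.
Qed.

Lemma homog_meval (M : {cmonom gen}) :
  homog (\sum_(g <- finsupp M) gexp g * (M g)%:Z) (meval gval M).
Proof.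
rewrite /meval; elim: (enum_fset (finsupp M)) => [|g s IH].
  by rewrite !big_nil; exact: homog1.
by rewrite !big_cons; apply: homogM => //; apply: homogX; exists (gpoly g).
Qed.

Lemma EN_neq0 : N%:R != 0 :> rat.
Proof. by rewrite pnatr_eq0 -lt0n EN_gt0. Qed.

Lemma EN_degtau : N%:R * degtau = d%:R.
Proof.
rewrite /EN /Defs.degtau /Ed; case: u.
  by rewrite mulrDr mulr1 mulrCA divff ?mulr1 ?mul1n ?natrD// pnatr_eq0 -lt0n.
by rewrite mul0n add0n mulrCA divff ?mulr1// pnatr_eq0 -lt0n.
Qed.

Lemma EN_deggen g : N%:R * deggen g = (gexp g)%:~R.
Proof.
case: g => [[j|j]|k] /=; last by rewrite mulr0.
  by rewrite rmorphB/= pospart_subn mulrBr mulrCA EN_degtau -!natrM mulnC [(_ * d)%N]mulnC.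
by rewrite rmorphB/= pospart_subn mulrBr mulrCA EN_degtau -!natrM mulnC [(_ * d)%N]mulnC.
Qed.

Lemma EN_tmdeg k (M : {cmonom gen}) : N%:R * tmdeg deggen degtau k M =
  (d%:Z * k%:Z + \sum_(g <- finsupp M) gexp g * (M g)%:Z)%:~R.
Proof.
rewrite /tmdeg mulrDr [N%:R * (k%:R * _)]mulrCA EN_degtau intrD intrM [k%:R * _]mulrC; congr (_ + _).
rewrite mulr_sumr rmorph_sum; apply: eq_bigr => g _.
by rewrite mulrCA EN_deggen rmorphM/= mulrC.
Qed.

Lemma homog_tau k : homog (d%:Z * k%:Z) (tau2 R m n u ^+ k).
Proof. by apply: homogX; exists 'X; rewrite line_evalX tau2E. Qed.

(** On $\tau$ and on each generator, the weight of the image is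
$N$ times the degree; hence also on every monomial. *)
Lemma realize_hcomp (q : nat) (f : {poly R1}) :
  homog (N * q)%:Z (realize (hcomp deggen degtau q%:R f)).
Proof.
rewrite /hcomp rmorph_sum; elim/big_ind: _ => [||k _].
- exact: homog0.
- by move=> x y; exact: homogD.
rewrite rmorph_sum; elim/big_rec: _ => [|M x /eqP Mq hx]; first exact: homog0.
apply: homogD => //; rewrite [X in homog _ X]teval_mono.
have zE : (N * q)%:Z = 0 + (\sum_(g <- finsupp M) gexp g * (M g)%:Z) + d%:Z * k%:Z.
  apply: (intr_inj (R := rat)); rewrite add0r [in RHS]addrC -EN_tmdeg Mq.
  by rewrite -natrM.
rewrite zE; apply: homogM; last exact: homog_tau.
by apply: homogM; [exact: homog_const|exact: homog_meval].
Qed.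

Lemma inR2_realize (f : {poly R1}) : inR2 (realize f).
Proof.
rewrite (poly_monoE f) rmorph_sum; apply: inR2_sum => k _.
rewrite rmorph_sum; apply: inR2_sum => M _; rewrite [X in inR2 X]teval_mono.
apply: inR2M; last exact/inR2X/inR2_tau2.
apply: inR2M; first exact: inR2_tofrac.
have [p ->] := homog_meval M.
by apply: inR2M; [exact: inR2_line_eval|exact: inR2_varz].
Qed.

(** The component $s^kp\,T^j$ is $\tau^k$ times an element of the shape
of the values of the generators. *)
Lemma tau_split p (k j : nat) : lev (p * 'X^k) * th ^+ (N * j) =
  tau2 R m n u ^+ k * (lev p * th ^ ((N * j)%:Z - (d * k)%:Z)).
Proof.
rewrite rmorphM rmorphXn/= line_evalX tau2E// exprMn -exprM.
have := expfzDr (d * k)%:Z ((N * j)%:Z - (d * k)%:Z) (laurent_var_neq0 R u).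
rewrite [_%:Z + (_ - _)]addrC subrK => thE.
rewrite -[X in _ * X]/(th ^ (N * j)%:Z) thE -[th ^ (d * k)%:Z]/(th ^+ (d * k)).
by move: (lev p) (line R m n u ^+ k) (th ^+ _) (th ^ _) => x y z t; ring.
Qed.

Local Notation tE := (tE R a m n delta i u).
Local Notation tF := (tF R a m n delta i u).
Local Notation varG := (@varG R a m n delta i u).
Local Notation varx := (@varx R a m n delta i u).

Lemma tE_sum : tE = 'X^(vE - uE) + \sum_(j < vE) 'X^(j - uE) * (varG j)%:P.
Proof.
rewrite /Defs.tE -addrA; congr (_ + _).
rewrite [RHS](bigID (fun j : 'I_vE => uE <= j)%N)/=; congr (_ + _).
apply: eq_big => [j|j jlt]; first by rewrite ltnNge.
have /eqP -> : (j - uE == 0)%N by rewrite subn_eq0 ltnW.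
by rewrite expr0 mul1r.
Qed.

Lemma tF_sum : tF = \sum_(j < nF) 'X^(j - uF) * (varx j)%:P.
Proof.
rewrite /Defs.tF.
rewrite [RHS](bigID (fun j : 'I_nF => uF <= j)%N)/=; congr (_ + _).
apply: eq_big => [j|j jlt]; first by rewrite ltnNge.
have /eqP -> : (j - uF == 0)%N by rewrite subn_eq0 ltnW.
by rewrite expr0 mul1r.
Qed.

Lemma embR2_sum_wpart k (f : pol2) : (size (straight u f) <= k)%N ->
  embR2 m n u f = \sum_(j < k) embR2 m n u (wpart u j%:Z f).
Proof.
move=> szf; rewrite -(@unstraightK R m n u f).
have {1}-> : straight u f = \sum_(j < k) ((straight u f)`_j)%:P * 'X^j.
  apply/polyP => j; rewrite coef_sum.
  under eq_bigr do rewrite coefCM coefXn.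
  have [ltj|lej] := ltnP j k.
    rewrite (bigD1 (Ordinal ltj))//= eqxx mulr1 big1 ?addr0// => l.
    by rewrite -val_eqE/= eq_sym => /negPf ->; rewrite mulr0.
  rewrite nth_default ?(leq_trans szf)// big1// => l _.
  by rewrite gtn_eqF ?mulr0// (leq_trans (ltn_ord l)).
rewrite rmorph_sum; apply: eq_bigr => j _.
by rewrite rmorphM rmorphXn/= unstraightC unstraightX embR2_wpart// exprM.
Qed.

Section Compatibility.
Variables (E F' : pol2) (alpha : {poly C}).
Local Notation stE := (straight u E).
Local Notation stF := (straight u F').
Hypothesis pGE : forall j : 'I_vE, stE`_j = pG j * 'X^(j - uE).
Hypothesis pxE : forall j : 'I_nF, stF`_j = px j * 'X^(j - uF).
Hypothesis size_E : (size stE <= vE.+1)%N.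
Hypothesis lead_E : stE`_vE = 'X^(vE - uE).
Hypothesis size_F : (size stF <= nF)%N.

Lemma realize_partG (j : 'I_vE) :
  embR2 m n u (wpart u j%:Z E) = realize ('X^(j - uE) * (varG j)%:P).
Proof.
by rewrite embR2_wpart// pGE tau_split [RHS]teval_shift.
Qed.

Lemma realize_partx (j : 'I_nF) :
  embR2 m n u (wpart u j%:Z F') = realize ('X^(j - uF) * (varx j)%:P).
Proof.
by rewrite embR2_wpart// pxE tau_split [RHS]teval_shift.
Qed.

Lemma realize_tF : embR2 m n u F' = realize tF.
Proof.
rewrite (embR2_sum_wpart size_F) tF_sum rmorph_sum.
by apply: eq_bigr => j _; exact: realize_partx.
Qed.

Hypothesis vE_d : ((size alpha).-1 * vE = d)%N.
Hypothesis vE_N : ((size alpha).-1 * (vE - uE) = N)%N.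
Hypothesis lt_uv : (uE < vE)%N.

Lemma realize_tE : embR2 m n u E = realize tE.
Proof.
rewrite (embR2_sum_wpart size_E) tE_sum rmorphD rmorph_sum.
rewrite big_ord_recr/= addrC; congr (_ + _).
  rewrite embR2_wpart// lead_E -['X^_]mul1r tau_split rmorph1 mul1r.
  rewrite [RHS]rmorphXn/= realize_tau.
  have -> : (N * vE)%:Z - (d * (vE - uE))%:Z = 0.
    by rewrite -vE_d -vE_N; apply/eqP; rewrite subr_eq0; apply/eqP; congr Posz; lia.
  by rewrite expr0z mulr1.
by apply: eq_bigr => j _; exact: realize_partG.
Qed.

Definition tAll : {poly R1} :=
  (map_poly (fun x => (scal a m n delta i u x)%:P) alpha).[tE] + tF.

Lemma realize_tAll : realize tAll = embR2 m n u (subst2 alpha E + F').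
Proof.
rewrite /tAll rmorphD [RHS]rmorphD /= -realize_tF; congr (_ + _).
rewrite /subst2 !horner_poly !rmorph_sum; apply: eq_bigr => j _.
rewrite rmorphM rmorphXn [RHS]rmorphM rmorphXn/= -realize_tE.
by rewrite embR2_const realize_const.
Qed.

Local Notation degP := (@degP R gen deggen degtau).
Local Notation k0 := (size alpha).-1.
Hypothesis alpha_monic : alpha \is monic.
Hypothesis nF_d : (nF <= d)%N.

Lemma degtau_tau : (vE - uE)%:R * degtau = vE%:R.
Proof.
apply: (mulfI EN_neq0); rewrite mulrCA EN_degtau -!natrM; congr (_%:R).
by rewrite -vE_d -vE_N; lia.
Qed.

Lemma degP_varG (j : 'I_vE) :
  degP (fun l => l < vE)%N ('X^(j - uE) * (varG j)%:P).
Proof.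
rewrite mulrC; apply: degP_mono; exists j; last exact: ltn_ord.
by rewrite tmdeg_var /= pospart_subn addrC subrK.
Qed.

Lemma degP_varx (j : 'I_nF) :
  degP (fun l => l < d)%N ('X^(j - uF) * (varx j)%:P).
Proof.
rewrite mulrC; apply: degP_mono; exists j; last exact: (leq_trans (ltn_ord j)).
by rewrite tmdeg_var /= pospart_subn addrC subrK.
Qed.

Lemma poly_Xn_mono k : 'X^k = (<< 1 *g mone >>)%:P * 'X^k :> {poly R1}.
Proof. by rewrite -[<< _ *g _ >>]/(1 : R1) mul1r. Qed.

Lemma degP_tauX k : degP (fun l => l = k * vE)%N ('X^((vE - uE) * k)).
Proof.
rewrite poly_Xn_mono; apply: degP_mono; exists (k * vE)%N => //.
by rewrite tmdeg_tau natrM mulrAC degtau_tau -natrM mulnC.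
Qed.

Lemma degP_const x : degP (fun l => l = 0)%N (scal a m n delta i u x)%:P.
Proof.
have -> : scal a m n delta i u x = << x *g mone >>.
  by rewrite /scal -mul_malgC mulr1.
rewrite -[_%:P]mulr1 -(expr0 'X).
by apply: degP_mono; exists 0%N => //; rewrite tmdeg_tau mul0r.
Qed.

(** The degrees are such that $\tau^{\mathrm{v}_E-\mathrm{u}_E}$ is the only
term of degree $\mathrm{v}_E$ in $\tilde E^\circ$. *)
Lemma degP_tEX k : exists2 r, tE ^+ k = 'X^((vE - uE) * k) + r &
  degP (fun l => l < k * vE)%N r.
Proof.
elim: k => [|k [r rE rd]].
  by exists 0; [rewrite muln0 !expr0 addr0|exact: degP0].
set r1 := \sum_(j < vE) 'X^(j - uE) * (varG j)%:P.
have r1d : degP (fun l => l < vE)%N r1 by apply: degP_sum => j _; exact: degP_varG.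
have Xd : degP (fun l => l = vE)%N ('X^(vE - uE)).
  by have := @degP_tauX 1; rewrite muln1 mul1n.
exists ('X^(vE - uE) * r + r1 * ('X^((vE - uE) * k) + r)).
  by rewrite exprS rE tE_sum -/r1 mulrDl mulrDr -exprD mulnS -addrA.
apply: degPD.
  by apply: (degPM _ _ Xd rd) => x y -> yk; rewrite mulSn ltn_add2l.
apply: (degPM (fun l => l <= k * vE)%N _ r1d) => [x y xv yk|].
  by rewrite mulSn -addSn leq_add.
apply: degPD; last by apply: degPW rd => x /ltnW.
by apply: degPW (@degP_tauX k) => x ->.
Qed.

Lemma tAll_lead : exists2 r, tAll = 'X^N + r & degP (fun l => l < d)%N r.
Proof.
have kE : size alpha = k0.+1.
  by rewrite prednK// size_poly_gt0 monic_neq0.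
have lk : alpha`_k0 = 1 by have /eqP := alpha_monic.
have vE0 : (0 < vE)%N by exact: leq_ltn_trans lt_uv.
have scal1 : scal a m n delta i u (1 : C) = 1 by rewrite /scal scale1r.
have [r rE rd] := degP_tEX k0.
rewrite /tAll horner_poly kE big_ord_recr/= lk scal1 mul1r rE.
have -> : 'X^((vE - uE) * k0) = 'X^N :> {poly R1} by rewrite mulnC vE_N.
set s := \sum_(j < k0) _; exists (s + r + tF); first by rewrite (addrCA s 'X^N r) -addrA.
apply: degPD; last first.
  by rewrite tF_sum; apply: degP_sum => j _; exact: degP_varx.
apply: degPD; last by rewrite -vE_d; exact: rd.
apply: degP_sum => j _; have [rj rjE rjd] := degP_tEX j.
apply: (degPM (fun l => l <= j * vE)%N _ (@degP_const _)) => [x y -> yj|].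
  by rewrite add0n -vE_d (leq_ltn_trans yj)// ltn_pmul2r.
rewrite rjE; apply: degPD; last by apply: degPW rjd => x /ltnW.
by apply: degPW (@degP_tauX j) => x ->.
Qed.

Lemma degP_tAll : degP (fun l => l <= d)%N tAll.
Proof.
have [r -> rd] := tAll_lead; apply: degPD; last by apply: degPW rd => x /ltnW.
rewrite -vE_N mulnC; apply: degPW (@degP_tauX k0) => x ->.
by rewrite vE_d.
Qed.

Lemma d_tdegs : d%:R \in tdegs deggen degtau tAll.
Proof.
have tN : tmdeg deggen degtau N (@mone {cmonom gen}) = d%:R.
  by rewrite tmdeg_tau EN_degtau.
rewrite -tN; apply: tdegs_mem.
have [r -> rd] := tAll_lead; rewrite -mcoeff_neq0 coefD coefXn eqxx mcoeffD mcoeff1 eqxx.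
have : (@mone {cmonom gen}) \notin msupp r`_N.
  by apply/negP => /rd[j]; rewrite tN => /eqP; rewrite eqr_nat => /eqP <-; rewrite ltnn.
by move=> /mcoeff_outdom ->; rewrite addr0 oner_eq0.
Qed.

(** The components of $\alpha(\tilde E^\circ)+\tilde F^\circ$ of distinct
degrees go to distinct powers of $T$ ([realize_hcomp]); since [unstraight] is
injective, they must go to the components of $\alpha(E)+F'$. *)
Lemma realize_polyH l : realize (polyH a m n delta i u alpha)`_l =
  if (l <= d)%N
  then lev (straight u (subst2 alpha E + F'))`_(d - l) * th ^+ (N * (d - l))
  else 0.
Proof.
rewrite (coef_hpoly _ degP_tAll d_tdegs); case: ifP => lel; last exact: rmorph0.
have /choice[p pE] := fun q : nat => realize_hcomp q tAll.
suff -> : straight u (subst2 alpha E + F') = \poly_(q < d.+1) p q.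
  by rewrite coef_poly ltnS leq_subr; exact: pE.
apply: (@unstraight_inj R m n u) => //; rewrite unstraightK -realize_tAll.
rewrite {1}(hcomp_sum degP_tAll) rmorph_sum poly_def rmorph_sum.
apply: eq_bigr => q _.
by rewrite -mul_polyC rmorphM rmorphXn/= unstraightC unstraightX pE -exprM.
Qed.

End Compatibility.

End Realization.

(** * Values of the powers of H *)

Section LaurentExtension.
Variables (R : realType) (a m n delta i : nat) (u : bool).
Local Notation K := (frac2 R).
Local Notation R1 := (R1 R a m n delta i u).
Local Notation laurent := (laurent R a m n delta i u).
Variable S : {rmorphism {poly R1} -> K}.
Hypothesis SX_neq0 : S 'X != 0.
Local Notation tau := (S 'X).

Lemma SextE (g : laurent) :
  Sext S g = mmap (S \o @polyC _) (fun z : int => tau ^ z) g.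
Proof. by []. Qed.

Lemma SextD (g h : laurent) : Sext S (g + h) = Sext S g + Sext S h.
Proof. by rewrite !SextE mmapD. Qed.

Lemma Sext_sum (J : Type) (r : seq J) (P : pred J) (F : J -> laurent) :
  Sext S (\sum_(j <- r | P j) F j) = \sum_(j <- r | P j) Sext S (F j).
Proof.
apply: (big_morph (Sext S)) => [g h|]; first exact: SextD.
by rewrite SextE mmap0.
Qed.

Lemma SextZ (x : R1) (g : laurent) : Sext S (x *: g) = S x%:P * Sext S g.
Proof.
have -> : Sext S (x *: g) = \sum_(z <- msupp g) S (mcoeff z (x *: g))%:P * tau ^ z.
  exact: (mmapEw (f := S \o @polyC _) (h := fun z : int => tau ^ z) (msuppZ_le x g)).
rewrite /Sext [RHS]mulr_sumr; apply: eq_bigr => z _.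
by rewrite mcoeffZ polyCM rmorphM/= mulrA.
Qed.

Lemma Sext_tshift z (p : {poly R1}) :
  Sext S (tshift z p : laurent) = S p * tau ^ z.
Proof.
have -> : S p = \sum_(k < size p) S (p`_k *: 'X^k).
  by rewrite -{1}[p]coefK poly_def rmorph_sum.
rewrite Sext_sum mulr_suml.
apply: eq_bigr => k _.
rewrite SextE mmapU -mul_polyC rmorphM rmorphXn/= expfzDr// mulrA.
by [].
Qed.

Hypothesis S_R2 : forall p, inR2 (S p).

(** $\tau^{\mathfrak j}\,g$ is a polynomial in $\tau$ when $\mathfrak j$
is the order of the pole, and $\tilde G_{B,e-\mu,k}$ consists of its terms of degree less than
$k$. *)
Lemma Sext_ppart (g : laurent) (k : nat) : (k <= pole g)%N ->
  exists2 x, inR2 x & tau ^+ pole g * Sext S g = S (ppart g k) + tau ^+ k * x.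
Proof.
set J := pole g => lekJ.
have gJ z : z \in msupp g -> - J%:Z <= z.
  by move=> zg; rewrite /J /pole; case: ex_minnP => l /allP gl _; apply: gl.
pose F (z : int) := S (mcoeff z g)%:P * tau ^ (z + J%:Z).
exists (\sum_(z <- msupp g | ~~ (z < k%:Z - J%:Z))
          S (mcoeff z g)%:P * tau ^ (z + J%:Z - k%:Z)).
  apply: inR2_sum => z; rewrite -leNgt => lez; apply: inR2M; first exact: S_R2.
  have : 0 <= z + J%:Z - k%:Z by rewrite -addrA addrC; lia.
  case: (z + J%:Z - k%:Z) => // l _.
  by have := S_R2 ('X^l); rewrite rmorphXn.
have -> : tau ^+ J * Sext S g = \sum_(z <- msupp g) F z.
  rewrite /Sext mulr_sumr; apply: eq_bigr => z _.
  by rewrite mulrCA /F addrC expfzDr.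
rewrite (bigID (fun z : int => z < k%:Z - J%:Z))/=; congr (_ + _); last first.
  rewrite mulr_sumr; apply: eq_bigr => z _.
  rewrite mulrCA /F -[tau ^+ k]/(tau ^ k%:Z) -expfzDr//.
  by congr (_ * _ ^ _); lia.
rewrite /ppart rmorph_sum -/J.
pose s := index_iota (J.+1 - k) J.+1.
have -> : \sum_(j <- s) S ('X^(J - j) * (mcoeff (- j%:Z) g)%:P) =
    \sum_(z <- [seq - j%:Z | j <- s]) F z.
  rewrite big_map; apply: eq_big_seq => j; rewrite mem_index_iota => /andP[_ ltj].
  rewrite rmorphM rmorphXn/= mulrC /F; congr (_ * _).
  by rewrite -[tau ^+ _]/(tau ^ (J - j)%N%:Z) -subzn// addrC.
rewrite [RHS](bigID (fun z : int => z \in msupp g))/= [X in _ = _ + X]big1 ?addr0.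
  rewrite -[RHS]big_filter -[LHS]big_filter; apply: perm_big; apply: uniq_perm.
  - by rewrite filter_uniq// fset_uniq.
  - rewrite filter_uniq// map_inj_uniq ?iota_uniq// => x y /oppr_inj[].
    by [].
  move=> z; rewrite !mem_filter; have [zg|] := boolP (z \in msupp g); last by rewrite andbF.
  rewrite andbT/=; apply/idP/mapP => [ltz|[j]].
    have zJ := gJ _ zg; exists `|z|%N.
      by rewrite mem_index_iota; lia.
    by lia.
  by rewrite mem_index_iota => ? ->; lia.
by move=> z zg; rewrite /F mcoeff_outdom// rmorph0 mul0r.
Qed.

End LaurentExtension.

Section PowerEvaluation.
Variables (R : realType) (a m n delta i : nat) (u : bool).
Hypotheses (m_gt0 : (0 < m)%N) (n_gt0 : (0 < n)%N).
Local Notation C := R[i].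
Local Notation K := (frac2 R).
Local Notation N := (EN m n u).
Local Notation d := (Ed m n u).
Local Notation R1 := (R1 R a m n delta i u).
Local Notation laurent := (laurent R a m n delta i u).
Local Notation th := (laurent_var R u).
Local Notation lev := (@line_eval R m n u).
Local Notation sigma := (line R m n u).
Variable S : {rmorphism {poly R1} -> K}.
Hypothesis SX : S 'X = tau2 R m n u.
Hypothesis S_const : forall x : C, S (scal a m n delta i u x)%:P = const_frac x.
Variables (H : {poly {poly R1}}) (fl : nat -> {poly C}).
Hypothesis SH : forall l, (l < (size H).-1)%N ->
  S H`_l.+1 = lev (fl l) * th ^ ((N * d)%:Z - (N * l.+1)%:Z).

Lemma line_neq0 : sigma != 0.
Proof.
have := tau2_neq0 R u m_gt0 n_gt0; rewrite (tau2E R u m_gt0 n_gt0).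
by apply: contraNneq => ->; rewrite mul0r.
Qed.

Lemma SX_neq0 : S 'X != 0. Proof. by rewrite SX tau2_neq0. Qed.

(** If $H=\tau^N(1+\cdots)$, this is the image of the dots after
$t\mapsto s^Nt$, up to powers of [laurent_var]; the scaling clears the
denominators $s^N$ that come from $\tau^N$. *)
Definition ratio_series : {poly {poly C}} :=
  \sum_(j < (size H).-1) ('X^(N * j) * fl j) *: 'X^(j.+1).

Lemma prod_exprz (F : fieldType) (x : F) (I : Type) (r : seq I) (z : I -> int) :
  x != 0 -> \prod_(j <- r) x ^ z j = x ^ (\sum_(j <- r) z j).
Proof.
move=> x0; elim: r => [|j r IH]; first by rewrite !big_nil expr0z.
by rewrite !big_cons IH expfzDr.
Qed.

(** The powers of [laurent_var] and of [line] are compared separately.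
Each factor $y_j$ lowers the power of $\tau$, hence that of [line], by $N$. The
factors $s^{Nj}$ of [ratio_series] and the power $-N\mu$ in front make up for it,
because $\sum_j(j+1)v_j=\mu$. *)
Lemma Sext_Hpow_term (A : rat) (kA : int) (mu : nat) (v : 'I_(size H).-1 -> nat) :
  N%:R * A = kA%:~R -> (\sum_(j < (size H).-1) j.+1 * v j)%N = mu ->
  let s := (\sum_j v j)%N in
  Sext S (@tshift R a m n delta i u (Num.floor (N%:R * (A - s%:R)))
     ((scal a m n delta i u
         (ratr (\prod_(l < s) (A - l%:R) / (\prod_j (v j)`!)%N%:R)))%:P
      * \prod_(j < (size H).-1) H`_j.+1 ^+ v j)) =
    th ^ (d%:Z * kA - (N * mu)%:Z) * sigma ^ (kA - (N * mu)%:Z)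
    * lev ((gfall (ratr A) s / (\prod_j (v j)`!)%N%:R)%:P
           * \prod_(j < (size H).-1) ('X^(N * j) * fl j) ^+ v j).
Proof.
move=> NA vmu /=; set s := (\sum_j v j)%N.
have th0 := laurent_var_neq0 R u; have sg0 := line_neq0.
have les : (s <= mu)%N.
  by rewrite /s -vmu; apply: leq_sum => j _; exact: leq_pmull.
have -> : Num.floor (N%:R * (A - s%:R)) = kA - (N * s)%:Z.
  rewrite mulrBr NA -natrM -[(N * s)%:R]/((N * s)%:Z%:~R) -rmorphB/=.
  exact: intrKfloor.
rewrite Sext_tshift ?SX_neq0// SX.
rewrite rmorphM/= S_const.
have wt : (\sum_(j < (size H).-1) j * v j + s)%N = mu.
  by rewrite -vmu /s -big_split/=; apply: eq_bigr => j _; rewrite mulSn addnC.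
have -> : S (\prod_(j < (size H).-1) H`_j.+1 ^+ v j) =
   lev (\prod_(j < (size H).-1) fl j ^+ v j) * th ^ ((N * d * s)%:Z - (N * mu)%:Z).
  transitivity (\prod_(j < (size H).-1) (lev (fl j ^+ v j)
      * th ^ (((N * d)%:Z - (N * j.+1)%:Z) * (v j)%:Z))).
    rewrite rmorph_prod; apply: eq_bigr => j _; rewrite rmorphXn/= SH//.
    by rewrite exprMn [lev _ in RHS]rmorphXn/= -exprz_exp.
  rewrite big_split/= [lev _ in RHS]rmorph_prod/= (prod_exprz _ _ th0).
  congr (_ * th ^ _).
  transitivity ((\sum_(j < (size H).-1) (N * d * v j)%N)%:Z
      - (\sum_(j < (size H).-1) (N * (j.+1 * v j))%N)%:Z).
    rewrite !(big_morph Posz PoszD (erefl 0%:Z)) -sumrB.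
    by apply: eq_bigr => j _; rewrite mulrBl -!PoszM mulnA.
  by rewrite -!big_distrr/= vmu.
have -> : \prod_(j < (size H).-1) ('X^(N * j) * fl j) ^+ v j =
    'X^(N * (mu - s)) * \prod_(j < (size H).-1) fl j ^+ v j :> {poly C}.
  under eq_bigr do rewrite exprMn -exprM -mulnA.
  rewrite big_split/= prodrXr; congr ('X^_ * _).
  by rewrite -big_distrr/= -wt addnK.
have -> : const_frac (ratr (\prod_(l < s) (A - l%:R) / (\prod_j (v j)`!)%N%:R))
    = lev (gfall (ratr A) s / (\prod_j (v j)`!)%N%:R)%:P.
  rewrite line_evalC; congr const_frac.
  rewrite fmorph_div rmorph_prod/= rmorph_nat; congr (_ / _).
  by apply: eq_bigr => l _; rewrite rmorphB/= rmorph_nat.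
rewrite (tau2E R u m_gt0 n_gt0) expfzMl -[th ^+ d]/(th ^ d%:Z) exprz_exp.
set F := \prod_(j < (size H).-1) fl j ^+ v j.
set x := (_%:P : {poly C}).
have -> : lev (x * ('X^(N * (mu - s)) * F)) = lev x * (sigma ^ (N * (mu - s))%:Z * lev F).
  by rewrite !rmorphM rmorphXn/= line_evalX.
have e1 : th ^ ((N * d * s)%:Z - (N * mu)%:Z) * th ^ (d%:Z * (kA - (N * s)%:Z))
    = th ^ (d%:Z * kA - (N * mu)%:Z).
  by rewrite -(expfzDr _ _ th0); congr (_ ^ _); rewrite !PoszM; ring.
have e2 : sigma ^ (kA - (N * mu)%:Z) * sigma ^ (N * (mu - s))%:Z = sigma ^ (kA - (N * s)%:Z).
  rewrite -(expfzDr _ _ sg0) mulnBr -subzn; last by rewrite leq_mul2l les orbT.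
  by congr (_ ^ _); ring.
rewrite -e1 -e2.
move: (lev x) (lev F) (th ^ _) (th ^ _) (sigma ^ _) (sigma ^ _) => *; ring.
Qed.

Lemma Sext_Hpow (A : rat) (kA : int) (M mu : nat) : (mu <= M)%N ->
  N%:R * A = kA%:~R ->
  Sext S (@Hpow R a m n delta i u H A mu) =
    th ^ (d%:Z * kA - (N * mu)%:Z) * sigma ^ (kA - (N * mu)%:Z)
    * lev (powser polyC (ratr A : C) M ratio_series)`_mu.
Proof.
move=> leM NA.
rewrite /Hpow Sext_sum /ratio_series (coef_powser polyC (ratr A : C) _ leM).
rewrite rmorph_sum mulr_sumr; apply: eq_bigr => v /eqP vmu.
exact: (Sext_Hpow_term NA vmu).
Qed.

End PowerEvaluation.

(** * A supported set of exponents *)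

Lemma sum_fset_support (V : nmodType) (C : nmodType) (c : nat -> C) (M mu : nat)
    (g : nat -> V) : (mu <= M)%N -> (forall beta, c beta = 0 -> g beta = 0) ->
  \sum_(beta <- [fset beta in iota 1 M | c beta != 0]%fset | (1 <= beta <= mu)%N)
    g beta = \sum_(beta <- iota 1 mu) g beta.
Proof.
move=> leM g0; set B := [fset beta in _ | _]%fset.
have BE beta : (beta \in B) = (1 <= beta <= M)%N && (c beta != 0).
  by rewrite !inE/= mem_iota add1n ltnS.
rewrite [RHS](bigID (fun beta => c beta != 0))/= [X in _ = _ + X]big1 ?addr0; last first.
  by move=> beta /negPn/eqP/g0.
rewrite -[LHS]big_filter -[RHS]big_filter; apply: perm_big; apply: uniq_perm.
- by rewrite filter_uniq// fset_uniq.
- by rewrite filter_uniq// iota_uniq.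
move=> beta; rewrite !mem_filter mem_iota add1n ltnS.
have -> : (beta \in (enum_fset B)) = (beta \in B) by [].
rewrite BE; case: (c beta != 0); rewrite ?andbF//= andbT.
case: (leqP 1 beta) => //= _; case: (leqP beta mu) => //= bmu.
by rewrite (leq_trans bmu leM).
Qed.

(** The hypothesis says that $N(e-\beta)/d$ is the integer
$k-N\beta$. By Bezout, so is $\gcd(N,d)(e-\beta)/d$, and
$\gcd(N,d)=\gcd(m,n)$. *)
Lemma Er_dvd_int (m n : nat) (u : bool) (e k beta : nat) :
  (0 < m)%N -> (0 < n)%N ->
  (Ed m n u * k = EN m n u * e + EN m n u * (Ed m n u - 1) * beta)%N ->
  (Er m n)%:R * (e%:R - beta%:R) / (Ed m n u)%:R \is a @Num.int rat.
Proof.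
move=> m0 n0; set d := Ed m n u; set N := EN m n u => kE.
have d0 : (0 < d)%N by rewrite /d /Ed addn_gt0 n0 orbT.
have dnz : d%:R != 0 :> rat by rewrite pnatr_eq0 -lt0n.
have rE : Er m n = gcdn N d.
  rewrite /Er /N /EN /d /Ed; case: (u); last by rewrite mul0n.
  by rewrite mul1n gcdnDr gcdnC.
have [x y xyE _] := egcdnP d (EN_gt0 u m0 n0).
apply/intrP; exists (x%:Z * (k%:Z - (N * beta)%:Z) - y%:Z * (e%:Z - beta%:Z)).
have rQ : (Er m n)%:R = x%:R * N%:R - y%:R * d%:R :> rat.
  by rewrite rE -!natrM xyE natrD addrAC subrr add0r.
have kQ : k%:R = (N%:R * e%:R + N%:R * (d%:R - 1) * beta%:R) / d%:R :> rat.
  have : d%:R * k%:R = N%:R * e%:R + N%:R * (d%:R - 1) * beta%:R :> rat.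
    by rewrite -natrM kE natrD !natrM natrB.
  by move=> <-; rewrite mulrC mulKf.
rewrite rmorphB/= !rmorphM/= !rmorphB/= -![(_%:Z)%:~R]/(_%:R) rQ kQ natrM.
by field.
Qed.

Lemma sum_iota_head (V : nmodType) (f : nat -> V) mu :
  \sum_(beta < mu.+1) f beta = f 0%N + \sum_(beta <- iota 1 mu) f beta.
Proof. by rewrite -(big_mkord xpredT) big_ltn// /index_iota subn1. Qed.

Section Supported.
Variables (R : realType) (a b m n delta i : nat) (u : bool).
Hypotheses (m_gt0 : (0 < m)%N) (n_gt0 : (0 < n)%N).
Local Notation C := R[i].
Local Notation pol2 := {poly {poly R[i]}}.
Local Notation K := (frac2 R).
Local Notation N := (EN m n u).
Local Notation d := (Ed m n u).
Local Notation e := (Ee a b m n u).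
Local Notation vE := (vE a m n delta u).
Local Notation uE := (uE a m n delta u).
Local Notation nF := (nF a m n delta i u).
Local Notation uF := (uF m n i u).
Local Notation gen := (gen a m n delta i u).
Local Notation R1 := (R1 R a m n delta i u).
Local Notation th := (laurent_var R u).
Local Notation lev := (@line_eval R m n u).
Local Notation sigma := (line R m n u).

Variables (pG : 'I_vE -> {poly C}) (px : 'I_nF -> {poly C}).
Variables (E F' G : pol2) (alpha : {poly C}) (c0 : C).
Local Notation stE := (straight u E).
Local Notation stF := (straight u (subst2 alpha E + F')).
Local Notation stG := (straight u G).
Hypothesis pGE : forall j : 'I_vE, stE`_j = pG j * 'X^(j - uE).
Hypothesis pxE : forall j : 'I_nF, (straight u F')`_j = px j * 'X^(j - uF).
Hypothesis size_E : (size stE <= vE.+1)%N.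
Hypothesis lead_E : stE`_vE = 'X^(vE - uE).
Hypothesis size_F' : (size (straight u F') <= nF)%N.
Hypothesis vE_d : ((size alpha).-1 * vE = d)%N.
Hypothesis vE_N : ((size alpha).-1 * (vE - uE) = N)%N.
Hypothesis lt_uv : (uE < vE)%N.
Hypothesis alpha_monic : alpha \is monic.
Hypothesis nF_d : (nF <= d)%N.
Hypothesis size_F : (size stF <= d.+1)%N.
Hypothesis lead_F : stF`_d = 'X^N.
Hypothesis size_G : (size stG <= e.+1)%N.
Hypothesis lead_G : stG`_e \is monic.
Hypothesis FG : jacobian (subst2 alpha E + F') G = const2 c0.
Hypothesis le_ude : (u.+2 <= d + e)%N.

Local Notation H := (polyH a m n delta i u alpha).

(** The test on [l] is needed because truncated subtraction would repeat the
component of degree 0. *)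
Definition coefF (l : nat) : {poly C} :=
  if (l.+1 <= d)%N then stF`_(d - l.+1) else 0.

Local Notation w := (ratio_series H coefF).

Lemma line_eval_inj : injective lev.
Proof.
move=> p q pq; apply: (@polyC_inj {poly C}); apply: (@unstraight_inj R m n u) => //.
Qed.

Lemma realize_H c l : realize pG px c H`_l.+1 =
  lev (coefF l) * th ^ ((N * d)%:Z - (N * l.+1)%:Z).
Proof.
rewrite (realize_polyH m_gt0 n_gt0 c pGE pxE size_E lead_E size_F' vE_d vE_N lt_uv alpha_monic nF_d).
rewrite /coefF; case: ifP => lel; last by rewrite rmorph0 mul0r.
by rewrite -[th ^+ _]/(th ^ (N * (d - l.+1))%N%:Z) mulnBr -subzn// leq_mul2l lel orbT.
Qed.

Lemma coefF_size l : ((size H).-1 <= l)%N -> coefF l = 0.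
Proof.
move=> lel; have := realize_H (fun=> 0) l.
rewrite nth_default; last by rewrite (leq_trans (leqSpred _)).
rewrite rmorph0 => /esym/eqP; rewrite mulf_eq0 (negPf (expfz_neq0 _ (laurent_var_neq0 R u))) orbF.
by rewrite -(rmorph0 lev) => /eqP/line_eval_inj.
Qed.

Lemma coef_w j : w`_j = if j is l.+1 then 'X^(N * l) * coefF l else 0.
Proof.
rewrite /ratio_series coef_sum.
under eq_bigr do rewrite coefZ coefXn.
case: j => [|l]; first by rewrite big1// => l _; rewrite mulr0.
have [ltl|lel] := ltnP l (size H).-1.
  rewrite (bigD1 (Ordinal ltl))//= eqxx mulr1 big1 ?addr0// => k.
  by rewrite -val_eqE/= eqSS eq_sym => /negPf ->; rewrite mulr0.
rewrite coefF_size// mulr0 big1// => k _.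
by rewrite eqSS gtn_eqF ?mulr0// (leq_trans (ltn_ord k)).
Qed.

Lemma reversal_ratio : reversal d stF \Po ('X^N%:P * 'X) = 'X^N%:P * (1 + w).
Proof.
apply/polyP => j; rewrite coef_comp_scale coef_reversal coefCM coefD coef1 coef_w.
case: j => [|l]/=; first by rewrite subn0 lead_F muln0 expr0 mulr1 addr0 mulr1.
rewrite add0r mulrA -exprD mulrC -mulnS ltnS /coefF.
by case: ifP => // _; rewrite !mulr0.
Qed.

Lemma Em_eq : (d + e - u.+2)%N = Em a b m n u.
Proof. by rewrite /Em -addn2 subnDA. Qed.

(** By [straight_expansion] and [Sext_Hpow], the $S$-value of
$\tilde G_{B,e-\mu}$ is the component of $G$ of $w$-degree $e-\mu$, for the set $B$
of all $\beta$ with $c_\beta\neq0$. This value lies in $R_2$, so by [Sext_ppart]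
the values of its truncations are multiples of powers of $\tau$, hence of $L$. *)
Lemma supported_exists : exists (c : nat -> C) (B : {fset nat}),
  admissibleB a b m n u B /\
  supported b [the {rmorphism {poly R1} -> K} of realize pG px c] alpha B.
Proof.
have d0 : (0 < d)%N by rewrite /Ed addn_gt0 n_gt0 orbT.
have w1 : ord_ge 1 w by apply/ord_geP => -[|j]// _; rewrite coef_w.
have [c [k [ck cE]]] :=
  straight_expansion d0 le_ude size_F size_G FG w1 reversal_ratio.
rewrite Em_eq in cE.
have c01 : c 0%N = 1.
  have := cE 0%N (leq0n _); rewrite big_ord1 muln0 expr0 mulr1 coef_reversal subn0/=.
  rewrite (coef0_pseries d e _ w1) mulr1 => gE.
  have := lead_G; rewrite gE qualifE/= lead_coefZ lead_coefXn mulr1.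
  by move/eqP.
pose B : {fset nat} := [fset beta in iota 1 (Em a b m n u) | c beta != 0]%fset.
have BE beta : (beta \in B) = (1 <= beta <= Em a b m n u)%N && (c beta != 0).
  by rewrite !inE/= mem_iota add1n ltnS.
pose S := [the {rmorphism {poly R1} -> K} of realize pG px c].
have SX : S 'X = tau2 R m n u by exact: realize_tau.
have SX0 : S 'X != 0 by rewrite SX tau2_neq0.
have S_const x : S (scal a m n delta i u x)%:P = const_frac x by exact: realize_const.
have SH l : (l < (size H).-1)%N ->
    S H`_l.+1 = lev (coefF l) * th ^ ((N * d)%:Z - (N * l.+1)%:Z).
  by move=> _; exact: realize_H.
have S_varc beta : S (varc R a m n delta i u beta)%:P = const_frac (c beta.-1.+1).
  transitivity (gval pG px c (inr beta.-1)); first exact: realize_var.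
  by rewrite /gval /gpoly /gexp line_evalC expr0z mulr1.
have th0 := laurent_var_neq0 R u.
have sg0 := line_neq0 R u m_gt0 n_gt0.
have term beta mu : (beta <= mu)%N -> (mu <= Em a b m n u)%N -> c beta != 0 ->
    const_frac (c beta) *
      Sext S (@Hpow R a m n delta i u H ((e%:R - beta%:R) / d%:R) (mu - beta)) =
    th ^ ((N * e)%:Z - (N * mu)%:Z) * sigma ^ (- (N * mu)%:Z) *
      lev (c beta *: ('X^(k beta) * (pseries d e (Em a b m n u) w beta)`_(mu - beta))).
  move=> leb lem cb.
  have NA : N%:R * ((e%:R - beta%:R) / d%:R) = ((k beta)%:Z - (N * beta)%:Z)%:~R :> rat.
    have dnz : d%:R != 0 :> rat by rewrite pnatr_eq0 -lt0n.
    rewrite rmorphB/= -![(_%:Z)%:~R]/(_%:R).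
    have kE : d%:R * (k beta)%:R = N%:R * e%:R + N%:R * (d%:R - 1) * beta%:R :> rat.
      by rewrite -natrM ck// natrD !natrM natrB.
    have -> : (k beta)%:R = (N%:R * e%:R + N%:R * (d%:R - 1) * beta%:R) / d%:R :> rat.
      by rewrite -kE mulrC mulKf.
    by rewrite natrM; field.
  rewrite (Sext_Hpow m_gt0 n_gt0 SX S_const SH (M := Em a b m n u) _ NA); last first.
    by rewrite (leq_trans _ lem)// leq_subr.
  have -> : ratr ((e%:R - beta%:R) / d%:R) = expnt C d e beta.
    by rewrite fmorph_div rmorphB/= !rmorph_nat.
  rewrite -/(pseries d e (Em a b m n u) w beta).
  move: ((pseries d e (Em a b m n u) w beta)`_(mu - beta)) => p.
  have -> : lev (c beta *: ('X^(k beta) * p)) =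
      const_frac (c beta) * (sigma ^ (k beta)%:Z * lev p).
    by rewrite -mul_polyC !rmorphM rmorphXn/= line_evalC line_evalX.
  have dk : (d * k beta)%:Z = (N * e)%:Z + (N * (d - 1) * beta)%:Z by rewrite ck.
  have zB : (N * (mu - beta))%:Z = (N * mu)%:Z - (N * beta)%:Z.
    by rewrite mulnBr -subzn// leq_mul2l leb orbT.
  have -> : d%:Z * ((k beta)%:Z - (N * beta)%:Z) - (N * (mu - beta))%:Z =
      (N * e)%:Z - (N * mu)%:Z.
    by rewrite mulrBr -PoszM dk zB !PoszM -subzn//; ring.
  have -> : (k beta)%:Z - (N * beta)%:Z - (N * (mu - beta))%:Z =
      - (N * mu)%:Z + (k beta)%:Z.
    by rewrite zB; ring.
  rewrite (expfzDr _ _ sg0).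
  move: (const_frac _) (th ^ _) (sigma ^ _) (sigma ^ _) (lev p) => *; ring.
have value mu : (mu <= Em a b m n u)%N ->
    Sext S (@tG R a b m n delta i u H B mu) =
    if (mu <= e)%N then embR2 m n u (wpart u (e - mu)%N%:Z G) else 0.
  move=> lem.
  have t0 := term 0%N mu (leq0n _) lem; rewrite c01 oner_eq0 subr0 subn0 in t0.
  have c1 : const_frac 1 = 1 :> K by rewrite -(rmorph1 (@Cfrac R)).
  rewrite c1 mul1r in t0; rewrite /tG SextD (t0 isT) Sext_sum.
  pose f beta := c beta *:
    ('X^(k beta) * (pseries d e (Em a b m n u) w beta)`_(mu - beta)).
  set A := th ^ _ * sigma ^ _.
  have -> : \sum_(beta <- B | (1 <= beta <= mu)%N)
      Sext S (varc R a m n delta i u beta *: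
        @Hpow R a m n delta i u H ((e%:R - beta%:R) / d%:R) (mu - beta))
    = \sum_(beta <- iota 1 mu) A * lev (f beta).
    transitivity (\sum_(beta <- B | (1 <= beta <= mu)%N) A * lev (f beta)).
      rewrite big_seq_cond [RHS]big_seq_cond; apply: eq_bigr => beta.
      case/and3P; rewrite BE => /andP[_ cb] b1 bmu.
      rewrite SextZ -(term beta mu bmu lem cb); congr (_ * _).
      rewrite (S_varc beta) (prednK b1); reflexivity.
    apply: (@sum_fset_support K C c _ mu (fun beta => A * lev (f beta)) lem) => beta cb.
    rewrite /f cb scale0r rmorph0 mulr0; reflexivity.
  rewrite -mulr_sumr -mulrDr -rmorph_sum -rmorphD/=.
  have fE : f 0%N + \sum_(beta <- iota 1 mu) f beta = (reversal e stG)`_mu * 'X^(N * mu).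
    rewrite (cE mu lem) (sum_iota_head f); reflexivity.
  have -> : 1 *: ('X^(k 0%N) * (pseries d e (Em a b m n u) w 0)`_mu) = f 0%N.
    rewrite /f c01 subn0; reflexivity.
  rewrite fE rmorphM rmorphXn/= line_evalX coef_reversal ltnS.
  have AE x : A * (lev x * sigma ^+ (N * mu)) = th ^ ((N * e)%:Z - (N * mu)%:Z) * lev x.
    have s1 : sigma ^ (- (N * mu)%:Z) * sigma ^+ (N * mu) = 1.
      rewrite -[sigma ^+ _]/(sigma ^ (N * mu)%:Z) -(expfzDr _ _ sg0) addNr.
      exact: expr0z.
    rewrite /A -[RHS]mulr1 -s1.
    move: (th ^ _) (lev x) (sigma ^ _) (sigma ^+ _) => y1 y2 y3 y4; ring.
  case: ifP => [lee|_]; last by (rewrite rmorph0 mul0r mulr0; reflexivity).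
  rewrite AE embR2_wpart mulrC; congr (_ * _).
  rewrite -[th ^+ _]/(th ^ (N * (e - mu))%N%:Z) mulnBr -subzn; first reflexivity.
  rewrite leq_mul2l lee; exact: orbT.
have S_R2 p : inR2 (S p) by exact: inR2_realize.
have G_R2 mu : (mu <= Em a b m n u)%N -> inR2 (Sext S (@tG R a b m n delta i u H B mu)).
  move=> lem; rewrite (value mu lem); case: ifP => _; last exact: inR20.
  exact: inR2_tofrac.
have admB : admissibleB a b m n u B.
  move=> beta; rewrite BE => /andP[betaB cb]; split=> //.
  exact: (Er_dvd_int m_gt0 n_gt0 (ck _ cb)).
exists c, B; split=> //; split=> [mu k' lem /andP[k1 lek]|mu /andP[ltmu lem]].
  have [x xR xE] := Sext_ppart SX0 S_R2 lek.
  have -> : S (ppart (@tG R a b m n delta i u H B mu) k') =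
     tau2 R m n u ^+ k' * (tau2 R m n u ^+ (pole (@tG R a b m n delta i u H B mu) - k')
        * Sext S (@tG R a b m n delta i u H B mu) - x).
    rewrite mulrBr mulrA -exprD subnKC//.
    rewrite -SX xE addrK; reflexivity.
  apply: Pzero_tau2 => //.
  apply: inR2D; last exact: inR2N.
  apply: inR2M; last exact: G_R2.
  exact/inR2X/inR2_tau2.
rewrite value//.
rewrite ifF; first reflexivity.
by apply/negbTE; rewrite -ltnNge -addn1.
Qed.

End Supported.

(** * Applying the remainder vanishing property *)

Lemma minimal_fset (T : choiceType) (P : {fset T} -> Prop) (B : {fset T}) : P B ->
  exists2 B' : {fset T}, (B' `<=` B)%fset /\ P B' &
    forall B'' : {fset T}, (B'' `<` B')%fset -> ~ P B''.
Proof.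
elim: {B}#|` B| {-2}B (leqnn #|` B|) => [|k IH] B szB PB.
  exists B => // B'' /fproper_ltn_card; rewrite ltnNge.
  by move: szB; rewrite leqn0 => /eqP ->.
have [[B' [B'B PB']]|nB] := pselect (exists B' : {fset T}, (B' `<` B)%fset /\ P B').
  have [|B2 [B2B' PB2] minB2] := IH B' _ PB'.
    by rewrite -ltnS (leq_trans (fproper_ltn_card B'B)).
  by exists B2 => //; split=> //; apply: fsubset_trans B2B' (fproper_sub B'B).
by exists B => // B'' B''B PB''; apply: nB; exists B''.
Qed.

Section RemainderVanishing.
Variables (R : realType) (a b m n delta i : nat) (u : bool).
Hypotheses (m_gt0 : (0 < m)%N) (n_gt0 : (0 < n)%N).
Local Notation C := R[i].
Local Notation pol2 := {poly {poly R[i]}}.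
Local Notation K := (frac2 R).
Local Notation N := (EN m n u).
Local Notation d := (Ed m n u).
Local Notation e := (Ee a b m n u).
Local Notation vE := (vE a m n delta u).
Local Notation uE := (uE a m n delta u).
Local Notation nF := (nF a m n delta i u).
Local Notation uF := (uF m n i u).
Local Notation R1 := (R1 R a m n delta i u).
Local Notation th := (laurent_var R u).
Local Notation lev := (@line_eval R m n u).

Variables (E F' G : pol2) (alpha : {poly C}) (c0 : C).
Local Notation stE := (straight u E).
Local Notation stF := (straight u (subst2 alpha E + F')).
Local Notation stG := (straight u G).
Hypothesis AE : AssertionE R.
Hypothesis abmn : calQ a b m n.
Hypothesis deltaP : [/\ (0 < delta)%N, (delta %| m %/ a)%N & (delta %| n %/ a)%N].
Hypothesis iI : inI m n i u.
Hypothesis alphaT : inT alpha.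
Hypothesis size_alpha : size alpha = (delta * a).+1.
Hypothesis prinE : principal E.
Hypothesis slope_E : slope_le uE stE.
Hypothesis slope_F' : slope_le uF (straight u F').
Hypothesis size_E : (size stE <= vE.+1)%N.
Hypothesis lead_E : stE`_vE = 'X^(vE - uE).
Hypothesis size_F' : (size (straight u F') <= nF)%N.
Hypothesis vF_ge : -1 <= vF a m n delta i u.
Hypothesis vE_d : (delta * a * vE = d)%N.
Hypothesis vE_N : (delta * a * (vE - uE) = N)%N.
Hypothesis lt_uv : (uE < vE)%N.
Hypothesis nF_d : (nF <= d)%N.
Hypothesis size_F : (size stF <= d.+1)%N.
Hypothesis lead_F : stF`_d = 'X^N.
Hypothesis size_G : (size stG <= e.+1)%N.
Hypothesis lead_G : stG`_e \is monic.
Hypothesis FG : jacobian (subst2 alpha E + F') G = const2 c0.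
Hypothesis le_ude : (u.+2 <= d + e)%N.

Lemma wdeg_le_size (f : pol2) (v : int) (k : nat) : (size (straight u f) <= k)%N ->
  k%:Z <= v + 1 -> wdeg_le u f v.
Proof.
move=> szf kv [] j; last by move=> _; exact: wpart_neg.
move=> vj; apply: (@straight_injective R u).
rewrite straight_wpart nth_default ?mul0r ?rmorph0//.
by rewrite (leq_trans szf)// -lez_nat (le_trans kv)// lezD1.
Qed.

Lemma line_eval_Pzero (p : {poly C}) (z : int) : p`_0 = 0 ->
  Pzero m n u 1 (lev p * th ^ z).
Proof.
move=> p0; have /factor_theorem[q qE] : root p 0.
  by rewrite /root horner_coef0 p0.
have -> : lev p * th ^ z = tau2 R m n u ^+ 1 * (lev q * th ^ (z - d%:Z)).
  rewrite qE subr0 rmorphM/= line_evalX expr1 (tau2E R u m_gt0 n_gt0).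
  have -> : th ^ z = th ^+ d * th ^ (z - d%:Z).
    rewrite -[th ^+ d]/(th ^ d%:Z) -expfzDr ?laurent_var_neq0//.
    by rewrite addrC subrK.
  move: (lev q) (line R m n u) (th ^+ d) (th ^ _) => x y z1 z2; ring.
apply: Pzero_tau2 => //; apply: inR2M; first exact: inR2_line_eval.
exact: inR2_varz.
Qed.

(** With a minimal supported set, Assertion E says that
$P_1(S(\tilde x_j))=0$ as soon as it holds for all larger indices; so it holds for
all of them. By [Pzero_line_eval] each quotient by $s^{j-\mathrm{u}_F}$ is then divisible
by $s$. *)
Lemma remainder_vanishing : slope_le uF.-1 (straight u F').
Proof.
have /choice[fG fGE] := slope_E.
have /choice[fx fxE] := slope_F'.
pose pG (j : 'I_vE) := fG j; pose px (j : 'I_nF) := fx j.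
have pGE (j : 'I_vE) : stE`_j = pG j * 'X^(j - uE) by exact: fGE.
have pxE (j : 'I_nF) : (straight u F')`_j = px j * 'X^(j - uF) by exact: fxE.
have [amon asz a2] := alphaT.
have kE : (size alpha).-1 = (delta * a)%N by rewrite size_alpha.
have vE_d' : ((size alpha).-1 * vE = d)%N by rewrite kE.
have vE_N' : ((size alpha).-1 * (vE - uE) = N)%N by rewrite kE.
have [c [B0 [admB0 supB0]]] := supported_exists m_gt0 n_gt0 pGE pxE size_E lead_E
  size_F' vE_d' vE_N' lt_uv amon nF_d size_F lead_F size_G lead_G FG le_ude.
pose S := [the {rmorphism {poly R1} -> K} of realize pG px c].
have [B [BB0 supB] minB] := minimal_fset supB0.
have admB : admissibleB a b m n u B by move=> beta /(fsubsetP BB0)/admB0.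
have SS : inS S.
  by split; [exact: inR2_realize|exact: realize_tau].
have comp : compatible b S E F' alpha.
  split=> //.
  - move=> beta /andP[b1 _]; exists (c beta.-1.+1).
    transitivity (gval pG px c (inr beta.-1)); first exact: realize_var.
    by rewrite /gval /gpoly /gexp line_evalC expr0z mulr1.
  - split; first exact: (realize_tF m_gt0 n_gt0 pG c pxE size_F').
      apply: (wdeg_le_size size_F').
      have v0 : 0 <= vF a m n delta i u + 1 by rewrite -lerBlDr sub0r.
      by rewrite /nF; case: (vF a m n delta i u + 1) v0.
    move=> j; rewrite pospart_subn; exact: (realize_partx m_gt0 n_gt0 pG c pxE).
  - split; first exact: (realize_tE m_gt0 n_gt0 px c pGE size_E lead_E size_F' vE_d' vE_N' lt_uv).
      apply: (wdeg_le_size size_E).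
      by rewrite -addn1 PoszD.
    move=> j; rewrite pospart_subn; exact: (realize_partG m_gt0 n_gt0 px c pGE).
have Svarx (j : 'I_nF) :
    S (varx R j)%:P = lev (px j) * th ^ ((N * j)%:Z - (d * (j - uF))%:Z).
  exact: (realize_var pG px c (inl (inr j))).
(* descending induction on j *)
have key t (j : 'I_nF) : (nF <= j + t)%N -> (uF <= j)%N -> (px j)`_0 = 0.
  elim: t j => [|t IH] j.
    by rewrite addn0 leqNgt ltn_ord.
  rewrite addnS => lej uj.
  have zer (j' : 'I_nF) : (j < j')%N -> Pzero m n u 1 (S (varx R j')%:P).
    move=> jj'; rewrite Svarx; apply: line_eval_Pzero; apply: IH.
      by rewrite (leq_trans lej)// -addSn leq_add2r.
    by rewrite (leq_trans uj)// ltnW.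
  case: (AE abmn deltaP iI SS alphaT comp admB uj supB zer prinE) => [|[B' [B'B supB']]].
    by rewrite Svarx; exact: Pzero_line_eval.
  by case: (minB _ B'B).
move=> j; have [lej|ltj] := leqP nF j.
  by exists 0; rewrite mul0r nth_default// (leq_trans size_F').
have [ltu|leu] := ltnP j uF.
  exists (straight u F')`_j; have /eqP -> : (j - uF.-1 == 0)%N.
    by rewrite subn_eq0 -ltnS (leq_trans ltu)// leqSpred.
  by rewrite mulr1.
have /factor_theorem[q qE] : root (px (Ordinal ltj)) 0.
  by rewrite /root horner_coef0 (key nF)// leq_addl.
have := pxE (Ordinal ltj); rewrite /= qE subr0 -mulrA -exprS => ->.
case: (uF) leu => [|v] leu; last by exists q; rewrite subnSK.
by exists (q * 'X); rewrite subn0 -mulrA -exprS.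
Qed.

End RemainderVanishing.

(** * Newton polygons and their corners *)

Section NewtonPolygon.
Local Open Scope classical_set_scope.
Local Open Scope convex_scope.
Variable R : realType.
Local Notation pol2 := {poly {poly R[i]}}.
Local Notation plane := (R^o * R^o)%type.
Implicit Types (f g : pol2) (z : plane).

Lemma convex_N0 f : @convex_set R plane (N0 f).
Proof.
rewrite /N0; case: ifP => _ x y l; first by rewrite inE.
rewrite !inE => xf yf A [Aconv fA].
have := Aconv x y l; rewrite !inE; apply; [exact: xf|exact: yf].
Qed.

Lemma N0_min f (A : set plane) : @convex_set R plane A -> supp f `<=` A ->
  A (0, 0) -> N0 f `<=` A.
Proof.
move=> Aconv fA A0; rewrite /N0; case: ifP => _; first by move=> z [].
apply: smallest_sub; first exact: Aconv.
by move=> z [|->]; [exact: fA|exact: A0].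
Qed.

Lemma supp_N0 f : supp f `<=` N0 f.
Proof.
rewrite /N0; case: eqP => [-> z [p [q []]]|_ z fz].
  by rewrite !coef0 eqxx.
by apply: sub_gen_smallest; left.
Qed.

Lemma origin_N0 f : f != 0 -> N0 f (0, 0).
Proof. by rewrite /N0 => /negPf ->; apply: sub_gen_smallest; right. Qed.

Lemma N0_sub f g : g != 0 -> supp f `<=` N0 g -> N0 f `<=` N0 g.
Proof.
move=> g0 fg; apply: N0_min => //; first exact: convex_N0.
exact: origin_N0.
Qed.

Lemma conv_segment (A : set plane) (x y z : plane) (t : R) :
  @convex_set R plane A -> A x -> A y -> 0 <= t <= 1 ->
  z = (t * x.1 + (1 - t) * y.1, t * x.2 + (1 - t) * y.2) -> A z.
Proof.
move=> Aconv Ax Ay /andP[t0 t1] ->.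
have := Aconv x y (Itv01 t0 t1); rewrite !inE; apply; [exact: Ax|exact: Ay].
Qed.

(** Open half-planes are convex. The functional $x+2y$ has a unique
maximum on $T_{p,q}$, at the corner $(p,q)$, which makes that corner
extreme. *)
Lemma N0_far_point f z : N0 f z -> 0 < z.1 + 2 * z.2 ->
  exists i j : nat, f`_j`_i != 0 /\ z.1 + 2 * z.2 <= (i + 2 * j)%:R.
Proof.
move=> fz z0; apply: contrapT => nof.
have nf i j : f`_j`_i != 0 -> (i + 2 * j)%:R < z.1 + 2 * z.2.
  by move=> f0; rewrite ltNge; apply/negP => le; apply: nof; exists i, j.
pose A := [set p : plane | p.1 + 2 * p.2 < z.1 + 2 * z.2].
suff /(_ z fz) : N0 f `<=` A by rewrite /A/= ltxx.
apply: N0_min; last by rewrite /A/= mulr0 addr0.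
  move=> x y t; rewrite !inE /A/= => Ax Ay.
  have t0 : 0 <= t%:inum by [].
  have t1 : t%:inum <= 1 by [].
  have xyE : z.1 + 2 * z.2 - ((x <| t |> y).1 + 2 * (x <| t |> y).2) =
      t%:inum * (z.1 + 2 * z.2 - (x.1 + 2 * x.2)) +
      (1 - t%:inum) * (z.1 + 2 * z.2 - (y.1 + 2 * y.2)).
    change (z.1 + 2 * z.2 - ((t%:inum * x.1 + (1 - t%:inum) * y.1) +
      2 * (t%:inum * x.2 + (1 - t%:inum) * y.2)) =
      t%:inum * (z.1 + 2 * z.2 - (x.1 + 2 * x.2)) +
      (1 - t%:inum) * (z.1 + 2 * z.2 - (y.1 + 2 * y.2))); ring.
  rewrite -subr_gt0 xyE; have [->|tn0] := eqVneq (t%:inum : R) 0.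
    by rewrite mul0r add0r subr0 mul1r subr_gt0.
  rewrite ltr_pwDl ?mulr_gt0 ?mulr_ge0 ?subr_gt0 ?subr_ge0//; last exact: ltW.
  by rewrite lt_neqAle eq_sym tn0.
by move=> p [i [j [f0 ->]]]; rewrite /A/= -natrM -natrD; exact: nf.
Qed.

(** The support lies in $T_{p,q}$ (see [supp_trapezoid]). *)
Definition inside (p q : nat) f : Prop :=
  forall i j : nat, f`_j`_i != 0 -> (j <= q)%N /\ (i + j <= p + q)%N.

Lemma supp_trapezoid (p q : nat) f : supp f `<=` trapezoid p q <-> inside p q f.
Proof.
split=> [fT i j f0|fT z [i [j [f0 ->]]]].
  have [] : @trapezoid R p q (i%:R, j%:R) by apply: fT; exists i, j.
  move=> /= /andP[_ jq] /andP[_ ipq]; move: jq ipq.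
  rewrite lerBrDr -natrD -PoszD -!pmulrn !ler_nat; lia.
have [jq ipq] := fT i j f0; split; rewrite /= ?ler0n/=.
  by rewrite -pmulrn ler_nat.
by rewrite lerBrDr -natrD -PoszD -pmulrn ler_nat.
Qed.

Lemma inside_N0 (p q : nat) f : N0 f = trapezoid p q -> inside p q f.
Proof. by move=> fT; apply/supp_trapezoid; rewrite -fT; exact: supp_N0. Qed.

Lemma corner_coef (p q : nat) f : (0 < p)%N -> N0 f = trapezoid p q ->
  f`_q`_p != 0.
Proof.
move=> p0 fT; have fI := inside_N0 fT.
have [||i [j [f0]]] := @N0_far_point f (p%:R, q%:R).
- rewrite fT; split=> /=; rewrite ?ler0n/= -pmulrn ?lexx//.
  by rewrite natrD addrK.
- by rewrite -natrM -natrD ltr0n addn_gt0 p0.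
rewrite -natrM -natrD ler_nat => /= ij.
by have [jq ipq] := fI i j f0; have [<- <-] : i = p /\ j = q by lia.
Qed.

(** If the coefficient at the corner were neither 0 nor 1, subtracting
the monomial would not change the support. *)
Lemma corner_coef1 (p q : nat) f : (0 < p)%N -> N0 f = trapezoid p q ->
  N0 (f - monom2 R p q) `<` N0 f -> f`_q`_p = 1.
Proof.
move=> p0 fT [_ notsub]; have fpq := corner_coef p0 fT.
apply: contrapT => fpq1; apply: notsub.
have mE i j : (monom2 R p q)`_j`_i = ((i == p) && (j == q))%:R.
  rewrite /monom2 coefCM coefXn.
  by case: eqP => _; rewrite ?mulr1 ?mulr0 ?coefXn ?coef0 ?andbT ?andbF.
have sub i j : f`_j`_i != 0 -> (f - monom2 R p q)`_j`_i != 0.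
  rewrite !coefB mE; case: andP => [[/eqP -> /eqP ->] _|_]; last by rewrite subr0.
  by rewrite subr_eq0; apply/eqP.
apply: N0_sub; last by move=> z [i [j [/sub f0 ->]]]; apply: supp_N0; exists i, j.
by apply: contraNneq (sub p q fpq) => ->; rewrite !coef0.
Qed.

End NewtonPolygon.

(** * Slices along a weight *)

Section Rows.
Variables (R : realType) (u : bool).
Local Notation C := R[i].
Local Notation pol2 := {poly {poly R[i]}}.
Implicit Types (f g : pol2).

(** The component of weight $j$ as a polynomial in $x$ for $u=0$, and in $y$
with $x=1$ for $u=1$; the straightened component is this one at $s-1$. *)
Definition slice f (j : nat) : {poly C} :=
  if u then \poly_(q < j.+1) f`_q`_(j - q) else f`_j.

Lemma sum_ord_eq (V : nmodType) (k l : nat) (F : nat -> V) :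
  (forall j, (k <= j)%N -> F j = 0) -> (forall j, (l <= j)%N -> F j = 0) ->
  \sum_(j < k) F j = \sum_(j < l) F j.
Proof.
move=> Fk Fl; rewrite (big_ord_widen (k + l) F) ?leq_addr//.
rewrite [RHS](big_ord_widen (k + l) F) ?leq_addl// big_mkcond [RHS]big_mkcond/=.
apply: eq_bigr => j _; case: ltnP => kj; case: ltnP => lj //; first exact: Fl.
by rewrite Fk.
Qed.

Lemma straight_slice f j : (straight u f)`_j = slice f j \Po ('X - 1).
Proof.
rewrite coef_straight /slice; case: u; last first.
  have [ltj|lej] := ltnP j (size f); last first.
    rewrite [f`_j]nth_default// comp_poly0 big1// => q _; rewrite big1// => p /eqP qj.
    by have := ltn_ord q; rewrite ltnNge -qj mul0n add0n in lej *; rewrite lej.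
  rewrite (bigD1 (Ordinal ltj))//= [X in _ + X]big1 ?addr0; last first.
    move=> q /eqP qj; rewrite big1// => p /eqP pq; case: qj; apply: val_inj => /=.
    by rewrite -pq mul0n add0n.
  by rewrite comp_polyE; apply: eq_bigl => p; rewrite mul0n add0n eqxx.
pose G q := if (q <= j)%N then f`_q`_(j - q) *: ('X - 1 : {poly C}) ^+ q else 0.
transitivity (\sum_(q < size f) G q).
  apply: eq_bigr => q _; rewrite /G; case: leqP => [leqj|ltjq]; last first.
    rewrite big1// => p /eqP pq; move: ltjq; rewrite -pq mul1n.
    by rewrite ltnNge leq_addl.
  have [ltj|lej] := ltnP (j - q) (size f`_q).
    rewrite (big_pred1 (Ordinal ltj))// => p.
    rewrite mul1n; apply/eqP/eqP => [pq|->]; last by rewrite /= subnK.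
    by apply: val_inj; rewrite /= -pq addnK.
  rewrite [f`_q`_(j - q)]nth_default// scale0r big1// => p /eqP pq.
  move: (ltn_ord p); rewrite ltnNge; have <- : (j - q)%N = p by rewrite -pq mul1n addnK.
  by rewrite lej.
rewrite (@sum_ord_eq _ _ j.+1 G); last 2 first.
- by move=> q leq; rewrite /G [f`_q]nth_default// coef0 scale0r if_same.
- by move=> q; rewrite /G ltnNge => /negPf ->.
rewrite poly_def rmorph_sum; apply: eq_bigr => q _.
rewrite /G -ltnS ltn_ord; move: (f`_q`_(j - q)) => c.
by rewrite -!mul_polyC rmorphM rmorphXn/= comp_polyX comp_polyC.
Qed.

Lemma size_XB1 : size ('X - 1 : {poly C}) = 2.
Proof. exact: (size_XsubC (1 : C)). Qed.

Lemma size_straight_slice f j : size (straight u f)`_j = size (slice f j).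
Proof. by rewrite straight_slice size_comp_poly2// size_XB1. Qed.

Lemma straight_at1 f j : ((straight u f)`_j).[1] = (slice f j)`_0.
Proof.
rewrite straight_slice horner_comp -horner_coef0; congr (_.[_]).
by rewrite !hornerE subrr.
Qed.

Lemma coef_straight_slice f j k : (size (slice f j) <= k.+1)%N ->
  ((straight u f)`_j)`_k = (slice f j)`_k.
Proof.
rewrite leq_eqVlt ltnS => /orP[/eqP szk|lek]; last first.
  by rewrite [LHS]nth_default ?[RHS]nth_default// size_straight_slice.
have := lead_coef_comp (slice f j) (q := 'X - 1).
rewrite size_XB1 -straight_slice => /(_ isT).
rewrite [lead_coef ('X - 1)](_ : _ = 1) ?expr1n ?mulr1; last exact: lead_coefXsubC.
by rewrite !lead_coefE size_straight_slice szk.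
Qed.

Lemma slice_inside p q f : inside p q f ->
  (size (slice f (u * p + q)) <= (if u then q else p).+1)%N /\
  (slice f (u * p + q))`_(if u then q else p) = f`_q`_p.
Proof.
move=> fI; rewrite /slice; case: u.
  rewrite mul1n coef_poly ltnS leq_addl addnK; split=> //.
  apply/leq_sizeP => j ltqj; rewrite coef_poly; case: ifP => // _.
  by apply: contraTeq ltqj => /fI[]; rewrite -leqNgt.
rewrite mul0n add0n; split=> //; apply/leq_sizeP => j ltpj.
by apply: contraTeq ltpj => /fI[_]; rewrite leq_add2r -leqNgt.
Qed.

Lemma size_straight_bound k f :
  (forall i j : nat, f`_j`_i != 0 -> (u * i + j <= k)%N) ->
  (size (straight u f) <= k.+1)%N.
Proof.
move=> fk; apply/leq_sizeP => j ltkj; rewrite straight_slice.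
suff -> : slice f j = 0 by rewrite comp_poly0.
apply/polyP => l; rewrite coef0 /slice; case: u fk => fk.
  rewrite coef_poly; case: ifP => // lej.
  apply: contraTeq ltkj => /fk; rewrite -leqNgt mul1n subnK// -ltnS.
apply: contraTeq ltkj => /fk; rewrite -leqNgt; exact.
Qed.

Lemma size_straight_inside p q f : inside p q f ->
  (size (straight u f) <= (u * p + q).+1)%N.
Proof. by move=> fI; apply: size_straight_bound => i j /fI; case: u; lia. Qed.

Lemma straight_top p q f : inside p q f -> f`_q`_p = 1 ->
  (straight u f)`_(u * p + q) \is monic /\
  size (straight u f)`_(u * p + q) = (if u then q else p).+1.
Proof.
move=> fI fpq; have [sz cf] := slice_inside fI.
have c1 := coef_straight_slice sz; rewrite cf fpq in c1.
have szE : size (straight u f)`_(u * p + q) = (if u then q else p).+1.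
  apply/eqP; rewrite eqn_leq size_straight_slice sz -size_straight_slice /=.
  by rewrite ltnNge; apply/negP => /leq_sizeP/(_ _ (leqnn _)); rewrite c1 => /eqP; rewrite oner_eq0.
by rewrite monicE lead_coefE szE c1.
Qed.

Lemma straight_top_slope p q c f : inside p q f ->
  slope_le c (straight u f) -> (u * p + q - c = if u then q else p)%N ->
  (straight u f)`_(u * p + q) = f`_q`_p *: 'X^(if u then q else p).
Proof.
move=> fI fs cE; have [sz cf] := slice_inside fI.
have := coef_straight_slice sz; rewrite cf; have [h hE] := fs (u * p + q)%N.
rewrite -size_straight_slice in sz; rewrite cE in hE.
move: sz hE; move: (straight u f)`_(u * p + q) => g sz hE gc.
apply/polyP => i; rewrite coefZ coefXn; have [->|ni] := eqVneq i; first by rewrite mulr1.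
rewrite mulr0; have [lti|] := ltnP i (if u then q else p); first by rewrite hE coefMXn lti.
rewrite leq_eqVlt eq_sym (negPf ni)/= => lti.
by rewrite nth_default// (leq_trans sz).
Qed.

End Rows.

(** * Trapezoids under products, dilations and hulls *)

Section Corners.
Local Open Scope classical_set_scope.
Variables (R : realType).
Local Notation pol2 := {poly {poly R[i]}}.
Local Notation plane := (R^o * R^o)%type.
Implicit Types (f g : pol2).

Lemma coefM2 f g j i : (f * g)`_j`_i =
  \sum_(j1 < j.+1) \sum_(i1 < i.+1) f`_j1`_i1 * g`_(j - j1)`_(i - i1).
Proof. by rewrite coefM coef_sum; apply: eq_bigr => j1 _; rewrite coefM. Qed.

Lemma inside_mul p q p' q' f g : inside p q f -> inside p' q' g ->
  inside (p + p') (q + q') (f * g) /\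
  (f * g)`_(q + q')`_(p + p') = f`_q`_p * g`_q'`_p'.
Proof.
move=> fI gI; split=> [i j|].
  move=> /eqP nz; apply: contrapT => out; apply: nz.
  rewrite coefM2 big1// => j1 _; rewrite big1// => i1 _.
  have [f0|f0] := eqVneq f`_j1`_i1 0; first by rewrite f0 mul0r.
  have [g0|g0] := eqVneq g`_(j - j1)`_(i - i1) 0; first by rewrite g0 mulr0.
  case: out; have [] := fI _ _ f0; have [] := gI _ _ g0.
  have := ltn_ord j1; have := ltn_ord i1; lia.
have ltq : (q < (q + q').+1)%N by rewrite ltnS leq_addr.
have ltp : (p < (p + p').+1)%N by rewrite ltnS leq_addr.
have other (j1 : 'I_(q + q').+1) (i1 : 'I_(p + p').+1) : (j1 != q :> nat) || (i1 != p :> nat) ->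
    f`_j1`_i1 * g`_(q + q' - j1)`_(p + p' - i1) = 0.
  have [f0|f0] := eqVneq f`_j1`_i1 0; first by rewrite f0 mul0r.
  have [g0|g0] := eqVneq g`_(q + q' - j1)`_(p + p' - i1) 0; first by rewrite g0 mulr0.
  have [] := fI _ _ f0; have [] := gI _ _ g0.
  have := ltn_ord j1; have := ltn_ord i1; lia.
rewrite coefM2 (bigD1 (Ordinal ltq))//= [X in _ + X]big1 ?addr0; last first.
  by move=> j1 j1q; rewrite big1// => i1 _; apply: other; rewrite -val_eqE/= in j1q; rewrite j1q.
rewrite (bigD1 (Ordinal ltp))//= [X in _ + X]big1 ?addr0; last first.
  move=> i1 i1p; rewrite -val_eqE/= in i1p.
  by apply: (other (Ordinal ltq)); rewrite i1p orbT.
by rewrite !addKn.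
Qed.

Lemma inside_exp p q f k : inside p q f -> f`_q`_p = 1 ->
  inside (k * p) (k * q) (f ^+ k) /\ (f ^+ k)`_(k * q)`_(k * p) = 1.
Proof.
move=> fI f1; elim: k => [|k [IH1 IH2]].
  rewrite expr0 !mul0n !coef1; split=> // i j.
  by rewrite coef1; case: j => [|j]; rewrite ?coef0 ?eqxx// coef1; case: i => [|i]; rewrite ?eqxx.
rewrite exprS !mulSn; have [fI' ->] := inside_mul fI IH1.
by rewrite f1 IH2 mulr1.
Qed.

(** The corner $(m,n)/k$ of the dilated trapezoid is extreme, hence a
point of the support, so its coordinates are integers. *)
Lemma inside_dilate (k m n : nat) (f : pol2) : (0 < k)%N -> (0 < m)%N ->
  N0 f = dilate k%:R^-1 (@trapezoid R m n) ->
  exists p q, [/\ m = (k * p)%N, n = (k * q)%N & inside p q f].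
Proof.
move=> k0 m0 fT; have k0' : (k%:R : R) != 0 by rewrite pnatr_eq0 -lt0n.
have fI i j : f`_j`_i != 0 -> (k * j <= n)%N /\ (k * (i + j) <= m + n)%N.
  move=> f0; have : dilate k%:R^-1 (@trapezoid R m n) (i%:R, j%:R).
    by rewrite -fT; apply: supp_N0; exists i, j.
  case=> -[x y] [/= /andP[_ yn] /andP[_ xyn]] [xE yE].
  have {xE}xE : x = (k * i)%:R by rewrite natrM -xE mulrA divff// mul1r.
  have {yE}yE : y = (k * j)%:R by rewrite natrM -yE mulrA divff// mul1r.
  move: yn xyn; rewrite xE yE lerBrDr -natrD -PoszD -!pmulrn !ler_nat; lia.
have [||i [j [f0]]] := @N0_far_point _ f (k%:R^-1 * m%:R, k%:R^-1 * n%:R).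
- rewrite fT; exists (m%:R, n%:R) => //; split=> /=; rewrite ?ler0n/= -pmulrn ?lexx//.
  by rewrite natrD addrK.
- by rewrite /= ltr_wpDr ?mulr_ge0 ?invr_ge0// mulr_gt0 ?invr_gt0 ?ltr0n.
have E (x y z : R) : z * x + 2 * (z * y) = (x + 2 * y) * z by ring.
rewrite /= (E m%:R n%:R) ler_pdivrMr ?ltr0n// -[2 * _]natrM -natrD -natrM.
rewrite ler_nat => ij.
have [jn ijn] := fI i j f0.
have [mE nE] : (m = k * i /\ n = k * j)%N by nia.
exists i, j; split=> // i' j' /fI; rewrite mE nE -mulnDr !leq_pmul2l//.
Qed.

(** Each point lies on a horizontal segment between the vertical side
and the slanted one. *)
Lemma trapezoid_hull (p q : nat) (A : set plane) : @convex_set R plane A ->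
  (0 < q)%N -> A (0, 0) -> A ((p + q)%:R, 0) -> A (p%:R, q%:R) -> A (0, q%:R) ->
  @trapezoid R p q `<=` A.
Proof.
move=> Aconv q0 A00 A10 A11 A01 [x y] [/= /andP[y0 yq] /andP[x0 xy]].
rewrite -pmulrn in yq; rewrite -PoszD -pmulrn in xy.
have q0' : 0 < q%:R :> R by rewrite ltr0n.
(* the horizontal line at height y *)
pose t := 1 - y / q%:R.
have t01 : 0 <= t <= 1.
  by rewrite subr_ge0 ler_pdivrMr// mul1r yq lerBlDr lerDl divr_ge0// ltW.
have qE : (1 - t) * q%:R = y by rewrite /t opprB addrC subrK divfK// gt_eqF.
have AL : A (0, y).
  by apply: (conv_segment Aconv A00 A01 t01); rewrite /= !mulr0 !add0r qE.
have AR : A ((p + q)%:R - y, y).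
  apply: (conv_segment Aconv A10 A11 t01); rewrite /= mulr0 add0r qE; congr pair.
  rewrite -[in LHS]qE natrD; ring.
have [w0|w0] := eqVneq ((p + q)%:R - y) 0.
  by have -> : x = 0 by apply/eqP; rewrite eq_le x0 andbT -w0.
have w1 : 0 < (p + q)%:R - y by rewrite lt_neqAle eq_sym w0 (le_trans x0).
pose s := x / ((p + q)%:R - y).
apply: (conv_segment (t := s) Aconv AR AL).
  by rewrite /s divr_ge0 ?(ltW w1)// ler_pdivrMr// mul1r.
rewrite /= mulr0 addr0 /s divfK//; congr pair; ring.
Qed.

End Corners.

(** * The decomposition of F *)

Section Decomposition.
Local Open Scope classical_set_scope.
Variables (R : realType).
Local Notation C := R[i].
Local Notation pol2 := {poly {poly R[i]}}.
Implicit Types (f g : pol2).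

Lemma mem_calN2 (a p q i j : nat) : (0 < a)%N ->
  ((a - 1) * p <= i)%N -> ((a - 1) * q <= j)%N -> (j <= a * q)%N ->
  (i + j <= a * p + a * q)%N -> @calN2 R a (a * p) (a * q) (i%:R, j%:R).
Proof.
move=> a0 pi qj jq ijpq.
have A0 : 0 < a%:R :> R by rewrite ltr0n.
have aE : (a - 1)%N%:R = a%:R - 1 :> R by rewrite natrB.
exists (i%:R - (a%:R - 1) * p%:R, j%:R - (a%:R - 1) * q%:R); last first.
  rewrite !natrM aE.
  change ((i%:R - (a%:R - 1) * p%:R + (a%:R - 1) / a%:R * (a%:R * p%:R),
           j%:R - (a%:R - 1) * q%:R + (a%:R - 1) / a%:R * (a%:R * q%:R)) =
          (i%:R, j%:R) :> R * R).
  by congr pair; field; rewrite gt_eqF.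
exists (a%:R * (i%:R - (a%:R - 1) * p%:R), a%:R * (j%:R - (a%:R - 1) * q%:R)); last first.
  change ((a%:R^-1 * (a%:R * (i%:R - (a%:R - 1) * p%:R)), a%:R^-1 * (a%:R * (j%:R - (a%:R - 1) * q%:R))) =
   (i%:R - (a%:R - 1) * p%:R, j%:R - (a%:R - 1) * q%:R) :> R * R).
  by rewrite !mulKf// gt_eqF.
rewrite /trapezoid/= -PoszD -!pmulrn.
move: pi qj jq ijpq; rewrite -!(ler_nat R) !natrD !natrM aE.
move: (a%:R : R) (p%:R : R) (q%:R : R) (i%:R : R) (j%:R : R) A0.
clear => a p q i j A0 pi qj jq ijpq; split; apply/andP; split; nra.
Qed.

Lemma notin_calN2 (a p q i j : nat) : (0 < a)%N -> (j < (a - 1) * q)%N ->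
  ~ @calN2 R a (a * p) (a * q) (i%:R, j%:R).
Proof.
move=> a0 jq; have A0 : 0 < a%:R :> R by rewrite ltr0n.
have aE : (a - 1)%N%:R = a%:R - 1 :> R by rewrite natrB.
case=> z [[x y] [/= /andP[y0 _] _]] zE.
rewrite -zE => -[_]; rewrite natrM.
change (a%:R^-1 * y + (a - 1)%N%:R / a%:R * (a%:R * q%:R) = j%:R -> False) => jE.
move: jq; rewrite -(ltr_nat R) -jE natrM ltNge => /negP; apply.
have -> : (a - 1)%N%:R / a%:R * (a%:R * q%:R) = (a - 1)%N%:R * q%:R :> R.
  by field; rewrite gt_eqF.
by rewrite lerDr mulr_ge0// invr_ge0 ltW.
Qed.

(** For a polynomial with support in $T_{ap,aq}$: the support avoids
$\mathcal N''$. *)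
Definition below (a p q : nat) f : Prop :=
  forall i j : nat, f`_j`_i != 0 -> ((a - 1) * q <= j)%N -> (i < (a - 1) * p)%N.

Lemma below_supp (a p q : nat) f : (0 < a)%N ->
  supp f `<=` @trapezoid R (a * p)%N (a * q)%N `\` @calN2 R a (a * p) (a * q) ->
  inside (a * p) (a * q) f /\ below a p q f.
Proof.
move=> a0 fT; have fI : inside (a * p) (a * q) f.
  by apply/supp_trapezoid => z /fT[].
split=> // i j f0 qj; rewrite ltnNge; apply/negP => pi.
have [_] : (@trapezoid R (a * p)%N (a * q)%N `\` @calN2 R a (a * p) (a * q)) (i%:R, j%:R).
  by apply: fT; exists i, j.
by have [] := fI i j f0; move=> jq ijq; apply; exact: mem_calN2.
Qed.

(** The data from which $F^\circ$ is built, in the form in which they are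
used; [p] and [q] are $m/(\delta a)$ and $n/(\delta a)$, and [dec_min] is the
minimality of $V^\circ$. *)
Record decomposition (a m n delta p q : nat) (F Fc E : pol2) (alpha : {poly C}) : Prop := {
  dec_m : m = (delta * a * p)%N;
  dec_n : n = (delta * a * q)%N;
  dec_delta : (0 < delta)%N;
  dec_principal : principal E;
  dec_inside : inside p q E;
  dec_corner : E`_q`_p = 1;
  dec_T : inT alpha;
  dec_F : F = subst2 alpha E + Fc;
  dec_inside_Fc : inside m n Fc;
  dec_below : below a (delta * p) (delta * q) Fc;
  dec_min : forall beta : {poly C}, inT beta ->
    supp (F - subst2 beta E) `<=` N0 F `\` calN2 a m n ->
    N0 (F - subst2 beta E) `<=` N0 Fc -> N0 (F - subst2 beta E) = N0 Fc }.

Lemma isFcirc_decomposition (a b m n : nat) (F Fc : pol2) :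
  calQ a b m n -> condF m n F -> isFcirc a m n F Fc ->
  exists delta p q E alpha, decomposition a m n delta p q F Fc E alpha.
Proof.
case=> -[a0 b0 m0 n0] [mn am an _ _] [[FT _] _ _].
case=> Q [delta [E [V [alpha [[_ [delta0 EdeltaP] [Eprin EQ Ecoef]] [_ Vmin [alphaT alphaS] VE FcE]]]]]].
have k0 : (0 < delta * a)%N by rewrite muln_gt0 delta0.
have [p [q [mE nE EI]]] := inside_dilate k0 m0 (EdeltaP E Eprin EQ).
exists delta, p, q, E, alpha.
have mE' : m = (a * (delta * p))%N by rewrite mE; ring.
have nE' : n = (a * (delta * q))%N by rewrite nE; ring.
have [FcI Fcb] : inside m n Fc /\ below a (delta * p) (delta * q) Fc.
  rewrite {1}mE' nE'; apply: below_supp => //; rewrite -mE' -nE' -FT FcE; exact: alphaS.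
split=> //.
- by move: Ecoef; rewrite mulnC {1}mE {1}nE ?mulKn.
- by rewrite FcE addrC subrK.
move=> beta betaT betaS; rewrite FcE -VE => sub; apply: Vmin => //.
by exists beta.
Qed.

End Decomposition.

(** * Minimality of the Newton polygon *)

Section MinimalCorner.
Local Open Scope classical_set_scope.
Variables (R : realType).
Local Notation C := R[i].
Local Notation pol2 := {poly {poly R[i]}}.
Implicit Types (f g : pol2).

(** The slopes determine the top components up to a constant:
they are multiples of $(x+1)^py^q$ and of $x^p(x+y)^q$. So the corner $(p,q)$ belongs to the
support together with $(0,q)$ and $(p+q,0)$. *)
Lemma slopes_hull p q f : (0 < q)%N -> (p <= q)%N -> inside p q f -> f`_q`_p != 0 ->
  slope_le (q - p) (straight false f) -> slope_le p (straight true f) ->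
  @trapezoid R p q `<=` N0 f.
Proof.
move=> q0 pq fI f0 s0 s1.
have fN0 i j : f`_j`_i != 0 -> N0 f (i%:R, j%:R).
  by move=> fij; apply: supp_N0; exists i, j.
apply: trapezoid_hull => //.
- exact: convex_N0.
- by apply: origin_N0; apply: contraNneq f0 => ->; rewrite !coef0.
- have := straight_top_slope fI s1; rewrite mul1n addKn => /(_ erefl) E.
  apply: (fN0 (p + q)%N 0%N); have := straight_at1 true f (p + q).
  rewrite E /slice coef_poly /= subn0 hornerZ hornerXn expr1n mulr1 => <-; exact: f0.
- exact: fN0.
have := straight_top_slope fI s0; rewrite mul0n add0n subKn// => /(_ erefl) E.
apply: (fN0 0%N q); have := straight_at1 false f q.
by rewrite E /slice /= hornerZ hornerXn expr1n mulr1 => <-.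
Qed.

Lemma subst2_add (alpha : {poly C}) (c : C) k E :
  subst2 (alpha + c%:P * 'X^k) E = subst2 alpha E + const2 c * E ^+ k.
Proof.
rewrite /subst2.
transitivity ((map_poly (polyC \o polyC) (alpha + c%:P * 'X^k) : {poly pol2}).[E]); first by [].
rewrite rmorphD rmorphM/= map_polyC map_polyXn hornerD hornerM hornerC hornerXn.
by [].
Qed.

Lemma inT_add (alpha : {poly C}) (c : C) k : inT alpha -> (k.+2 < size alpha)%N ->
  inT (alpha + c%:P * 'X^k).
Proof.
case=> amon asz a2 ltk.
have szc : (size (c%:P * 'X^k)%R < size alpha)%N.
  rewrite mul_polyC (leq_ltn_trans (size_scale_leq _ _))// size_polyXn.
  by apply: leq_trans ltk; rewrite ltnS.
have szE : size (alpha + c%:P * 'X^k) = size alpha by rewrite size_polyDl.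
split.
- by rewrite monicE lead_coefDl// -monicE.
- by rewrite szE.
rewrite szE coefD a2 add0r coefCM coefXn; case: eqP => [kE|_]; last by rewrite mulr0.
by move: ltk; rewrite -kE; case: (size alpha) asz => [|[|s]] //=; rewrite ltnn.
Qed.

(** If the coefficient $c$ at the corner is not zero, then
$N^0(F^\circ)$ contains all of $T_{kp,kq}=N^0(E^k)$ ([slopes_hull]), so passing
from $\alpha$ to $\alpha+cz^k$ replaces $N^0(F^\circ)$ by a part of it that misses
the corner. For $k=\delta(a-1)$ the polynomial $\alpha+cz^k$ need not be
admissible, but then the corner is in $\mathcal N''$. *)
Lemma minimal_corner (a m n delta p q k : nat) (F Fc E : pol2) (alpha : {poly C}) :
  decomposition a m n delta p q F Fc E alpha -> size alpha = (delta * a).+1 ->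
  (0 < a)%N -> (0 < p <= q)%N -> N0 F = trapezoid m n ->
  (k <= delta * (a - 1))%N -> inside (k * p) (k * q) Fc ->
  slope_le (k * q - k * p) (straight false Fc) -> slope_le (k * p) (straight true Fc) ->
  Fc`_(k * q)`_(k * p) = 0.
Proof.
case=> mE nE delta0 Eprin EI E1 alphaT FE FcI Fcb Fcmin sz a0 /andP[p0 pq] FT.
rewrite leq_eqVlt => /orP[/eqP kE _ _ _|ltk FcI' s0 s1].
  apply/eqP/negP => /negP /Fcb.
  by rewrite kE !mulnA [((a - 1) * delta)%N]mulnC leqnn ltnn => /(_ isT).
apply/eqP/negP => /negP c0; set c := (Fc`_(k * q)`_(k * p))%R in c0.
pose beta := alpha + c%:P * 'X^k.
have k2 : (k.+2 < size alpha)%N.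
  by rewrite sz ltnS; move: ltk; rewrite mulnBr muln1; lia.
have betaT : inT beta by exact: inT_add.
pose g := Fc - const2 c * E ^+ k.
have gE : F - subst2 beta E = g.
  by rewrite FE /beta subst2_add opprD addrA [subst2 alpha E + Fc]addrC addrK.
have [EkI Ek1] := inside_exp k EI E1.
have coefg i j : g`_j`_i = Fc`_j`_i - c * (E ^+ k)`_j`_i.
  by rewrite /g !coefB /const2 !coefCM.
have gI : inside (k * p) (k * q) g.
  move=> i j; rewrite coefg; have [->|/FcI'//] := eqVneq Fc`_j`_i 0.
  have [->|/EkI//] := eqVneq (E ^+ k)`_j`_i 0.
  by rewrite mulr0 subr0 eqxx.
have gc : g`_(k * q)`_(k * p) = 0 by rewrite coefg Ek1 mulr1 subrr.
have Fc0 : Fc != 0 by apply: contraNneq c0 => Fc0; rewrite /c Fc0 !coef0.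
have mE' : m = (a * (delta * p))%N by rewrite mE; ring.
have nE' : n = (a * (delta * q))%N by rewrite nE; ring.
have gS : supp g `<=` N0 F `\` calN2 a m n.
  move=> z [i [j [g0 ->]]]; have [jq ijpq] := gI i j g0; split.
    rewrite FT; suff : inside m n g by move/supp_trapezoid; apply; exists i, j.
    move=> i' j' /gI[]; rewrite mE nE; move: ltk; rewrite mulnBr muln1; nia.
  rewrite mE' nE'; apply: notin_calN2 => //; apply: (leq_ltn_trans jq).
  by rewrite mulnA [((a - 1) * delta)%N]mulnC ltn_mul2r ltk (leq_trans p0 pq).
have NgE : N0 g `<=` N0 Fc -> False.
  move=> gsub; have := Fcmin beta betaT; rewrite gE => /(_ gS gsub) NE.
  have Ncorner : N0 Fc ((k * p)%:R, (k * q)%:R).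
    by apply: supp_N0; exists (k * p)%N, (k * q)%N.
  have [k0|k0] := posnP k.
    suff g0 : g = 0 by move: Ncorner; rewrite -NE /N0 g0 eqxx.
    apply/polyP => j; apply/polyP => i; rewrite !coef0; apply/eqP/negP => /negP g0.
    have [] := gI i j g0; rewrite k0 !mul0n addn0 !leqn0 addn_eq0 => /eqP j0 /andP[/eqP i0 _].
    by move: g0 gc; rewrite i0 j0 k0 !mul0n => /eqP.
  rewrite -NE in Ncorner; have [|i [j [g0]]] := N0_far_point Ncorner.
    by rewrite /= -natrM -natrD ltr0n addn_gt0 muln_gt0 k0 p0.
  rewrite /= -natrM -natrD ler_nat => ij; have [jq ijpq] := gI i j g0.
  have [iE jE] : (i = k * p /\ j = k * q)%N by lia.
  by move: g0; rewrite iE jE gc eqxx.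
apply: NgE; apply: N0_sub => //; have [k0|k0] := posnP k.
  move=> z [i [j [g0 ->]]]; have [] := gI i j g0.
  rewrite k0 !mul0n addn0 !leqn0 addn_eq0 => /eqP -> /andP[/eqP -> _].
  exact: origin_N0.
apply: (@subset_trans _ (@trapezoid R (k * p)%N (k * q)%N)); first exact/supp_trapezoid.
by apply: slopes_hull => //; rewrite ?muln_gt0 ?leq_mul2l ?k0 ?pq ?orbT ?(leq_trans p0).
Qed.

End MinimalCorner.

(** * Comparison of the top rows *)

Section TopCoefficients.
Variables (A : comNzRingType).
Implicit Types (f g : {poly A}).

Lemma size_exp_bound f k q : (size f <= q.+1)%N -> (size (f ^+ k) <= (k * q).+1)%N.
Proof.
move=> sf; apply: (leq_trans (size_poly_exp_leq _ _)).
by rewrite ltnS mulnC leq_mul2l; case: (size f) sf => [|s]/=; rewrite ?orbT// ltnS => ->; rewrite orbT.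
Qed.

Lemma size_mul_bound f g p q : (size f <= p.+1)%N -> (size g <= q.+1)%N ->
  (size (f * g)%R <= (p + q).+1)%N.
Proof.
move=> sf sg; apply: (leq_trans (size_polyMleq _ _)).
by move: sf sg; move: (size f) (size g) => x y; lia.
Qed.

Lemma coefM_top f g p q : (size f <= p.+1)%N -> (size g <= q.+1)%N ->
  (f * g)`_(p + q) = f`_p * g`_q.
Proof.
move=> sf sg; have ltp : (p < (p + q).+1)%N by rewrite ltnS leq_addr.
rewrite coefM (bigD1 (Ordinal ltp))//= addKn [X in _ + X]big1 ?addr0// => j jp.
have [pj|jltp] := ltnP p j; first by rewrite [f`_j]nth_default ?mul0r// (leq_trans sf).
have {}jp : (j < p)%N by rewrite ltn_neqAle jltp andbT; rewrite -val_eqE/= in jp.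
rewrite [g`__]nth_default ?mulr0// (leq_trans sg)//; lia.
Qed.

Lemma coef_exp_top f k q : (size f <= q.+1)%N -> (f ^+ k)`_(k * q) = f`_q ^+ k.
Proof.
move=> sf; elim: k => [|k IH]; first by rewrite !expr0 coef1.
by rewrite !exprS mulSn coefM_top ?IH// size_exp_bound.
Qed.

(** Terms of degree at least 2 in [g] do not reach the
coefficient. *)
Lemma coef_exp_split f g k q j : (size f <= q.+1)%N -> (size g <= (q - j).+1)%N ->
  (0 < j <= q)%N -> ((f + g) ^+ k.+1)`_(k.+1 * q - j) =
  (f ^+ k.+1)`_(k.+1 * q - j) + (f`_q ^+ k * g`_(q - j)) *+ k.+1.
Proof.
move=> sf sg /andP[j0 jq]; rewrite exprDn coef_sum big_ord_recl big_ord_recl.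
rewrite subn0 expr0 mulr1 bin0 mulr1n [X in _ + (_ + X)]big1 ?addr0; last first.
  move=> i _; rewrite coefMn nth_default ?mul0rn//.
  have ltik := ltn_ord i; rewrite /bump/= ?add1n.
  have s1 := size_exp_bound (k.+1 - i.+2) sf; have s2 := size_exp_bound i.+2 sg.
  apply: (leq_trans (size_mul_bound s1 s2)); clear -ltik j0 jq; nia.
congr (_ + _); rewrite coefMn /= /bump /= addn0 expr1 bin1 subn1 /=.
congr (_ *+ _); have -> : (k.+1 * q - j = k * q + (q - j))%N by rewrite mulSn addnC addnBA.
by rewrite coefM_top ?coef_exp_top ?size_exp_bound.
Qed.

End TopCoefficients.

Section RowInduction.
Variables (C : numFieldType).
Local Notation K := {poly C}.

(** Near the top, a polynomial in [f] looks like its leading power,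
because the next term of [alpha] is missing. *)
Lemma coef_subst_top (alpha : {poly C}) (f : {poly K}) k q j : alpha \is monic -> size alpha = k.+3 ->
  alpha`_k.+1 = 0 -> (size f <= q.+1)%N -> (j < 2 * q)%N ->
  (subst alpha f)`_(k.+2 * q - j) = (f ^+ k.+2)`_(k.+2 * q - j).
Proof.
move=> amon asz a0 sf j2; rewrite /subst asz 2!big_ord_recr/= a0.
have -> : alpha`_k.+2 = 1 by move: amon; rewrite monicE lead_coefE asz => /eqP.
rewrite !polyC0 mul0r addr0 !polyC1 mul1r coefD coef_sum big1 ?add0r// => i _.
rewrite coefCM [(f ^+ _)`__]nth_default ?mulr0//; apply: (leq_trans (size_exp_bound i sf)).
have := ltn_ord i; clear -j2; nia.
Qed.

(** Induction from the top row down. The rows of $e$ above the current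
one have the right slope by induction, so modulo $s^{kp-j}$ the row $kq-j$ of $f$
is $k\,s^{(k-1)p}e_{q-j}+f_{0,kq-j}$. The second summand has degree less than
$(k-1)p$ but is divisible by $s^{(k-1)p}$, hence is zero. (Here $k$ is [k.+2].) *)
Lemma rows_slope (alpha : {poly C}) (f f0 e : {poly K}) (k p q : nat) :
  alpha \is monic -> size alpha = k.+3 -> alpha`_k.+1 = 0 ->
  (0 < p <= q)%N -> (size e <= q.+1)%N -> e`_q \is monic -> size e`_q = p.+1 ->
  f = subst alpha e + f0 -> slope_le (k.+2 * (q - p)) f ->
  f`_(k.+2 * q) = 'X^(k.+2 * p) ->
  (forall j, (j <= p)%N -> (size (f0`_(k.+2 * q - j))%R <= k.+1 * p)%N) ->
  slope_le (q - p) e.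
Proof.
move=> amon asz a0 /andP[p0 pq] se emon esz fE fs ftop f0s.
have q0 : (0 < q)%N by exact: leq_trans pq.
have eq : e`_q = 'X^p.
  have := coef_subst_top (j := 0) amon asz a0 se; rewrite subn0 muln_gt0 q0 => /(_ isT) top.
  rewrite coef_exp_top// in top.
  have := f0s 0%N isT; rewrite subn0 => f0s0.
  have := congr1 (fun h : {poly K} => h`_(k.+2 * q)) fE; rewrite /= coefD ftop top => E.
  apply/eqP; rewrite eq_sym -subr_eq0; apply: contraT => ne.
  (* the cofactor of $X^p - e_q$ in the difference of their powers, a sum of
     $k + 2$ monic polynomials of the same degree *)
  pose S : K := \sum_(i < k.+2) ('X^p) ^+ (k.+1 - i) * e`_q ^+ i.
  have Xe : ('X^p - e`_q) * S = f0`_(k.+2 * q).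
    by rewrite /S -subrXX -exprM mulnC E addrC addKr.
  have sX : (size ('X^p : K) <= p.+1)%N by rewrite size_polyXn.
  have se_q : (size (e`_q)%R <= p.+1)%N by rewrite esz.
  have ep : (e`_q)`_p = 1 by move: emon; rewrite monicE lead_coefE esz => /eqP.
  have Si i : (i < k.+2)%N -> (k.+1 * p = (k.+1 - i) * p + i * p)%N.
    by move=> ik; rewrite -mulnDl subnK.
  have Stop : S`_(k.+1 * p) = k.+2%:R.
    rewrite /S coef_sum -[k.+2 in RHS]card_ord -sumr_const; apply: eq_bigr => i _.
    rewrite (Si i)// coefM_top ?size_exp_bound// !coef_exp_top//.
    by rewrite ep coefXn eqxx !expr1n mulr1.
  have szS : size S = (k.+1 * p).+1.
    apply/eqP; rewrite eqn_leq; apply/andP; split.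
      apply: (leq_trans (size_sum _ _ _)); apply/bigmax_leqP => i _.
      by rewrite (Si i)// size_mul_bound ?size_exp_bound.
    rewrite ltnNge; apply/negP => /leq_sizeP/(_ _ (leqnn _)); rewrite Stop => /eqP.
    by rewrite pnatr_eq0.
  have S0 : S != 0 by rewrite -size_poly_eq0 szS.
  move: f0s0; rewrite -Xe (size_mul ne S0) szS addnS /=.
  move: ne; rewrite -size_poly_gt0; move: (size _) (k.+1 * p)%N => x y; clear; lia.
suff key j : (j <= p)%N -> exists h, e`_(q - j) = h * 'X^(p - j).
  move=> r; have [ltqr|lerq] := ltnP q r.
    by exists 0; rewrite mul0r nth_default// (leq_trans se).
  have [lt|le] := ltnP (q - r) p.+1.
    have [h hE] := key (q - r)%N lt; exists h; rewrite subKn// in hE; rewrite hE.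
    by congr (_ * 'X^_); clear -lerq pq lt; lia.
  exists e`_r; have -> : (r - (q - p) = 0)%N by clear -lerq pq le; lia.
  by rewrite expr0 mulr1.
elim/ltn_ind: j => -[|j] IH jp; first by exists 1; rewrite !subn0 mul1r.
(* the rows of e already known to have the right divisibility *)
pose U := \poly_(r < q.+1) (if (q - j.+1 < r)%N then e`_r else 0).
pose W := e - U.
have jq : (j.+1 <= q)%N by exact: leq_trans pq.
have Us : slope_le (q - p) U.
  move=> r; rewrite /U coef_poly; case: ltnP => rq; last by exists 0; rewrite mul0r.
  case: ltnP => qr; last by exists 0; rewrite mul0r.
  have l1 : (q - r < j.+1)%N by clear -jq qr rq; lia.
  have l2 : (q - r <= p)%N by clear -l1 jp; lia.
  have [h hE] := IH _ l1 l2.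
  exists h; rewrite subKn// in hE; rewrite hE.
  by congr (_ * 'X^_); clear -rq pq qr jp; lia.
have sU : (size U <= q.+1)%N by exact: size_poly.
have sW : (size W <= (q - j.+1).+1)%N.
  apply/leq_sizeP => r ler; rewrite /W coefB /U coef_poly ler.
  case: ltnP => qr; first by rewrite subrr.
  by rewrite subr0 nth_default// (leq_trans se).
have Uq : U`_q = 'X^p.
  by rewrite /U coef_poly ltnSn eq ltn_subrL /= q0.
have WE : W`_(q - j.+1) = e`_(q - j.+1).
  by rewrite /W coefB /U coef_poly ltnn if_same subr0.
have := coef_exp_split k.+1 sU sW jq; rewrite WE Uq.
have -> : U + W = e by rewrite /W addrC subrK.
set g := e`_(q - j.+1) => eE.
have := congr1 (fun h : {poly K} => h`_(k.+2 * q - j.+1)) fE; rewrite /= coefD.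
rewrite (coef_subst_top amon asz a0 se); last by clear -jp pq q0; lia.
rewrite eE; have [h1 ->] := slope_leX k.+2 Us (k.+2 * q - j.+1)%N.
have [h2 ->] := fs (k.+2 * q - j.+1)%N.
have -> : (k.+2 * q - j.+1 - k.+2 * (q - p) = k.+1 * p + (p - j.+1))%N.
  by clear -jp pq; nia.
have := f0s _ jp; move: (f0`_(k.+2 * q - j.+1)) => f1 sf1 FE.
have alg (y x : K) l : h2 * (y * x) = h1 * (y * x) + (y * g) *+ l + f1 ->
    f1 = ((h2 - h1) * x - g *+ l) * y.
  move=> E; have -> : f1 = h2 * (y * x) - (h1 * (y * x) + (y * g) *+ l).
    by rewrite E [X in X - _]addrC addrK.
  by rewrite -[(y * g) *+ l]mulr_natr -[g *+ l]mulr_natr; move: (l%:R : K) => z; ring.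
rewrite exprD -exprM [(p * k.+1)%N]mulnC in FE.
have f1E := alg _ _ _ FE; rewrite f1E in sf1.
have [z0|z0] := eqVneq ((h2 - h1) * 'X^(p - j.+1) - g *+ k.+2) 0; last first.
  move: sf1; rewrite size_Mmonic ?monicXn// size_polyXn addnS /=.
  move: z0; rewrite -size_poly_gt0; move: (size _) (k.+1 * p)%N => x y; clear; lia.
exists (k.+2%:R^-1 *: (h2 - h1)); rewrite -scalerAl (subr0_eq z0) -scaler_nat scalerA.
by rewrite mulVf ?scale1r// pnatr_eq0.
Qed.

End RowInduction.

(** * Arithmetic of the bounds *)

Section Floors.

Lemma truncn_div (x y : nat) : (0 < y)%N -> Num.truncn (x%:R / y%:R : rat) = (x %/ y)%N.
Proof.
move=> y0; apply: truncn_def; rewrite ler_pdivlMr ?ltr0n// ltr_pdivrMr ?ltr0n// -!natrM ler_nat ltr_nat.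
by rewrite leq_trunc_div ltn_ceil.
Qed.

Lemma fl0E m n i : (0 < m < n)%N -> fl0 m n i = (i %/ m)%N.
Proof.
move=> /andP[m0 mn]; have nm : (0 < n - m)%N by rewrite subn_gt0.
rewrite /fl0 /eps truncn_div ?muln_gt0 ?m0//.
by rewrite divnMr.
Qed.

Lemma fl1E m n i : (0 < m < n)%N -> fl1 m n i = (i.+1 %/ (n - m))%N.
Proof.
move=> /andP[m0 mn]; have nm : (0 < n - m)%N by rewrite subn_gt0.
rewrite /fl1 /eps truncn_div ?muln_gt0 ?m0//.
by rewrite [(i.+1 * m)%N]mulnC divnMl.
Qed.

(** Floors drop only at multiples of the divisor. *)
Lemma divn_pred d i : (0 < d)%N -> (0 < i)%N ->
  ((i - 1) %/ d)%N = if (d %| i)%N then (i %/ d).-1 else (i %/ d)%N.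
Proof.
move=> d0 i0; rewrite subn1; case: ifP => [/dvdnP[q qE]|ndvd].
  case: q qE i0 => [->//|q -> _]; rewrite mulnK// mulSn -[d in (d + _)%N]prednK//.
  by rewrite addSn /= addnC divnMDl// divn_small ?addn0// prednK.
rewrite {1}(divn_eq i d).
have r0 : (0 < i %% d)%N by rewrite lt0n -/(dvdn d i) ndvd.
rewrite -subn1 -addnBA// divnMDl// [((_ - 1) %/ d)%N]divn_small ?addn0//.
by rewrite (leq_ltn_trans (leq_subr _ _))// ltn_mod.
Qed.

End Floors.

(** * Slopes and degrees of the decomposition *)

Section Slopes.
Variables (R : realType).
Local Notation C := R[i].
Local Notation pol2 := {poly {poly R[i]}}.

Lemma condF_slope (m n : nat) (F : pol2) (u : bool) : (m <= n)%N -> condF m n F ->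
  slope_le (if u then m else n - m)%N (straight u F).
Proof.
move=> mn [[FT _] F0 F1] j; have FI := inside_N0 FT.
have szF := size_straight_inside u FI.
have [ltj|lej] := ltnP (u * m + n) j.
  by exists 0; rewrite mul0r nth_default// (leq_trans szF).
have [ltc|lec] := ltnP (if u then m else n - m)%N j; last first.
  exists (straight u F)`_j; have /eqP -> : (j - (if u then m else n - m) == 0)%N.
    by rewrite subn_eq0.
  by rewrite mulr1.
case: u szF ltc lej => _ ltc; rewrite ?mul1n ?mul0n ?add0n => lej.
  have lei : (m + n - j <= n)%N by clear -ltc; lia.
  have := F1 _ lei.
  have -> : (m%:Z + n%:Z - (m + n - j)%N%:Z = j%:Z) by clear -lej; lia.
  have -> : (n%:Z - (m + n - j)%N%:Z = j%:Z - m%:Z) by clear -lej; lia.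
  by move=> /dvd_straight[q qE]; exists q; rewrite qE pospart_subn.
have lei : (n - j <= m)%N by clear -ltc mn; lia.
have := F0 _ lei.
have -> : (n%:Z - (n - j)%N%:Z = j%:Z) by clear -lej; lia.
have -> : (m%:Z - (n - j)%N%:Z = j%:Z - (n - m)%N%:Z) by clear -lej mn; lia.
by move=> /dvd_straight[q qE]; exists q; rewrite qE pospart_subn.
Qed.

Lemma subst_comp (alpha : {poly C}) (p : {poly {poly C}}) :
  subst alpha p = map_poly polyC alpha \Po p.
Proof.
rewrite comp_polyE size_map_polyC /subst; apply: eq_bigr => i _.
by rewrite coef_map/= mul_polyC.
Qed.

Variables (a m n delta p q : nat) (F Fc E : pol2) (alpha : {poly C}).
Hypothesis D : decomposition a m n delta p q F Fc E alpha.
Hypothesis a2 : (2 <= a)%N.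
Hypothesis m0 : (0 < m)%N.
Hypothesis mn : (m < n)%N.
Hypothesis Fcond : condF m n F.
Hypothesis Fmono : F`_n`_m = 1.

Let FI : inside m n F.
Proof. by case: Fcond => -[/inside_N0]. Qed.

Let mE : m = (delta * a * p)%N. Proof. exact: dec_m D. Qed.
Let nE : n = (delta * a * q)%N. Proof. exact: dec_n D. Qed.
Let d0 : (0 < delta)%N. Proof. exact: dec_delta D. Qed.
Let a0 : (0 < a)%N. Proof. by case: a a2. Qed.
Let p0 : (0 < p)%N. Proof. by move: m0; rewrite mE !muln_gt0 => /andP[]. Qed.
Let pq : (p < q)%N.
Proof. by move: mn; rewrite mE nE ltn_pmul2l// muln_gt0 d0 a0. Qed.

Lemma straight_dec u : straight u F = subst alpha (straight u E) + straight u Fc.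
Proof.
have := straightB u F Fc; rewrite {1}(dec_F D) addrK straight_subst2 => ->.
by rewrite subrK.
Qed.

(** The corner of $F$ is outside the support of $F^\circ$, so the top row
of $\alpha(E)$ is not zero: $\alpha(E)$ has degree $n$ in $y$, and $E$ has degree
$q$. *)
Lemma size_alpha_dec : size alpha = (delta * a).+1.
Proof.
have [amon asz _] := dec_T D.
have [Emon Esz] := straight_top false (dec_inside D) (dec_corner D).
have [Fmon Fsz] := straight_top false FI Fmono.
have Ele := size_straight_inside false (dec_inside D).
have Fle := size_straight_inside false FI.
have Fcle := size_straight_inside false (dec_inside_Fc D).
have Fcn : (size ((straight false Fc)`_n)%R <= m)%N.
  rewrite size_straight_slice /slice; apply/leq_sizeP => i mi.
  apply/eqP/negP => /negP /(dec_below D).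
  have -> : ((a - 1) * (delta * q) <= n)%N by rewrite nE mulnBl mul1n; clear; lia.
  move=> /(_ isT); rewrite ltnNge; apply/negP; rewrite negbK (leq_trans _ mi)// mE.
  by rewrite mulnBl mul1n; clear; lia.
rewrite mul0n add0n in Emon Esz Ele Fmon Fsz Fle Fcle.
have := straight_dec false; move: (straight false F) (straight false E) (straight false Fc)
  Emon Esz Ele Fmon Fsz Fle Fcle Fcn => f e fc emon esz ele fmon fsz fle fcle fcn fE.
have sE : size (subst alpha e) = n.+1.
  have -> : subst alpha e = f - fc by rewrite fE addrK.
  apply/eqP; rewrite eqn_leq; apply/andP; split.
    by rewrite (leq_trans (size_polyD _ _))// geq_max fle size_polyN.
  rewrite ltnNge; apply/negP => /leq_sizeP/(_ _ (leqnn _)).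
  rewrite coefB => /subr0_eq fn; move: fcn; rewrite -fn fsz ltnn; exact.
have se : size e = q.+1.
  apply/eqP; rewrite eqn_leq ele ltnNge; apply/negP => /leq_sizeP/(_ _ (leqnn _)) e0.
  by move: esz; rewrite e0 size_poly0.
have := size_comp_poly (map_poly polyC alpha) e; rewrite -subst_comp sE se size_map_polyC /=.
rewrite nE => /eqP; rewrite eqn_pmul2r ?(leq_trans p0 (ltnW pq))// => /eqP ->.
by rewrite prednK// (leq_trans _ asz).
Qed.

Lemma slope_root u c : (c <= (if u then m else n - m))%N ->
  slope_le c (straight u Fc) -> slope_le (uE a m n delta u) (straight u E).
Proof.
move=> cd Fcs; have [amon asz _] := dec_T D.
have uEE : ((size alpha).-1 * uE a m n delta u = if u then m else n - m)%N.
  rewrite size_alpha_dec /= /uE; case: u {cd Fcs}.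
    by rewrite {1}mE mulKn ?muln_gt0 ?d0// mE.
  by rewrite mE nE -mulnBr mulKn ?muln_gt0 ?d0.
apply: (slope_le_root amon asz); rewrite uEE.
have -> : subst alpha (straight u E) = straight u F - straight u Fc.
  by rewrite straight_dec addrK.
apply: slope_leB; first exact: condF_slope (ltnW mn) Fcond.
exact: slope_leW Fcs.
Qed.

Lemma row_below j : ((a - 1) * (delta * q) <= j)%N ->
  (size ((straight false Fc)`_j)%R <= (a - 1) * (delta * p))%N.
Proof.
move=> lej; rewrite size_straight_slice /slice; apply/leq_sizeP => i lei.
by apply/eqP/negP => /negP /(dec_below D)/(_ lej); rewrite ltnNge lei.
Qed.

(** No divisibility of $F^\circ$ is assumed: the shortness of
its high rows is enough to compare $F$ with $\alpha(E)$ ([rows_slope]), and then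
$F^\circ$ has the slope that $F$ and $\alpha(E)$ have in common. *)
Lemma slope_initial : slope_le (n - m) (straight false Fc).
Proof.
have [amon asz a1] := dec_T D.
have da2 : (2 <= delta * a)%N by rewrite (leq_trans a2)// leq_pmull.
have [k kE] : exists k, (delta * a = k.+2)%N by move: da2; case: (delta * a)%N => [|[|k]]// _; exists k.
have szk : size alpha = k.+3 by rewrite size_alpha_dec kE.
have nmE : (n - m = k.+2 * (q - p))%N by rewrite mE nE kE mulnBr.
have Fs : slope_le (n - m)%N (straight false F) := condF_slope false (ltnW mn) Fcond.
have Ftop : (straight false F)`_n = 'X^m.
  have := straight_top_slope FI Fs; rewrite mul0n add0n subKn ?(ltnW mn)// => /(_ erefl).
  by rewrite Fmono scale1r.
have [Emon Esz] := straight_top false (dec_inside D) (dec_corner D).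
have Ele := size_straight_inside false (dec_inside D).
rewrite mul0n add0n in Emon Esz Ele.
have Es : slope_le (q - p) (straight false E).
  have ak : alpha`_k.+1 = 0 by move: a1; rewrite szk.
  have pq' : (0 < p <= q)%N by rewrite p0 (ltnW pq).
  apply: (rows_slope amon szk ak pq' Ele Emon Esz (straight_dec false)).
  - by rewrite -nmE; exact: Fs.
  - by rewrite -kE -mE -nE; exact: Ftop.
  move=> j jp; rewrite -kE -nE.
  have lej : ((a - 1) * (delta * q) <= n - j)%N.
    by rewrite nE mulnBl mul1n; move: jp pq d0; clear; nia.
  apply: (leq_trans (row_below lej)).
  have -> : (k.+1 = delta * a - 1)%N by rewrite kE subn1.
  by rewrite !mulnBl !mul1n; move: p0 d0; clear; nia.
have -> : straight false Fc = straight false F - subst alpha (straight false E).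
  by rewrite straight_dec addrC addKr.
apply: slope_leB; first exact: Fs.
by rewrite nmE -[k.+2]/(k.+3.-1) -szk; exact: slope_le_subst.
Qed.

Lemma mulXn_small (h : {poly C}) k : (size (h * 'X^k)%R <= k)%N -> h * 'X^k = 0.
Proof.
have [->|h0] := eqVneq h 0; first by rewrite mul0r.
rewrite size_Mmonic ?monicXn// size_polyXn addnS /=.
by move: h0; rewrite -size_poly_gt0; move: (size h) => x; clear; lia.
Qed.

(** A high row has degree less than $(a-1)\delta p$ in $x$, but is divisible by
$s^{j-c}$. *)
Lemma size_below_x c : ((a - 1) * (delta * (q - p)) <= c)%N ->
  slope_le c (straight false Fc) ->
  (size (straight false Fc) <= c + (a - 1) * (delta * p))%N.
Proof.
move=> lec Fs; apply/leq_sizeP => j lej; have [h hE] := Fs j.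
have lej' : ((a - 1) * (delta * q) <= j)%N.
  by apply: leq_trans lej; move: lec (ltnW pq); rewrite !mulnBr !mulnBl; clear; nia.
have := row_below lej'; rewrite hE => sz; apply: mulXn_small; apply: (leq_trans sz).
by rewrite leq_subRL ?(leq_trans (leq_addr _ _) lej).
Qed.

(** By [size_below_x] the degree in $y$ is less than $(a-1)\delta q$,
and components of $(1,1)$-degree $j$ are divisible by $s^{j-c}$. *)
Lemma size_below_y c : slope_le ((a - 1) * (delta * (q - p))) (straight false Fc) ->
  slope_le c (straight true Fc) ->
  (size (straight true Fc) <= c + (a - 1) * (delta * q))%N.
Proof.
move=> F0s F1s; have := size_below_x (leqnn _) F0s.
rewrite -!mulnDr subnK ?(ltnW pq)// => sz0.
have row0 j : ((a - 1) * (delta * q) <= j)%N -> Fc`_j = 0.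
  move=> lej; apply/eqP; rewrite -size_poly_eq0.
  by rewrite -[Fc`_j]/(slice false Fc j) -size_straight_slice nth_default ?size_poly0// (leq_trans sz0).
apply/leq_sizeP => j lej; have [h hE] := F1s j.
rewrite hE; apply: mulXn_small; rewrite -hE size_straight_slice /slice.
apply: (@leq_trans ((a - 1) * (delta * q))%N).
  apply/leq_sizeP => i lei; rewrite coef_poly; case: ifP => // _.
  by rewrite row0// coef0.
by rewrite leq_subRL ?(leq_trans (leq_addr _ _) lej).
Qed.

Lemma size_corner0 u P Q c : inside P Q Fc -> Fc`_Q`_P = 0 -> slope_le c (straight u Fc) ->
  (u * P + Q - c = if u then Q else P)%N -> (size (straight u Fc) <= u * P + Q)%N.
Proof.
move=> FcI Fc0 Fs cE; have := straight_top_slope FcI Fs cE.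
rewrite Fc0 scale0r => top; apply/leq_sizeP => j.
rewrite leq_eqVlt => /orP[/eqP <- //|ltj].
by rewrite nth_default// (leq_trans (size_straight_inside u FcI)).
Qed.

End Slopes.

Section Numerics.
Variables (a m n delta p q : nat).
Hypothesis a2 : (2 <= a)%N.
Hypothesis d0 : (0 < delta)%N.
Hypothesis p0 : (0 < p)%N.
Hypothesis pq : (p < q)%N.
Hypothesis mE : m = (delta * a * p)%N.
Hypothesis nE : n = (delta * a * q)%N.

Let da0 : (0 < delta * a)%N. Proof. by rewrite muln_gt0 d0 (ltnW a2). Qed.

Lemma mn_range : (0 < m < n)%N.
Proof. by rewrite mE nE muln_gt0 da0 p0 ltn_pmul2l. Qed.

Lemma diffE : (n - m = delta * a * (q - p))%N.
Proof. by rewrite nE mE mulnBr. Qed.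

Lemma diff_gt1 : (1 < n - m)%N.
Proof.
rewrite diffE; have : (0 < q - p)%N by rewrite subn_gt0.
by move: a2 d0; clear; nia.
Qed.

Lemma thresholdE : threshold a m n = (m * ((a - 1) * (delta * (q - p))))%N.
Proof.
rewrite /threshold diffE -[RHS](mulKn _ (ltnW a2)); congr (_ %/ _)%N; ring.
Qed.

Lemma thresholdE' : threshold a m n = ((n - m) * ((a - 1) * (delta * p)))%N.
Proof. rewrite thresholdE diffE mE; ring. Qed.

Lemma uEE u : uE a m n delta u = if u then p else (q - p)%N.
Proof. by rewrite /uE diffE mE !mulKn// if_same. Qed.

Lemma vEE u : vE a m n delta u = (u * p + q)%N.
Proof.
rewrite /vE /Ed mE nE.
have -> : (u * (delta * a * p) + delta * a * q = delta * a * (u * p + q))%N by ring.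
by rewrite mulKn.
Qed.

Lemma fl0_le i k : (i <= m * k)%N -> (fl0 m n i <= k)%N.
Proof.
move=> ik; rewrite fl0E ?mn_range//; have /andP[m0 _] := mn_range.
by rewrite -(mulKn k m0) leq_div2r.
Qed.

Lemma fl1_le i k : (i <= (n - m) * k)%N -> (fl1 m n i <= k)%N.
Proof.
move=> ik; rewrite fl1E ?mn_range//.
have nm0 : (0 < n - m)%N := ltnW diff_gt1.
rewrite -ltnS ltn_divLR// mulSn mulnC.
by apply: (leq_trans (n := ((n - m) * k).+2)); rewrite ?ltnS// -addn2 addnC leq_add2r diff_gt1.
Qed.

Lemma uF_le u i : (i <= m * (n - m))%N -> (uF m n i u <= if u then m else n - m)%N.
Proof.
by case: u => im; [apply: fl1_le; rewrite mulnC|apply: fl0_le].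
Qed.

Lemma vF_high i u : (threshold a m n < i)%N ->
  vF a m n delta i u + 1 = (uF m n i u + (a - 1) * (delta * (if u then q else p)))%N.
Proof.
move=> ti; rewrite /vF ti subrK.
have -> : ((u * n - u * m + m) * (a - 1) %/ a = (a - 1) * (delta * (if u then q else p)))%N.
  have -> : (u * n - u * m + m = a * (delta * (if u then q else p)))%N.
    rewrite nE mE; case: u; rewrite ?mul1n ?mul0n ?subnn; first rewrite subnK; try ring.
    by rewrite leq_mul2l (ltnW pq) orbT.
  by rewrite -mulnA mulKn ?(ltnW a2)// mulnC.
by [].
Qed.

(** In the exceptional case of the definition of $\mathrm{v}_F$, the
trapezoid $T_{a_i,b_i}$ is $k\,T_{p,q}$ for an integer $k$. *)
Lemma vF_low i u : (i <= threshold a m n)%N ->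
  vF a m n delta i u + 1 = (u * seqa m n i + seqb m n i).+1 \/
  vF a m n delta i u + 1 = (u * seqa m n i + seqb m n i)%N /\
    exists k, [/\ (k <= delta * (a - 1))%N, seqa m n i = (k * p)%N,
      seqb m n i = (k * q)%N & fl0 m n i = (k * q - k * p)%N].
Proof.
move=> it; rewrite /vF ltnNge it /=; case: ifP => [/andP[/eqP q01 qint]|_]; last first.
  by left; rewrite -addn1 PoszD.
right; split; first by rewrite subrK.
have /andP[m0 mn] := mn_range.
have nm0 : (0 < n - m)%N := ltnW diff_gt1.
have : ((a * delta * fl1 m n i)%N%:R / m%:R : rat) \is a Num.nat.
  by rewrite natrEint qint divr_ge0.
case/natrP => k kE; rewrite kE in q01.
have k1 : (a * delta * fl1 m n i = k * m)%N.
  by apply/eqP; rewrite -(eqr_nat rat) [eqbRHS]natrM -kE divfK// pnatr_eq0 -lt0n.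
have k0 : (a * delta * fl0 m n i = k * (n - m))%N.
  by apply/eqP; rewrite -(eqr_nat rat) [eqbRHS]natrM -q01 divfK// pnatr_eq0 -lt0n.
have f1 : (fl1 m n i = k * p)%N.
  apply/eqP; rewrite -(eqn_pmul2l da0) [(delta * a)%N]mulnC k1 mE; apply/eqP; ring.
have f0 : (fl0 m n i = k * (q - p))%N.
  apply/eqP; rewrite -(eqn_pmul2l da0) [(delta * a)%N]mulnC k0 diffE; apply/eqP; ring.
exists k; split=> //.
- have := @fl0_le i ((a - 1) * (delta * (q - p))); rewrite -thresholdE => /(_ it).
  have -> : ((a - 1) * (delta * (q - p)) = delta * (a - 1) * (q - p))%N by ring.
  by rewrite f0 leq_pmul2r// subn_gt0.
- by rewrite /seqb f1 f0 -mulnDr subnKC// ltnW.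
- by rewrite f0 mulnBr.
Qed.

Lemma vF_ge i u : -1 <= vF a m n delta i u.
Proof.
suff : 0 <= vF a m n delta i u + 1 by rewrite -lerBlDr sub0r.
have [ti|it] := ltnP (threshold a m n) i; first by rewrite vF_high.
by have [->|[-> _]] := vF_low u it.
Qed.

Lemma nF_le i u : (i <= m * (n - m))%N -> (nF a m n delta i u <= Ed m n u)%N.
Proof.
move=> im; rewrite /nF /Ed; have [ti|it] := ltnP (threshold a m n) i.
  rewrite vF_high// absz_nat; apply: (leq_trans (leq_add (uF_le u im) (leqnn _))).
  by rewrite mE nE; case: u; rewrite ?mul1n ?mul0n -?mulnBr; move: (ltnW a2) pq; clear; nia.
have l1 : (seqa m n i <= (a - 1) * (delta * p))%N by apply: fl1_le; rewrite -thresholdE'.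
have l0 : (fl0 m n i <= (a - 1) * (delta * (q - p)))%N by apply: fl0_le; rewrite -thresholdE.
apply: (@leq_trans (u * seqa m n i + seqb m n i).+1).
  by have [->|[-> _]] := vF_low u it.
rewrite /seqb; move: l1 l0; rewrite /seqa mE nE; move: (fl1 _ _ _) (fl0 _ _ _) => x y l1 l0.
have xy : (x + y <= (a - 1) * (delta * q))%N.
  by apply: (leq_trans (leq_add l1 l0)); rewrite -!mulnDr subnKC// ltnW.
have ux : (u * x <= u * (delta * a * p))%N.
  by rewrite leq_mul2l (leq_trans l1) ?orbT// mulnBl; clear; lia.
rewrite -addnS leq_add// (leq_ltn_trans xy)//.
by move: (leq_ltn_trans (leq0n p) pq) a2 d0; clear; nia.
Qed.

End Numerics.

(** * Descent of the divisibility collections *)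

Section Step.
Variables (R : realType) (a b m n delta p q : nat).
Local Notation C := R[i].
Local Notation pol2 := {poly {poly R[i]}}.
Variables (F G Fc E : pol2) (alpha : {poly C}).
Hypothesis AE : AssertionE R.
Hypothesis abmn : calQ a b m n.
Hypothesis Fcond : condF m n F.
Hypothesis Gcond : condG a b m n F G.
Hypothesis D : decomposition a m n delta p q F Fc E alpha.

Let a2 : (2 <= a)%N. Proof. by case: abmn => _ [_ _ _ _ /andP[]]. Qed.
Let m0 : (0 < m)%N. Proof. by case: abmn => -[]. Qed.
Let n0 : (0 < n)%N. Proof. by case: abmn => -[]. Qed.
Let b0 : (0 < b)%N. Proof. by case: abmn => -[]. Qed.
Let mn : (m < n)%N. Proof. by case: abmn => _ []. Qed.
Let mE : m = (delta * a * p)%N. Proof. exact: dec_m D. Qed.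
Let nE : n = (delta * a * q)%N. Proof. exact: dec_n D. Qed.
Let d0 : (0 < delta)%N. Proof. exact: dec_delta D. Qed.
Let a0 : (0 < a)%N. Proof. exact: ltnW a2. Qed.
Let p0 : (0 < p)%N. Proof. by move: m0; rewrite mE !muln_gt0 => /andP[]. Qed.
Let pq : (p < q)%N.
Proof. by move: mn; rewrite mE nE ltn_pmul2l// muln_gt0 d0 a0. Qed.
Let Fmono : F`_n`_m = 1.
Proof. by case: Fcond => -[FT Flt] _ _; exact: corner_coef1. Qed.
Let FI : inside m n F.
Proof. by case: Fcond => -[/inside_N0]. Qed.

Lemma slope_step (i : nat) (u : bool) : inI m n i u ->
  slope_le (uF m n i u) (straight u Fc) ->
  (size (straight u Fc) <= nF a m n delta i u)%N ->
  slope_le (uF m n i u).-1 (straight u Fc).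
Proof.
move=> iI Fs szFc; have [im _] := iI.
have le_c := uF_le a2 d0 p0 pq mE nE u im.
have Es := slope_root D a2 m0 mn Fcond Fmono le_c Fs.
have deltaP : [/\ (0 < delta)%N, (delta %| m %/ a)%N & (delta %| n %/ a)%N].
  by rewrite mE nE [(delta * a)%N]mulnC -!mulnA !mulKn// !dvdn_mulr.
have vEq := vEE a2 d0 mE nE u; have uEq := uEE a2 d0 mE nE u.
have uv : (u * p + q - (if u then p else q - p) = if u then q else p)%N.
  by case: (u); rewrite ?mul1n ?addKn// mul0n add0n subKn// ltnW.
have sE : (size (straight u E) <= (vE a m n delta u).+1)%N.
  by rewrite vEq; exact: size_straight_inside (dec_inside D).
have lE : (straight u E)`_(vE a m n delta u) =
    'X^(vE a m n delta u - uE a m n delta u).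
  rewrite vEq uEq uv; rewrite uEq in Es.
  by rewrite (straight_top_slope (dec_inside D) Es uv) (dec_corner D) scale1r.
have lF : (straight u F)`_(Ed m n u) = 'X^(EN m n u).
  have uvF : (u * m + n - (if u then m else n - m) = if u then n else m)%N.
    by case: (u); rewrite ?mul1n ?addKn// mul0n add0n subKn// ltnW.
  have := straight_top_slope FI (condF_slope u (ltnW mn) Fcond) uvF.
  by rewrite Fmono scale1r.
have [GT Glt [c0 FG]] := Gcond.
have GP : (b * m %/ a = b * delta * p)%N.
  by rewrite mE -[RHS](mulKn _ a0); congr (_ %/ _)%N; ring.
have GQ : (b * n %/ a = b * delta * q)%N.
  by rewrite nE -[RHS](mulKn _ a0); congr (_ %/ _)%N; ring.
have GE : Ee a b m n u = (u * (b * m %/ a) + b * n %/ a)%N.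
  rewrite GP GQ /Ee /Ed mE nE -[RHS](mulKn _ a0); congr (_ %/ _)%N; ring.
have P0 : (0 < b * m %/ a)%N by rewrite GP !muln_gt0 b0 d0 p0.
have GI := inside_N0 GT.
have [Gmon _] := straight_top u GI (corner_coef1 P0 GT Glt).
have sG := size_straight_inside u GI; rewrite -GE in Gmon sG.
have da0 : (0 < delta * a)%N by rewrite muln_gt0 d0.
have FE := dec_F D.
apply: (remainder_vanishing m0 n0 AE abmn deltaP iI (dec_T D)
  (size_alpha_dec D a2 m0 mn Fcond Fmono) (dec_principal D) Es Fs sE lE szFc
  (vF_ge a2 d0 p0 pq mE nE i u) _ _ _ (nF_le a2 d0 p0 pq mE nE u im) _ _ sG Gmon (c0 := c0)).
- rewrite vEq /Ed mE nE; ring.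
- by rewrite vEq uEq uv /EN; case: (u); rewrite ?mE ?nE.
- by rewrite vEq uEq; case: (u); move: pq p0; clear; lia.
- rewrite -FE; exact: size_straight_inside FI.
- rewrite -FE; exact: lF.
- rewrite -FE; exact: FG.
rewrite /Ed GE GP GQ; have : (0 < b * delta * p)%N by rewrite -GP.
have : (b * delta * p < b * delta * q)%N by rewrite ltn_pmul2l ?muln_gt0 ?b0.
by move: (b * delta * p)%N (b * delta * q)%N m0 mn; case: (u); clear; lia.
Qed.

Let fl0_thr : fl0 m n (threshold a m n) = ((a - 1) * (delta * (q - p)))%N.
Proof.
rewrite fl0E ?(mn_range a2 d0 p0 pq mE nE)// (thresholdE a2 mE nE).
by rewrite mulKn.
Qed.

Let thr_le : (threshold a m n <= m * (n - m))%N.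
Proof.
rewrite /threshold -[leqRHS](mulnK _ a0) leq_div2r//.
by rewrite leq_mul2l leq_subr orbT.
Qed.

Lemma size_above (i : nat) (u : bool) : (threshold a m n < i)%N ->
  slope_le (uF m n i u) (straight u Fc) ->
  (u -> slope_le (fl0 m n (threshold a m n)) (straight false Fc)) ->
  (size (straight u Fc) <= nF a m n delta i u)%N.
Proof.
move=> ti Fs F0s; rewrite /nF (vF_high a2 pq mE nE)// absz_nat.
case: u Fs F0s => [Fs /(_ isT)|Fs _].
  by rewrite fl0_thr => F0s; exact: (size_below_y D a2 mn F0s Fs).
apply: (size_below_x D a2 mn _ Fs); rewrite -fl0_thr /uF.
rewrite !fl0E ?(mn_range a2 d0 p0 pq mE nE)//; exact: leq_div2r (ltnW ti).
Qed.

Lemma size_upto (i : nat) (u : bool) : (i <= threshold a m n)%N -> DSC m n i Fc ->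
  (size (straight u Fc) <= nF a m n delta i u)%N.
Proof.
move=> it [[/wDC_slope s0 /wDC_slope s1] /supp_trapezoid FcI]; rewrite /nF.
have [->|[-> [k [kle aE bE fE]]]] := vF_low a2 d0 p0 pq mE nE u it.
  exact: size_straight_inside FcI.
rewrite absz_nat; rewrite aE bE in FcI *.
have s0' : slope_le (k * q - k * p) (straight false Fc) by rewrite -fE.
have s1' : slope_le (k * p) (straight true Fc) by rewrite -aE.
have FT : N0 F = trapezoid m n by case: Fcond => -[].
have p0q : (0 < p <= q)%N by rewrite p0 ltnW.
have c0 := minimal_corner D (size_alpha_dec D a2 m0 mn Fcond Fmono) a0 p0q FT kle FcI s0' s1'.
case: u.
  by apply: (size_corner0 FcI c0 s1'); rewrite mul1n addKn.
by apply: (size_corner0 FcI c0 s0'); rewrite mul0n add0n subKn// leq_mul2l (ltnW pq) orbT.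
Qed.

Lemma uF_pred (i : nat) (u : bool) : (0 < i <= m * (n - m))%N ->
  inI m n i u /\ uF m n (i - 1) u = (uF m n i u).-1 \/ uF m n (i - 1) u = uF m n i u.
Proof.
move=> /andP[i0 im]; have rng := mn_range a2 d0 p0 pq mE nE.
have nm0 : (0 < n - m)%N by rewrite subn_gt0.
rewrite /inI; case: u; rewrite /uF ?fl0E ?fl1E//.
  have -> : (i - 1).+1 = (i.+1 - 1)%N by rewrite subn1 prednK// subn1.
  by rewrite divn_pred//; case: ifP; [left|right].
by rewrite divn_pred//; case: ifP; [left|right].
Qed.

Lemma wDC_pred (i : nat) (u : bool) : (0 < i <= m * (n - m))%N ->
  wDC m n u i Fc -> (inI m n i u -> (size (straight u Fc) <= nF a m n delta i u)%N) ->
  wDC m n u (i - 1) Fc.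
Proof.
move=> irng /wDC_slope Fs szFc; apply/wDC_slope.
have [[iI ->]|->] := uF_pred u irng; last exact: Fs.
exact: slope_step iI Fs (szFc iI).
Qed.

Lemma wDC_x_pred (i : nat) : (threshold a m n + 1 <= i <= m * (n - m))%N ->
  wDC m n false i Fc -> wDC m n false (i - 1) Fc.
Proof.
rewrite addn1 => /andP[ti im] FDC; apply: wDC_pred => // [|_].
  by rewrite im (leq_trans _ ti).
by apply: size_above => //; exact/wDC_slope.
Qed.

(** The chain starts at $i=m(n-m)$ with [slope_initial]. *)
Lemma wDC_x_threshold : wDC m n false (threshold a m n) Fc.
Proof.
suff key k i : (i + k = m * (n - m))%N -> (threshold a m n <= i)%N -> wDC m n false i Fc.
  by apply: (key (m * (n - m) - threshold a m n)%N); rewrite ?subnKC ?thr_le.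
elim: k i => [|k IH] i.
  rewrite addn0 => -> _; apply/wDC_slope; rewrite /uF fl0E ?(mn_range a2 d0 p0 pq mE nE)//.
  by rewrite mulKn//; exact: (slope_initial D a2 m0 mn Fcond Fmono).
rewrite addnS -addSn => ik ti; have := IH _ ik (leqW ti).
have := @wDC_x_pred i.+1; rewrite subn1 addn1 /=; apply.
by rewrite ltnS ti -ik leq_addr.
Qed.

(** At the threshold itself the index is not in $\mathcal I$ for $u=1$,
because $n-m\geq2$ divides the threshold. *)
Lemma wDC_y_pred (i : nat) : (threshold a m n <= i <= m * (n - m))%N ->
  wDC m n true i Fc -> wDC m n true (i - 1) Fc.
Proof.
move=> /andP[ti im] FDC; have [i0|i0] := posnP i; first by move: FDC; rewrite i0.
apply: wDC_pred => // [|[_ nmi]]; first by rewrite i0.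
apply: size_above; [|exact/wDC_slope|by move=> _; have /wDC_slope := wDC_x_threshold].
rewrite ltn_neqAle ti andbT; apply/eqP => tE; move: nmi.
rewrite -tE (thresholdE' a2 mE nE) -addn1 dvdn_addr ?dvdn_mulr// dvdn1.
by have := diff_gt1 a2 d0 pq mE nE; case: eqP => [->|].
Qed.

Lemma DSC_pred (i : nat) : (1 <= i <= threshold a m n)%N ->
  DSC m n i Fc -> DC m n (i - 1) Fc.
Proof.
move=> /andP[i0 it] FDSC; have [[DC0 DC1] _] := FDSC.
have im : (0 < i <= m * (n - m))%N.
  by rewrite i0 (leq_trans it).
by split; apply: wDC_pred => // _; exact: size_upto.
Qed.

End Step.

Theorem lemma5p2 (R : realType) : AssertionE R -> AssertionD R.
Proof.
move=> AE a b m n F G Fc abmn Fcond Gcond Fcirc.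
have [delta [p [q [E [alpha D]]]]] := isFcirc_decomposition abmn Fcond Fcirc.
split=> i.
- exact: (wDC_x_pred AE abmn Fcond Gcond D).
- exact: (wDC_y_pred AE abmn Fcond Gcond D).
exact: (DSC_pred AE abmn Fcond Gcond D).
Qed.
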